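(* Let $x_1,x_2,x_3$ be three distinct points of $\mathbb{S}^2$. For all $i\geq 2$, the lower central series quotient $$\Gamma_i(B_2(\mathbb{S}^2\setminus\{x_1,x_2,x_3\}))/\Gamma_{i+1}(B_2(\mathbb{S}^2\setminus\{x_1,x_2,x_3\}))$$ is isomorphic to the direct sum of a finite number of copies of $\mathbb{Z}_2$.
   Context: For a surface $M$, $F_m(M)=\{(y_1,\ldots,y_m)\in M^m: y_i\neq y_j\text{ if }i\neq j\}$, and $B_m(M)=\pi_1(F_m(M)/S_m)$ is the $m$-string braid group of $M$. Lower central series: $\Gamma_1(G)=G$, $\Gamma_{i+1}(G)=[G,\Gamma_i(G)]$. $\mathbb{Z}_2$ is the cyclic group of order $2$. *)

(* Defs.v *)
From HB Require Import structures.
From mathcomp Require Import all_boot all_order all_algebra perm ring lra.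
From mathcomp Require Import boolp classical_sets functions set_interval.
From mathcomp Require Import reals topology normedtype homotopy.

Set Implicit Arguments.
Unset Strict Implicit.
Unset Printing Implicit Defensive.

Import Order.TTheory GRing.Theory Num.Theory numFieldNormedType.Exports.

Local Open Scope classical_set_scope.
Local Open Scope ring_scope.
Local Open Scope quotient_scope.

Definition unit_interval (R : realType) : Type := `[0 : R, 1]%classic.

Section UnitInterval.
Variable R : realType.
Local Notation I := (unit_interval R).

HB.instance Definition _ := SubType.copy I `[0 : R, 1]%classic.
HB.instance Definition _ := Topological.copy I `[0 : R, 1]%classic.

Lemma unit_interval_bounds (t : I) : 0 <= val t <= 1.
Proof. by have := valP t; rewrite inE /= in_itv. Qed.

Lemma clamp_subproof (t : R) :
  Num.max 0 (Num.min 1 t) \in `[0 : R, 1]%classic.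
Proof.
rewrite inE /= in_itv /= le_max lexx /= ge_max ler01 /=.
by rewrite ge_min lexx.
Qed.

(* The retraction of R onto [0, 1]. *)
Definition clamp (t : R) : I := Sub (Num.max 0 (Num.min 1 t)) (clamp_subproof t).

Lemma clampK (t : R) : 0 <= t <= 1 -> val (clamp t) = t.
Proof. by case/andP=> t0 t1; rewrite SubK (min_idPr t1) (max_idPr t0). Qed.

Lemma valK_clamp (t : I) : clamp (val t) = t.
Proof. by apply/val_inj/clampK/unit_interval_bounds. Qed.

Lemma zero_one_unit_interval : clamp 0 != clamp 1.
Proof.
apply/eqP => /(congr1 (val : I -> R)); rewrite !clampK ?lexx ?ler01 // => /eqP.
by rewrite eq_sym oner_eq0.
Qed.

HB.instance Definition _ := isBiPointed.Build I zero_one_unit_interval.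

Lemma val_zero : val (zero : I) = 0.
Proof. by apply: clampK; rewrite lexx ler01. Qed.

Lemma val_one : val (one : I) = 1.
Proof. by apply: clampK; rewrite lexx ler01. Qed.

Lemma clamp_le0 (t : R) : t <= 0 -> clamp t = zero.
Proof.
move=> t0; apply/val_inj; rewrite val_zero SubK; apply/max_idPl.
by rewrite ge_min t0 orbT.
Qed.

Lemma clamp_ge1 (t : R) : 1 <= t -> clamp t = one.
Proof.
move=> t1; apply/val_inj; rewrite val_one SubK (min_idPl t1).
exact/max_idPr/ler01.
Qed.

Lemma val_unit_interval_continuous : continuous (val : I -> R).
Proof. exact: initial_continuous. Qed.

Lemma to_unit_interval_continuous (X : topologicalType) (f : X -> I) :
  continuous (val \o f) -> continuous f.
Proof.
by move=> cf; apply/(continuous_comp_initial (f := f)).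
Qed.

Lemma clamp_continuous : continuous clamp.
Proof.
apply: to_unit_interval_continuous => t.
apply: (@continuous_max R R (cst 0) (Num.min 1)); first exact: cvg_cst.
by apply: (@continuous_min R R (cst 1) id); [exact: cvg_cst | exact: cvg_id].
Qed.

End UnitInterval.

Lemma pair_continuous (X A B : topologicalType) (f : X -> A) (g : X -> B) x :
  {for x, continuous f} -> {for x, continuous g} ->
  {for x, continuous (fun x => (f x, g x))}.
Proof. by move=> cf cg; apply: (cvg_pair (G := nbhs (f x)) (H := nbhs (g x))). Qed.

Section Pasting.
Variables (R : realType) (X T : topologicalType).

Lemma paste_continuous (u v : X -> R) (a b : X -> T) :
  continuous u -> continuous v -> continuous a -> continuous b ->
  (forall x, u x = v x -> a x = b x) ->
  continuous (fun x => if u x <= v x then a x else b x).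
Proof.
move=> cu cv ca cb uvab; set f := (f in continuous f).
have closed_uv (w1 w2 : X -> R) : continuous w1 -> continuous w2 ->
    closed [set x | w1 x <= w2 x].
  move=> cw1 cw2.
  rewrite [X in closed X](_ : _ = (w2 \- w1) @^-1` [set t | 0 <= t]).
    apply: preimage_closed; last exact: closed_ge.
    by move=> x _; apply: cvgB; [exact: cw2|exact: cw1].
  by apply/seteqP; split => x /=; rewrite subr_ge0.
have uvT : [set x | u x <= v x] `|` [set x | v x <= u x] = setT.
  apply/seteqP; split => // x _ /=.
  by case: (leP (u x) (v x)) => [|/ltW]; [left|right].
apply/continuous_subspace_setT; rewrite -uvT.
apply: withinU_continuous; [exact: closed_uv|exact: closed_uv| |].
  apply: (subspace_eq_continuous (f := a)); last exact: continuous_subspaceT.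
  by move=> x; rewrite inE /from_subspace /f /= => ->.
apply: (subspace_eq_continuous (f := b)); last exact: continuous_subspaceT.
move=> x; rewrite inE /from_subspace /f /= => vu; case: ifPn => // uv.
by apply/esym/uvab/le_anti/andP.
Qed.

End Pasting.

Section Paths.
Variables (R : realType) (T : topologicalType).
Local Notation I := (unit_interval R).

Definition path_homotopic x y (p q : {path I from x to y in T}) : Prop :=
  exists H : I * I -> T,
    [/\ continuous H,
        forall t, H (t, zero) = p t,
        forall t, H (t, one) = q t,
        forall s, H (zero, s) = x &
        forall s, H (one, s) = y].

Definition concat_fun (f g : I -> T) (t : I) : T :=
  if val t <= 2^-1 then f (clamp (2 * val t)) else g (clamp (2 * val t - 1)).

Lemma concat_fun0 (f g : I -> T) : concat_fun f g zero = f zero.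
Proof. by rewrite /concat_fun val_zero invr_ge0 ler0n mulr0. Qed.

Lemma concat_fun1 (f g : I -> T) : concat_fun f g one = g one.
Proof.
rewrite /concat_fun val_one lt_geF ?invf_lt1 ?ltr0n ?ltr1n// mulr1.
by rewrite -[2]natr1 addrK.
Qed.

Definition rev_fun (f : I -> T) (t : I) : T := f (clamp (1 - val t)).

Lemma affine_continuous (X : topologicalType) (c d : R) (u : X -> I) :
  continuous u -> continuous ((fun x => c * val (u x) + d) : X -> R).
Proof.
move=> cu x; apply: cvgD; last exact: cvg_cst.
apply: cvgM; first exact: cvg_cst.
by apply: continuous_comp; [exact: cu | exact: val_unit_interval_continuous].
Qed.

Lemma affine_clamp_continuous (X : topologicalType) (c d : R) (u : X -> I) :
  continuous u -> continuous (fun x => clamp (c * val (u x) + d)).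
Proof.
move=> cu x; apply: continuous_comp; last exact: clamp_continuous.
exact: affine_continuous.
Qed.

Lemma flip_zero : clamp (1 - val (zero : I)) = one.
Proof. by rewrite val_zero subr0. Qed.

Lemma flip_one : clamp (1 - val (one : I)) = zero.
Proof. by rewrite val_one subrr. Qed.

Lemma flip_clamp_continuous (X : topologicalType) (u : X -> I) :
  continuous u -> continuous (fun x => clamp (1 - val (u x))).
Proof.
move=> cu; have := affine_clamp_continuous (c := -1) (d := 1) cu.
by under eq_fun do rewrite mulN1r addrC.
Qed.

Lemma concat_continuous (X : topologicalType) (u : X -> I)
    (h k : I -> X -> T) :
  continuous u ->
  continuous (fun tx : I * X => h tx.1 tx.2) ->
  continuous (fun tx : I * X => k tx.1 tx.2) ->
  (forall x, h one x = k zero x) ->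
  continuous (fun x => concat_fun (h^~ x) (k^~ x) (u x)).
Proof.
move=> cu ch ck hk; rewrite /concat_fun.
have c2 : continuous (fun x => clamp (2 * val (u x))).
  have := affine_clamp_continuous (c := 2) (d := 0) cu.
  by under eq_fun do rewrite addr0.
apply: (@paste_continuous R X T (fun x => val (u x)) (fun=> 2^-1)
  (fun x => h (clamp (2 * val (u x))) x)
  (fun x => k (clamp (2 * val (u x) - 1)) x)).
- move=> x; apply: continuous_comp; first exact: cu.
  exact: val_unit_interval_continuous.
- by move=> x; exact: cvg_cst.
- move=> x; apply: (@continuous_comp _ _ _
    (fun x => (clamp (2 * val (u x)), x)) (fun tx : I * X => h tx.1 tx.2)).
    by apply: pair_continuous; [exact: c2 | exact: cvg_id].
  exact: (ch (clamp (2 * val (u x)), x)).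
- move=> x; apply: (@continuous_comp _ _ _
    (fun x => (clamp (2 * val (u x) - 1), x)) (fun tx : I * X => k tx.1 tx.2)).
    by apply: pair_continuous; [exact: (affine_clamp_continuous (d := -1)) | exact: cvg_id].
  exact: (ck (clamp (2 * val (u x) - 1), x)).
- by move=> x ->; rewrite divff ?pnatr_eq0// subrr; exact: hk.
Qed.


Lemma concat_fun_continuous (f g : I -> T) :
  continuous f -> continuous g -> f one = g zero -> continuous (concat_fun f g).
Proof.
move=> cf cg fg.
have c (h : I -> T) : continuous h -> continuous (h \o (@fst I I)).
  by move=> ch t; apply: continuous_comp; [exact: cvg_fst | exact: ch].
apply: (@concat_continuous I id (fun t _ => f t) (fun t _ => g t)) => //.
- by move=> t; exact: cvg_id.
- exact: (c f).
- exact: (c g).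
Qed.

Section Concat.
Variables (x y z : T).
Variables (p : {path I from x to y in T}) (q : {path I from y to z in T}).

Lemma concat_path_continuous : continuous (concat_fun p q).
Proof.
apply: concat_fun_continuous; [exact: (@cts_fun I T p)|exact: (@cts_fun I T q)|].
by rewrite path_one path_zero.
Qed.

Lemma concat_path_zero : concat_fun p q zero = x.
Proof. by rewrite concat_fun0 path_zero. Qed.

Lemma concat_path_one : concat_fun p q one = z.
Proof. by rewrite concat_fun1 path_one. Qed.

(* Follow p, then q, both at double speed. *)
Definition concat_path : {path I from x to z in T} :=
  mk_path concat_path_continuous concat_path_zero concat_path_one.

Lemma rev_path_continuous : continuous (rev_fun p).
Proof.
move=> t; apply: (@continuous_comp _ _ _ (fun t : I => clamp (1 - val t)) p);
  last exact: (@cts_fun I T p).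
by apply: (flip_clamp_continuous (u := id)) => s; exact: cvg_id.
Qed.

Lemma rev_path_zero : rev_fun p zero = y.
Proof. by rewrite /rev_fun val_zero subr0 path_one. Qed.

Lemma rev_path_one : rev_fun p one = x.
Proof. by rewrite /rev_fun val_one subrr path_zero. Qed.

Definition rev_path : {path I from y to x in T} :=
  mk_path rev_path_continuous rev_path_zero rev_path_one.

End Concat.

Definition cst_path x : {path I from x to x in T} := cst x.

Lemma reparam_homotopic x y x' y' (f : {path I from x' to y' in T})
    (phi psi : I -> I) (p q : {path I from x to y in T}) :
  continuous phi -> continuous psi ->
  phi zero = psi zero -> phi one = psi one ->
  p =1 f \o phi -> q =1 f \o psi -> path_homotopic p q.
Proof.
move=> cphi cpsi e0 e1 pE qE.
exists (fun ts => f (clamp ((1 - val ts.2) * val (phi ts.1)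
                            + val ts.2 * val (psi ts.1)))); split.
- move=> ts; apply: (@continuous_comp _ _ _ (fun ts : I * I =>
    clamp ((1 - val ts.2) * val (phi ts.1) + val ts.2 * val (psi ts.1))) f);
    last exact: (@cts_fun I T f).
  apply: continuous_comp; last exact: clamp_continuous.
  have c1 (chi : I -> I) : continuous chi ->
      {for ts, continuous (fun ts : I * I => val (chi ts.1))}.
    move=> cchi; apply: continuous_comp; last exact: val_unit_interval_continuous.
    by apply: continuous_comp; [exact: cvg_fst | exact: cchi].
  have c2 : {for ts, continuous (fun ts : I * I => val ts.2)}.
    apply: continuous_comp; last exact: val_unit_interval_continuous.
    exact: cvg_snd.
  apply: cvgD; apply: cvgM; [|exact: c1|exact: c2|exact: c1].
  by apply: cvgB; [exact: cvg_cst | exact: c2].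
- move=> t; rewrite pE; change (f (clamp ((1 - val (zero : I)) * val (phi t)
    + val (zero : I) * val (psi t))) = f (phi t)).
  by rewrite val_zero subr0 mul1r mul0r addr0 valK_clamp.
- move=> t; rewrite qE; change (f (clamp ((1 - val (one : I)) * val (phi t)
    + val (one : I) * val (psi t))) = f (psi t)).
  by rewrite val_one subrr mul1r mul0r add0r valK_clamp.
- move=> s; change (f (clamp ((1 - val s) * val (phi zero)
    + val s * val (psi zero))) = x).
  rewrite -e0 -mulrDl subrK mul1r valK_clamp.
  by rewrite -(path_zero (s := p)) pE.
- move=> s; change (f (clamp ((1 - val s) * val (phi one)
    + val s * val (psi one))) = y).
  rewrite -e1 -mulrDl subrK mul1r valK_clamp.
  by rewrite -(path_one (s := p)) pE.
Qed.

Lemma path_homotopic_refl x y (p : {path I from x to y in T}) :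
  path_homotopic p p.
Proof.
by apply: (@reparam_homotopic _ _ _ _ p id id) => // t; exact: cvg_id.
Qed.

Lemma path_homotopic_sym x y (p q : {path I from x to y in T}) :
  path_homotopic p q -> path_homotopic q p.
Proof.
move=> [H [cH Hp Hq Hx Hy]].
exists (fun ts => H (ts.1, clamp (1 - val ts.2))); split => //.
- move=> ts; apply: (@continuous_comp _ _ _
    (fun ts : I * I => (ts.1, clamp (1 - val ts.2))) H); last exact: cH.
  apply: pair_continuous; first exact: cvg_fst.
  by apply: (flip_clamp_continuous (u := snd)) => ?; exact: cvg_snd.
- by move=> t; rewrite -(Hq t); congr (H (_, _)); apply: flip_zero.
- by move=> t; rewrite -(Hp t); congr (H (_, _)); apply: flip_one.
Qed.

Lemma path_homotopic_trans x y (p q r : {path I from x to y in T}) :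
  path_homotopic p q -> path_homotopic q r -> path_homotopic p r.
Proof.
move=> [H [cH Hp Hq Hx Hy]] [K [cK Kq Kr Kx Ky]].
exists (fun ts => concat_fun (fun s => H (ts.1, s)) (fun s => K (ts.1, s)) ts.2).
have c (F : I * I -> T) : continuous F ->
    continuous (fun u : I * (I * I) => F (u.2.1, u.1)).
  move=> cF u; apply: (@continuous_comp _ _ _
    (fun u : I * (I * I) => (u.2.1, u.1)) F); last exact: cF.
  apply: pair_continuous; last exact: cvg_fst.
  by apply: (@continuous_comp _ _ _ snd fst); [exact: cvg_snd | exact: cvg_fst].
split.
- apply: (@concat_continuous _ snd (fun s ts => H (ts.1, s))
    (fun s ts => K (ts.1, s))); [move=> ts; exact: cvg_snd|exact: c|exact: c|].
  by move=> ts; rewrite Hq Kq.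
- by move=> t; rewrite concat_fun0 Hp.
- by move=> t; rewrite concat_fun1 Kr.
- by move=> s; rewrite /concat_fun; case: ifP => _; rewrite ?Hx ?Kx.
- by move=> s; rewrite /concat_fun; case: ifP => _; rewrite ?Hy ?Ky.
Qed.

Lemma concat_path_homotopic x y z (p p' : {path I from x to y in T})
    (q q' : {path I from y to z in T}) :
  path_homotopic p p' -> path_homotopic q q' ->
  path_homotopic (concat_path p q) (concat_path p' q').
Proof.
move=> [H [cH Hp Hq Hx Hy]] [K [cK Kq Kr Kx Ky]].
exists (fun ts => concat_fun (fun t => H (t, ts.2)) (fun t => K (t, ts.2)) ts.1).
have c (F : I * I -> T) : continuous F ->
    continuous (fun u : I * (I * I) => F (u.1, u.2.2)).
  move=> cF u; apply: (@continuous_comp _ _ _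
    (fun u : I * (I * I) => (u.1, u.2.2)) F); last exact: cF.
  apply: pair_continuous; first exact: cvg_fst.
  by apply: (@continuous_comp _ _ _ snd snd); exact: cvg_snd.
split.
- apply: (@concat_continuous _ fst (fun t ts => H (t, ts.2))
    (fun t ts => K (t, ts.2))); [move=> ts; exact: cvg_fst|exact: c|exact: c|].
  by move=> ts; rewrite Hy Kx.
- move=> t; change (concat_fun (fun t => H (t, zero)) (fun t => K (t, zero)) t
    = concat_fun p q t).
  by rewrite /concat_fun Hp Kq.
- move=> t; change (concat_fun (fun t => H (t, one)) (fun t => K (t, one)) t
    = concat_fun p' q' t).
  by rewrite /concat_fun Hq Kr.
- by move=> s; rewrite concat_fun0 Hx.
- by move=> s; rewrite concat_fun1 Ky.
Qed.

Lemma rev_path_homotopic x y (p q : {path I from x to y in T}) :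
  path_homotopic p q -> path_homotopic (rev_path p) (rev_path q).
Proof.
move=> [H [cH Hp Hq Hx Hy]].
exists (fun ts => H (clamp (1 - val ts.1), ts.2)); split => //.
- move=> ts; apply: (@continuous_comp _ _ _
    (fun ts : I * I => (clamp (1 - val ts.1), ts.2)) H); last exact: cH.
  apply: pair_continuous; last exact: cvg_snd.
  by apply: (flip_clamp_continuous (u := fst)) => ?; exact: cvg_fst.
- by move=> t; exact: Hp.
- by move=> t; exact: Hq.
- by move=> s; rewrite -[RHS](Hy s); congr (H (_, _)); apply: flip_zero.
- by move=> s; rewrite -[RHS](Hx s); congr (H (_, _)); apply: flip_one.
Qed.

Lemma affine_val_continuous (c d : R) :
  continuous ((fun t => c * val t + d) : I -> R).
Proof.
by apply: (@affine_continuous I c d id) => t; exact: cvg_id.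
Qed.

Lemma concat_pathA x y z w (p : {path I from x to y in T})
    (q : {path I from y to z in T}) (r : {path I from z to w in T}) :
  path_homotopic (concat_path p (concat_path q r))
                 (concat_path (concat_path p q) r).
Proof.
apply: path_homotopic_sym.
apply: (@reparam_homotopic _ _ _ _ (concat_path p (concat_path q r))
  (fun t => clamp (Num.min (2 * val t + 0)
                     (Num.min (1 * val t + 4^-1) (2^-1 * val t + 2^-1)))) id).
- move=> t; apply: continuous_comp; last exact: clamp_continuous.
  apply: continuous_min; first exact: affine_val_continuous.
  by apply: continuous_min; exact: affine_val_continuous.
- by move=> t; exact: cvg_id.
- by apply: clamp_le0; rewrite val_zero ge_min mulr0 add0r lexx.
- by apply: clamp_ge1; rewrite val_one !le_min; apply/and3P; split; lra.
- move=> t; change (concat_fun (concat_fun p q) r t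
    = concat_fun p (concat_fun q r) (clamp (Num.min (2 * val t + 0)
        (Num.min (1 * val t + 4^-1) (2^-1 * val t + 2^-1))))).
  have /andP[] := unit_interval_bounds t.
  rewrite addr0 mul1r /concat_fun; move: (val t) => s s0 s1.
  have [s4|s4] := leP s 4^-1.
    have -> : Num.min (2 * s) (Num.min (s + 4^-1) (2^-1 * s + 2^-1)) = 2 * s.
      by apply/min_idPl; rewrite le_min; apply/andP; split; lra.
    rewrite (@clampK _ (2 * s)); last by apply/andP; split; lra.
    have -> : s <= 2^-1 by lra.
    by have -> : 2 * s <= 2^-1 by lra.
  rewrite (min_idPr (x := 2 * s) _); last by rewrite ge_min; apply/orP; left; lra.
  have [s2|s2] := leP s 2^-1.
    rewrite (min_idPl (x := s + 4^-1) _); last by lra.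
    rewrite (@clampK _ (2 * s)); last by apply/andP; split; lra.
    rewrite (@clampK _ (s + 4^-1)); last by apply/andP; split; lra.
    have /lt_geF -> : 2^-1 < 2 * s by lra.
    have /lt_geF -> : 2^-1 < s + 4^-1 by lra.
    rewrite (@clampK _ (2 * (s + 4^-1) - 1)); last by apply/andP; split; lra.
    have -> : 2 * (s + 4^-1) - 1 <= 2^-1 by lra.
    by congr (q (clamp _)); lra.
  rewrite (min_idPr (x := s + 4^-1) _); last by lra.
  rewrite (@clampK _ (2^-1 * s + 2^-1)); last by apply/andP; split; lra.
  have /lt_geF -> : 2^-1 < 2^-1 * s + 2^-1 by lra.
  rewrite (@clampK _ (2 * (2^-1 * s + 2^-1) - 1));
    last by apply/andP; split; lra.
  have /lt_geF -> : 2^-1 < 2 * (2^-1 * s + 2^-1) - 1 by lra.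
  by congr (r (clamp _)); lra.
- by [].
Qed.

Lemma concat_cst_path x y (p : {path I from x to y in T}) :
  path_homotopic (concat_path (cst_path x) p) p.
Proof.
apply: (@reparam_homotopic _ _ _ _ p (fun t => clamp (2 * val t - 1)) id) => //.
- by apply: affine_clamp_continuous => t; exact: cvg_id.
- by move=> t; exact: cvg_id.
- by apply: clamp_le0; rewrite val_zero; lra.
- by apply: clamp_ge1; rewrite val_one; lra.
- move=> t; change (concat_fun (cst x) p t = p (clamp (2 * val t - 1))).
  rewrite /concat_fun; case: ifP => // t2.
  by rewrite (@clamp_le0 _ (2 * val t - 1)) ?path_zero//; lra.
Qed.

Lemma concat_path_cst x y (p : {path I from x to y in T}) :
  path_homotopic (concat_path p (cst_path y)) p.
Proof.
apply: (@reparam_homotopic _ _ _ _ p (fun t => clamp (2 * val t + 0)) id) => //.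
- by apply: affine_clamp_continuous => t; exact: cvg_id.
- by move=> t; exact: cvg_id.
- by apply: clamp_le0; rewrite val_zero; lra.
- by apply: clamp_ge1; rewrite val_one; lra.
- move=> t; change (concat_fun p (cst y) t = p (clamp (2 * val t + 0))).
  rewrite addr0 /concat_fun; case: leP => // t2.
  by rewrite (@clamp_ge1 _ (2 * val t)) ?path_one//; lra.
Qed.

Lemma fold_continuous (c d : R) :
  continuous (fun t : I => clamp (c * `|2 * val t - 1| + d)).
Proof.
suff cn (X : topologicalType) (u : X -> I) : continuous u ->
    continuous (fun x => clamp (c * `|2 * val (u x) - 1| + d)).
  by apply: (cn I id) => t; exact: cvg_id.
move=> cu x; apply: continuous_comp; last exact: clamp_continuous.
apply: cvgD; last exact: cvg_cst.
apply: cvgM; first exact: cvg_cst.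
by apply: cvg_norm; exact: (affine_continuous (c := 2) (d := -1)).
Qed.

Lemma concat_rev_path x y (p : {path I from x to y in T}) :
  path_homotopic (concat_path (rev_path p) p) (cst_path y).
Proof.
apply: (@reparam_homotopic _ _ _ _ p
  (fun t => clamp (1 * `|2 * val t - 1| + 0)) (cst one)).
- exact: fold_continuous.
- exact: cst_continuous.
- by apply: clamp_ge1; rewrite val_zero mulr0 sub0r normrN normr1; lra.
- by apply: clamp_ge1; rewrite val_one mulr1 -[2]natr1 addrK normr1; lra.
- move=> t; change (concat_fun (rev_fun p) p t = p (clamp (1 * `|2 * val t - 1| + 0))).
  have /andP[] := unit_interval_bounds t.
  rewrite /concat_fun /rev_fun; move: (val t) => s s0 s1.
  case: leP => s2.
    rewrite clampK; last by apply/andP; split; lra.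
    by rewrite ler0_norm; [congr (p (clamp _))|]; lra.
  by rewrite ger0_norm; [congr (p (clamp _))|]; lra.
- by move=> t; exact/esym/(path_one (s := p)).
Qed.

Lemma concat_path_rev x y (p : {path I from x to y in T}) :
  path_homotopic (concat_path p (rev_path p)) (cst_path x).
Proof.
apply: (@reparam_homotopic _ _ _ _ p
  (fun t => clamp (-1 * `|2 * val t - 1| + 1)) (cst zero)).
- exact: fold_continuous.
- exact: cst_continuous.
- by apply: clamp_le0; rewrite val_zero mulr0 sub0r normrN normr1; lra.
- by apply: clamp_le0; rewrite val_one mulr1 -[2]natr1 addrK normr1; lra.
- move=> t; change (concat_fun p (rev_fun p) t = p (clamp (-1 * `|2 * val t - 1| + 1))).
  have /andP[] := unit_interval_bounds t.
  rewrite /concat_fun /rev_fun; move: (val t) => s s0 s1.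
  case: leP => s2.
    by rewrite ler0_norm; [congr (p (clamp _))|]; lra.
  rewrite clampK; last by apply/andP; split; lra.
  by rewrite ger0_norm; [congr (p (clamp _))|]; lra.
- by move=> t; exact/esym/(path_zero (s := p)).
Qed.

End Paths.

Section FundamentalGroup.
Variables (R : realType) (T : topologicalType) (x0 : T).

Definition loop : Type := {path unit_interval R from x0 to x0 in T}.

HB.instance Definition _ := gen_eqMixin loop.
HB.instance Definition _ := gen_choiceMixin loop.

Definition loop_homotopic (p q : loop) : bool := `[< path_homotopic p q >].

Lemma loop_homotopic_equiv : equiv_class_of loop_homotopic.
Proof.
split=> [p|p q|q p r]; first exact/asboolP/path_homotopic_refl.
  by apply/asboolP/asboolP => /path_homotopic_sym.
by move=> /asboolP pq /asboolP qr; exact/asboolP/(path_homotopic_trans pq).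
Qed.

Canonical loop_homotopic_equiv_rel := EquivRelPack loop_homotopic_equiv.

Definition fundamental_group : Type := {eq_quot loop_homotopic}.
Local Notation pi1 := fundamental_group.

HB.instance Definition _ := Choice.copy pi1 {eq_quot loop_homotopic}.
HB.instance Definition _ := Quotient.copy pi1 {eq_quot loop_homotopic}.

Lemma loop_classP (p q : loop) :
  \pi_pi1 p = \pi_pi1 q <-> path_homotopic p q.
Proof. by split=> [/eqmodP/asboolP|pq] //; apply/eqmodP/asboolP. Qed.

Definition pi1_one : pi1 := \pi_pi1 (cst_path R x0 : loop).
Definition pi1_mul (a b : pi1) : pi1 :=
  \pi_pi1 (concat_path (repr a) (repr b) : loop).
Definition pi1_inv (a : pi1) : pi1 := \pi_pi1 (rev_path (repr a) : loop).

Lemma repr_loop_class (p : loop) : path_homotopic (repr (\pi_pi1 p)) p.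
Proof. by apply/loop_classP; rewrite reprK. Qed.

Lemma pi1_mulE (p q : loop) :
  pi1_mul (\pi_pi1 p) (\pi_pi1 q) = \pi_pi1 (concat_path p q : loop).
Proof. by apply/loop_classP/concat_path_homotopic; exact: repr_loop_class. Qed.

Lemma pi1_invE (p : loop) : pi1_inv (\pi_pi1 p) = \pi_pi1 (rev_path p : loop).
Proof. exact/loop_classP/rev_path_homotopic/repr_loop_class. Qed.

Lemma pi1_mulA : associative pi1_mul.
Proof.
elim/quotW=> p; elim/quotW=> q; elim/quotW=> r.
rewrite (pi1_mulE q r) (pi1_mulE p q) (pi1_mulE p) (pi1_mulE _ r).
by apply/loop_classP; exact: concat_pathA.
Qed.

Lemma pi1_mul1 : left_id pi1_one pi1_mul.
Proof. by elim/quotW=> p; rewrite pi1_mulE; apply/loop_classP; exact: concat_cst_path. Qed.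

Lemma pi1_1mul : right_id pi1_one pi1_mul.
Proof. by elim/quotW=> p; rewrite pi1_mulE; apply/loop_classP; exact: concat_path_cst. Qed.

Lemma pi1_mulV : left_inverse pi1_one pi1_inv pi1_mul.
Proof.
by elim/quotW=> p; rewrite pi1_invE pi1_mulE; apply/loop_classP; exact: concat_rev_path.
Qed.

Lemma pi1_Vmul : right_inverse pi1_one pi1_inv pi1_mul.
Proof.
by elim/quotW=> p; rewrite pi1_invE pi1_mulE; apply/loop_classP; exact: concat_path_rev.
Qed.

HB.instance Definition _ :=
  isGroup.Build pi1 pi1_mulA pi1_mul1 pi1_1mul pi1_mulV pi1_Vmul.

End FundamentalGroup.

Definition group_isomorphic (G H : groupType) : Prop :=
  exists f : {multiplicative G -> H}, bijective f.

Section LowerCentralSeries.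
Local Open Scope group_scope.
Variable G : groupType.

Definition is_subgroup (S : set G) : Prop := group_closed (fun x => x \in S).

Lemma is_subgroupP (S : set G) :
  is_subgroup S <-> S 1 /\ (forall x y, S x -> S y -> S (x / y)).
Proof.
split=> [[S1 SF]|[S1 SF]]; split=> [|x y].
- exact/set_mem.
- by move=> Sx Sy; apply/set_mem/SF; exact/mem_set.
- exact/mem_set.
- by move=> /set_mem Sx /set_mem Sy; exact/mem_set/SF.
Qed.

Definition commutator_subgroup (A B : set G) : set G :=
  smallest is_subgroup [set [~ a, b] | a in A & b in B].

(* Gamma_1 = G and Gamma_(i+1) = [G, Gamma_i]; index 0 is a dummy, equal to G. *)
Definition lower_central_series (i : nat) : set G :=
  iter i.-1 (commutator_subgroup [set: G]) [set: G].

Local Notation Gamma := lower_central_series.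

Lemma lower_central_seriesS i : (0 < i)%N ->
  Gamma i.+1 = commutator_subgroup [set: G] (Gamma i).
Proof. by case: i. Qed.

Lemma commutator_subgroup_is_subgroup (A B : set G) :
  is_subgroup (commutator_subgroup A B).
Proof.
apply/is_subgroupP; split=> [|x y Cx Cy] S [/[dup] + /is_subgroupP[S1 SF] SAB] //.
by move=> gS; apply: SF; [exact: Cx | exact: Cy].
Qed.

Lemma lower_central_series_is_subgroup i : is_subgroup (Gamma i).
Proof.
rewrite /Gamma; case: i.-1 => [|k] /=; first exact/is_subgroupP.
exact: commutator_subgroup_is_subgroup.
Qed.

Lemma lower_central_series_conj i x y : Gamma i x -> Gamma i (x ^ y).
Proof.
rewrite /Gamma; elim: i.-1 x y => [//|k IHk] x y /= Gx S [/is_subgroupP[S1 SF] SR].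
suff : ((fun z => z ^ y) @^-1` S) x by [].
apply: Gx; split; last first.
  move=> _ [a _] [b Gb <-] /=; rewrite conjRg; apply: SR.
  by exists (a ^ y) => //; exists (b ^ y) => //; exact: IHk.
apply/is_subgroupP; split=> [|u v] /=; first by rewrite conj1g.
by rewrite conjMg conjVg; exact: SF.
Qed.

Lemma lower_central_seriesV i x : Gamma i x -> Gamma i x^-1.
Proof.
have /is_subgroupP[G1 GF] := lower_central_series_is_subgroup i.
by move=> Gx; rewrite -div1g; exact: GF.
Qed.

Lemma lower_central_seriesM i x y : Gamma i x -> Gamma i y -> Gamma i (x * y).
Proof.
have /is_subgroupP[G1 GF] := lower_central_series_is_subgroup i.
by move=> Gx Gy; rewrite -(invgK y); apply: GF => //; exact: lower_central_seriesV.
Qed.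

Lemma lower_central_series_sub i : Gamma i.+1 `<=` Gamma i.
Proof.
case: i => [//|i]; rewrite lower_central_seriesS//.
apply: smallest_sub; first exact: lower_central_series_is_subgroup.
move=> _ [a _] [b Gb <-]; rewrite -invgR commgEl.
apply/lower_central_seriesV/lower_central_seriesM => //.
  exact: lower_central_seriesV.
exact: lower_central_series_conj.
Qed.

End LowerCentralSeries.

Arguments lower_central_series : clear implicits.

Section LowerCentralQuotient.
Local Open Scope group_scope.
Variables (G : groupType) (i : nat).

Definition lower_central_group : Type := lower_central_series G i.
Local Notation H := lower_central_group.

HB.instance Definition _ := SubChoice.copy H (lower_central_series G i).
HB.instance Definition _ := SubChoice_isSubGroup.Build G _ H
  (lower_central_series_is_subgroup G i).

Definition lower_central_rel (a b : H) : bool :=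
  (val a)^-1 * val b \in lower_central_series G i.+1.

Let closedV u : u \in lower_central_series G i.+1 ->
  u^-1 \in lower_central_series G i.+1.
Proof. by move=> /set_mem Gu; exact/mem_set/lower_central_seriesV. Qed.

Let closedM u v : u \in lower_central_series G i.+1 ->
  v \in lower_central_series G i.+1 ->
  u * v \in lower_central_series G i.+1.
Proof. by move=> /set_mem Gu /set_mem Gv; exact/mem_set/lower_central_seriesM. Qed.

Let closedJ u v : u \in lower_central_series G i.+1 ->
  u ^ v \in lower_central_series G i.+1.
Proof. by move=> /set_mem Gu; apply/mem_set/lower_central_series_conj. Qed.

Lemma lower_central_rel_equiv : equiv_class_of lower_central_rel.
Proof.
rewrite /lower_central_rel; split=> [a|a b|b a c].
- by rewrite mulVg; exact: (lower_central_series_is_subgroup G i.+1).1.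
- by apply/idP/idP => /closedV; rewrite invgM invgK.
- move=> ab bc; have := closedM ab bc.
  by rewrite -mulgA mulVKg.
Qed.

Canonical lower_central_equiv_rel := EquivRelPack lower_central_rel_equiv.

(* Left cosets of Gamma_(i+1), i.e. the quotient group Gamma_i / Gamma_(i+1). *)
Definition lower_central_quotient : Type := {eq_quot lower_central_rel}.
Local Notation Q := lower_central_quotient.

HB.instance Definition _ := Choice.copy Q {eq_quot lower_central_rel}.
HB.instance Definition _ := Quotient.copy Q {eq_quot lower_central_rel}.

Lemma lower_central_classP (a b : H) :
  \pi_Q a = \pi_Q b <->
  lower_central_series G i.+1 ((val a)^-1 * val b).
Proof. by split=> [/eqmodP/set_mem|ab] //; apply/eqmodP/mem_set. Qed.

Definition lcq_one : Q := \pi_Q 1.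
Definition lcq_mul (u v : Q) : Q := \pi_Q (repr u * repr v).
Definition lcq_inv (u : Q) : Q := \pi_Q (repr u)^-1.

Let reprP (a : H) :
  (val (repr (\pi_Q a)))^-1 * val a \in lower_central_series G i.+1.
Proof. by apply/mem_set/lower_central_classP; rewrite reprK. Qed.

Lemma lcq_mulE (a b : H) : lcq_mul (\pi_Q a) (\pi_Q b) = \pi_Q (a * b).
Proof.
apply/lower_central_classP/set_mem.
move: (repr (\pi_Q a)) (repr (\pi_Q b)) (reprP a) (reprP b) => a' b' aa' bb'.
have := closedM bb' (closedJ (val b) aa').
by rewrite !valM invgM /conjg !mulgA mulgK.
Qed.

Lemma lcq_invE (a : H) : lcq_inv (\pi_Q a) = \pi_Q a^-1.
Proof.
apply/lower_central_classP/set_mem.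
move: (repr (\pi_Q a)) (reprP a) => a' aa'.
have := closedJ (val a)^-1 (closedV aa').
by rewrite !gmulfV invgM /conjg !invgK !mulgA mulgV mul1g.
Qed.

Lemma lcq_mulA : associative lcq_mul.
Proof.
elim/quotW=> a; elim/quotW=> b; elim/quotW=> c.
by rewrite (lcq_mulE b c) (lcq_mulE a b) (lcq_mulE a) (lcq_mulE _ c) mulgA.
Qed.

Lemma lcq_mul1 : left_id lcq_one lcq_mul.
Proof. by elim/quotW=> a; rewrite (lcq_mulE 1 a) mul1g. Qed.

Lemma lcq_1mul : right_id lcq_one lcq_mul.
Proof. by elim/quotW=> a; rewrite (lcq_mulE a 1) mulg1. Qed.

Lemma lcq_mulV : left_inverse lcq_one lcq_inv lcq_mul.
Proof. by elim/quotW=> a; rewrite lcq_invE (lcq_mulE _ a) mulVg. Qed.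

Lemma lcq_Vmul : right_inverse lcq_one lcq_inv lcq_mul.
Proof. by elim/quotW=> a; rewrite lcq_invE (lcq_mulE a) mulgV. Qed.

HB.instance Definition _ :=
  isGroup.Build Q lcq_mulA lcq_mul1 lcq_1mul lcq_mulV lcq_Vmul.

End LowerCentralQuotient.

(* F_m(M), with the topology induced by the product topology on M^m. *)
Definition configuration_space (m : nat) (M : topologicalType) :
    topologicalType :=
  [set y : {ptws 'I_m -> M} | forall i j : 'I_m, i != j -> y i <> y j].

Section UnorderedConfigurations.
Variables (m : nat) (M : topologicalType).

Definition same_orbit (y z : configuration_space m M) : bool :=
  `[< exists s : 'S_m, forall i : 'I_m, val z i = val y (s i) >].

Lemma same_orbit_equiv : equiv_class_of same_orbit.
Proof.
have sym y z : same_orbit y z -> same_orbit z y.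
  move=> /asboolP[s yz]; apply/asboolP; exists s^-1%g => i.
  by rewrite yz permKV.
split=> [y|y z|z y w].
- by apply/asboolP; exists 1%g => i; rewrite perm1.
- by apply/idP/idP; exact: sym.
- move=> /asboolP[s yz] /asboolP[t zw]; apply/asboolP.
  by exists (t * s)%g => i; rewrite zw yz permM.
Qed.

Canonical same_orbit_equiv_rel := EquivRelPack same_orbit_equiv.

(* The orbit space F_m(M)/S_m, with the quotient topology. *)
Definition unordered_configuration_space : topologicalType :=
  quotient_topology {eq_quot same_orbit}.

End UnorderedConfigurations.

(* B_m(M), based at an arbitrary point c of F_m(M)/S_m. *)
Definition braid_group (R : realType) (m : nat) (M : topologicalType)
    (c : unordered_configuration_space m M) : groupType :=
  fundamental_group R c.

Definition sphere2 (R : realType) : topologicalType :=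
  [set v : 'rV[R]_3 | \sum_(i < 3) v ord0 i ^+ 2 = 1].

Definition punctured_sphere (R : realType) (x1 x2 x3 : sphere2 R) :
    topologicalType :=
  ~` [set x1; x2; x3].

(* Main.v *)
(* Stereographic projection from x3 identifies the punctured sphere with
   C \ {0, 1}, and an unordered pair {y, z} of points of C \ {0, 1} is recorded by
   A = y z, B = (1 - y)(1 - z). The configuration space becomes the complement in
   C^2 of the lines A = 0 and B = 0 and of the conic on which y = z, which is tangent
   to both lines. Its fundamental group is normally generated by meridians a, b of the
   lines and s of the conic. Two local computations give relations: the lines cross
   transversally, so some conjugates of a and b commute; near each tangency point the
   orbits of a weighted circle action are central in the local group, and one of them
   is a product of conjugates squared, (s a)^2, so that it commutes with a meridian of
   the conic. Modulo Gamma_3 the relations give [a, b] = 1 and [s, a]^2 = [s, b]^2 = 1;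
   since a, b, s generate the abelianization, Gamma_2/Gamma_3 has exponent 2, and
   commutators propagate this to every Gamma_i/Gamma_(i+1), which is finitely
   generated because the abelianization is. *)

Require Import Defs.
From HB Require Import structures.
From mathcomp Require Import all_boot all_order all_algebra perm ring lra.
From mathcomp Require Import complex.
From mathcomp Require Import boolp classical_sets functions set_interval.
From mathcomp Require Import reals topology normedtype homotopy realfun.

Set Implicit Arguments.
Unset Strict Implicit.
Unset Printing Implicit Defensive.

Import Order.TTheory GRing.Theory Num.Theory numFieldNormedType.Exports.

Local Open Scope classical_set_scope.
Local Open Scope ring_scope.
Local Open Scope complex_scope.

(** * Lower central series of a normally generated group *)

(** The main obstacle is generation: every loop must be shown to lie in any normal subgroup [N] that
    contains the three meridians, with neither van Kampen's theorem nor a cell structure at hand.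
    Paths in C^2 are seen only through a map [Phi] to the group, subject to two axioms
    ([transport]). A subset of C^2 is [good] when, modulo [N], [Phi] has a potential on those of its
    paths that avoid the curves. The subset itself may contain points of the curves, so it can be a
    convex open set, whose part off the curves is connected by generic broken lines; this
    connectedness is what lets potentials on overlapping sets be glued. A meridian in [N] means that
    goodness extends across its curve. Relations are only found up to conjugating the meridians in
    them. This is harmless, since conjugating an entry changes a commutator only modulo Gamma_3.
    Loops run round squares instead of circles: that a homotopy avoids the curves then becomes a
    polynomial inequality over [R]. *)

Section NormalSubsets.
Local Open Scope group_scope.
Variable G : groupType.
Local Notation Gamma := (lower_central_series G).

(** Normal subgroups as predicates: congruence modulo [N] is written as membership of x y^-1, and no
    quotient group is formed. *)
Record normal_subset (N : set G) : Prop := NormalSubset {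
  normal1 : N 1;
  normalM : forall x y, N x -> N y -> N (x * y);
  normalV : forall x, N x -> N x^-1;
  normalJ : forall x y, N x -> N (x ^ y) }.

Lemma normal_Gamma i : normal_subset (Gamma i).
Proof.
split; [|exact: lower_central_seriesM|exact: lower_central_seriesV|].
  by have /is_subgroupP[] := lower_central_series_is_subgroup G i.
exact: lower_central_series_conj.
Qed.

Lemma normalVE N x : normal_subset N -> N x^-1 -> N x.
Proof. by move=> nN /(normalV nN); rewrite invgK. Qed.

Lemma normalJE N x y : normal_subset N -> N (x ^ y) -> N x.
Proof. by move=> nN /(normalJ nN (y^-1)); rewrite conjgK. Qed.

Lemma normalRC N x y : normal_subset N -> N [~ x, y] -> N [~ y, x].
Proof. by move=> nN h; apply: normalVE => //; rewrite invgR. Qed.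

Lemma normalMlE N x y : normal_subset N -> N x -> N (x * y) -> N y.
Proof.
by move=> nN Nx Nxy; rewrite -(mulKg x y); apply: (normalM nN) => //; apply: (normalV nN).
Qed.

Lemma normalMrE N x y : normal_subset N -> N y -> N (x * y) -> N x.
Proof.
by move=> nN Ny Nxy; rewrite -(mulgK y x); apply: (normalM nN) => //; apply: (normalV nN).
Qed.

Lemma GammaR i g c : (0 < i)%N -> Gamma i c -> Gamma i.+1 [~ g, c].
Proof.
move=> i0 Gc; rewrite lower_central_seriesS// => S [_]; apply.
by exists g => //; exists c.
Qed.

Lemma GammaRr i g c : (0 < i)%N -> Gamma i c -> Gamma i.+1 [~ c, g].
Proof. by move=> i0 Gc; apply: normalRC (normal_Gamma _) _; exact: GammaR. Qed.

Lemma Gamma2 g c : Gamma 2 [~ g, c].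
Proof. exact: (@GammaR 1). Qed.

Lemma Gamma_ind i (H : set G) : (0 < i)%N -> normal_subset H ->
  (forall x c, Gamma i c -> H [~ x, c]) -> Gamma i.+1 `<=` H.
Proof.
move=> i0 nH hH; rewrite lower_central_seriesS// => x; apply; split.
  apply/is_subgroupP; split; first exact: (normal1 nH).
  by move=> u v Hu Hv; apply: (normalM nH) => //; apply: (normalV nH).
by move=> _ [g _] [c Gc <-]; exact: hH.
Qed.

Lemma commg_mull (x y c : G) : [~ x * y, c] = [~ x, c] ^ y * [~ y, c].
Proof. by rewrite /commg /conjg !invgM !mulgA !mulgK. Qed.

Lemma commg_mulr (x c d : G) : [~ x, c * d] = [~ x, d] * [~ x, c] ^ d.
Proof. by rewrite /commg /conjg !invgM !mulgA !mulgK. Qed.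

Lemma commgV_l (x c : G) : [~ x^-1, c] = ([~ x, c] ^ x^-1)^-1.
Proof.
apply/(@mulgI _ ([~ x, c] ^ x^-1)); rewrite mulgV -commg_mull mulgV.
by rewrite comm1g.
Qed.

Lemma commgV_r (x c : G) : [~ x, c^-1] = ([~ x, c] ^ c^-1)^-1.
Proof.
by apply/(@mulIg _ ([~ x, c] ^ c^-1)); rewrite mulVg -commg_mulr mulgV commg1.
Qed.

(** By [xy, c] = [x, c]^y [y, c], and because a conjugation of [x] can be moved onto [c], [Gamma i]
    being normal. Statements on all [x] thereby reduce to normal generators. *)
Lemma commutatorl_normal i (H : set G) : normal_subset H ->
  normal_subset [set x | forall c, Gamma i c -> H [~ x, c]].
Proof.
move=> nH; split=> [c _|x y Hx Hy c Gc|x Hx c Gc|x g Hx c Gc] /=.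
- by rewrite comm1g; exact: (normal1 nH).
- rewrite commg_mull; apply: (normalM nH) => //; last exact: Hy.
  by apply: (normalJ nH) => //; exact: Hx.
- by rewrite commgV_l; apply: (normalV nH); apply: (normalJ nH); exact: Hx.
- rewrite -(conjgKV g c) -conjRg; apply: (normalJ nH); apply: Hx.
  exact: (normalJ (normal_Gamma i)).
Qed.

(** [x ^ g] is [x] times a commutator, and the commutator of that with [c] lies in [Gamma 3]. *)
Lemma commutator_Jl (H : set G) x g c : normal_subset H -> Gamma 3 `<=` H ->
  H [~ x, c] -> H [~ x ^ g, c].
Proof.
move=> nH H3 Hx; have -> : x ^ g = x * [~ x, g] by rewrite commgEl mulVKg.
rewrite commg_mull; apply: (normalM nH) => //; first exact: (normalJ nH).
by apply: H3; apply: (@GammaRr 2) => //; exact: Gamma2.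
Qed.

Lemma commutator_JlE (H : set G) x g c : normal_subset H -> Gamma 3 `<=` H ->
  H [~ x ^ g, c] -> H [~ x, c].
Proof. by move=> nH H3 /(commutator_Jl g^-1 nH H3); rewrite conjgK. Qed.

Lemma commutator_JrE (H : set G) x g c : normal_subset H -> Gamma 3 `<=` H ->
  H [~ c, x ^ g] -> H [~ c, x].
Proof.
by move=> nH H3 /(normalRC nH)/(commutator_JlE nH H3)/(normalRC nH).
Qed.

(** Here the other entry is one fixed element, so a conjugation is absorbed by [Gamma 3] instead of
    being moved across. *)
Lemma commutatorr_normal (H : set G) x : normal_subset H -> Gamma 3 `<=` H ->
  normal_subset [set c | H [~ c, x]].
Proof.
move=> nH H3; split=> [|c d Hc Hd|c Hc|c g Hc] /=.
- by rewrite comm1g; exact: (normal1 nH).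
- by rewrite commg_mull; apply: (normalM nH) => //; exact: (normalJ nH).
- by rewrite commgV_l; apply: (normalV nH); exact: (normalJ nH).
- exact: commutator_Jl.
Qed.

(** For i > 1, the preimage in [Gamma i.-1] of the 2-torsion of the abelian group [Gamma i.-1] /
    [Gamma i]. *)
Definition square_in (i : nat) : set G := [set u | Gamma i.-1 u /\ Gamma i (u * u)].

Lemma square_in_normal i : (1 < i)%N -> normal_subset (square_in i).
Proof.
case: i => [//|[//|i]] _; have nG k := normal_Gamma k.
split=> [|x y [Gx Gxx] [Gy Gyy]|x [Gx Gxx]|x y [Gx Gxx]].
- by split; rewrite ?mulg1; exact: (normal1 (nG _)).
- split; first exact: (normalM (nG _)).
  have -> : x * y * (x * y) = x * x * (y * y) * [~ y, x] ^ y.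
    by rewrite /commg /conjg !mulgA !(mulgK, mulgVK).
  apply: (normalM (nG _)) => //; first exact: (normalM (nG _)).
  by apply: (normalJ (nG _)) => //; exact: GammaR.
- by split; rewrite -?invgM; exact: (normalV (nG _)).
- by split; rewrite -?conjMg; exact: (normalJ (nG _)).
Qed.

Lemma square_in_Gamma i : (1 < i)%N -> Gamma i `<=` square_in i.
Proof.
case: i => [//|i] _ x Gx; split; last exact: lower_central_seriesM.
exact: lower_central_series_sub.
Qed.

End NormalSubsets.
Arguments square_in : clear implicits.

Section Criterion.
Local Open Scope group_scope.
Variable G : groupType.
Variables a b s : G.
Local Notation Gamma := (lower_central_series G).

Hypothesis gen : forall N : set G, normal_subset N -> N a -> N b -> N s ->
  forall x, N x.

Hypothesis ab : exists x y, commute (a ^ x) (b ^ y).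

(* For meridians [s], [t] of two curves tangent at a point, (s t)^2 is, up to
   conjugating its factors, the generic orbit of the weighted circle action. *)
Definition tangency_relation (t : G) :=
  exists g1 g2 g3 g4,
    commute (((s ^ g1 * t ^ g2) * (s ^ g1 * t ^ g2)) ^ g3) (s ^ g4).

Hypothesis as_ : tangency_relation a.
Hypothesis bs_ : tangency_relation b.

Let nG := normal_Gamma G.

(** With u = s^g1 t^g2 the relation puts [u^2, s] in [Gamma 3], and this is [u, s]^2 up to
    [Gamma 3]. In the expansion of [u, s] the factor coming from s^g1 is harmless because [s, s] =
    1. *)
Lemma tangency_square t : tangency_relation t -> square_in G 3 [~ t, s].
Proof.
move=> [g1 [g2 [g3 [g4 /commgP/eqP]]]] e.
have nS := square_in_normal G (isT : (1 < 3)%N); have S3 := @square_in_Gamma G 3 isT.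
have {e} : Gamma 3 [~ s ^ g1 * t ^ g2 * (s ^ g1 * t ^ g2), s].
  apply: (commutator_JlE (g := g3) (nG 3) (@subset_refl _ _)).
  apply: (commutator_JrE (g := g4) (nG 3) (@subset_refl _ _)).
  by rewrite e; exact: (normal1 (nG 3)).
set u := s ^ g1 * t ^ g2; rewrite commg_mull => h.
have {h} Su : square_in G 3 [~ u, s].
  split; first exact: Gamma2.
  have E (v : G) : v ^ u * v = v * v * [~ v, u] ^ v.
    by rewrite /commg /conjg !mulgA !(mulgK, mulgVK, mulgV, mul1g).
  move: h; rewrite E => h; refine (normalMrE (nG 3) _ h).
  by apply: (normalJ (nG 3)); apply: (@GammaRr _ 2) => //; exact: Gamma2.
apply: (commutator_JlE (g := g2) nS S3).
move: Su; rewrite /u commg_mull; apply: (normalMlE nS).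
apply: (normalJ nS); apply: (commutator_Jl _ nS S3).
by rewrite commgg; exact: (normal1 nS).
Qed.

Lemma generator_square x : x = a \/ x = b \/ x = s ->
  forall c, square_in G 3 [~ x, c].
Proof.
have nS := square_in_normal G (isT : (1 < 3)%N); have S3 := @square_in_Gamma G 3 isT.
have Sas := tangency_square as_; have Sbs := tangency_square bs_.
have Sab : square_in G 3 [~ a, b].
  have [x1 [x2 /commgP/eqP e]] := ab.
  apply: (commutator_JlE (g := x1) nS S3); apply: (commutator_JrE (g := x2) nS S3).
  by rewrite e; exact: (normal1 nS).
have Sxx z : square_in G 3 [~ z, z] by rewrite commgg; exact: (normal1 nS).
move=> xE c; apply: (normalRC nS).
apply: (gen (commutatorr_normal x nS S3)) => /=.
- by case: xE => [->|[->|->]] //; apply: (normalRC nS).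
- by case: xE => [->|[->|->]] //; apply: (normalRC nS).
- by case: xE => [->|[->|->]] //; apply: (normalRC nS).
Qed.

(** Inductive step: if c is in Gamma_k and c^2 in Gamma_(k+1), put v = [y, c]. Then [y, c^2] = v v^c
    lies in Gamma_(k+2) and differs from v^2 by [v, c], which lies there too. *)
Lemma Gamma_square i x : (1 < i)%N -> Gamma i x -> Gamma i.+1 (x * x).
Proof.
case: i => [//|[//|i]] _; elim: i x => [|i IH] x Gx.
  have nS := square_in_normal G (isT : (1 < 3)%N).
  suff /(_ x Gx)[] : Gamma 2 `<=` square_in G 3 by [].
  apply: Gamma_ind => // y c _; move: c.
  have /gen : normal_subset [set y | forall c, square_in G 3 [~ y, c]].
    have := commutatorl_normal 1 nS; congr normal_subset.
    by apply/seteqP; split => z h c; [exact: h|move=> _; exact: h].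
  by apply => c; apply: generator_square; [left|right; left|right; right].
have nS := square_in_normal G (isT : (1 < i.+4)%N).
suff /(_ x Gx)[] : Gamma i.+3 `<=` square_in G i.+4 by [].
apply: Gamma_ind => // y c Gc; split; first exact: GammaR.
have : Gamma i.+4 [~ y, c * c] by apply: GammaR => //; exact: IH.
rewrite commg_mulr; set v := [~ y, c] => h.
have E (u : G) : u * u ^ c = u * u * [~ u, c].
  by rewrite (commgEl u) -mulgA mulVKg.
move: h; rewrite E; apply: (normalMrE (nG _)).
by apply: GammaRr => //; exact: GammaR.
Qed.

(** Finite generation of [Gamma i] modulo [Gamma i.+1]. That quotient is central, so normal
    generation is generation there. *)
Definition fg_layer i := exists S : seq G, (forall x, x \in S -> Gamma i x) /\
  forall H, normal_subset H -> Gamma i.+1 `<=` H -> (forall x, x \in S -> H x) ->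
    Gamma i `<=` H.

(** The commutator is bilinear modulo the next term, so commutators of [a], [b], [s] with generators
    of one layer generate the next layer. *)
Lemma Gamma_fg i : (0 < i)%N -> fg_layer i.
Proof.
case: i => [//|i] _; elim: i => [|i [S [SG Sgen]]].
  exists [:: a; b; s]; split => // H nH _ HS x _.
  by apply: gen => //; apply: HS; rewrite !inE eqxx ?orbT.
pose l := [:: a; b; s].
exists [seq [~ x, y] | x <- l, y <- S]; split.
  by move=> _ /allpairsP[[x y] [_ yS ->]]; apply: GammaR => //; exact: SG.
move=> H nH H2 HS; apply: Gamma_ind => // x.
suff /gen : normal_subset [set x | forall c, Gamma i.+1 c -> H [~ x, c]].
  suff lH y : y \in l -> forall c, Gamma i.+1 c -> H [~ y, c].
    by apply; apply: lH; rewrite !inE eqxx ?orbT.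
  move=> yl c Gc.
  suff /(_ c Gc)[] : Gamma i.+1 `<=` [set c | Gamma i.+1 c /\ H [~ y, c]] by [].
  apply: Sgen.
  - split=> [|u v [Gu Hu] [Gv Hv]|u [Gu Hu]|u v [Gu Hu]].
    + by rewrite /= commg1; split; [exact: (normal1 (nG _))|exact: (normal1 nH)].
    + split; first exact: (normalM (nG _)).
      by rewrite commg_mulr; apply: (normalM nH) => //; exact: (normalJ nH).
    + split; first exact: (normalV (nG _)).
      by rewrite commgV_r; apply: (normalV nH); exact: (normalJ nH).
    + split; first exact: (normalJ (nG _)).
      have -> : u ^ v = u * [~ u, v] by rewrite commgEl mulVKg.
      rewrite commg_mulr; apply: (normalM nH) => //; last exact: (normalJ nH).
      by apply: H2; apply: GammaR => //; exact: GammaRr.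
  - by move=> u Gu; split; [exact: lower_central_series_sub|apply: H2; exact: GammaR].
  - move=> u uS; split; first exact: SG.
    by apply: HS; apply/allpairsP; exists (y, u).
exact: commutatorl_normal.
Qed.

End Criterion.

(** * Finitely generated groups of exponent 2 *)

Section ElementaryAbelian.
Local Open Scope group_scope.
Variable Q : groupType.
Hypothesis exp2 : forall x : Q, x * x = 1.

Lemma exponent2_commutative (x y : Q) : x * y = y * x.
Proof.
have inv (z : Q) : z^-1 = z by apply: (mulgI z); rewrite mulgV exp2.
by rewrite -[x * y]inv invgM !inv.
Qed.

Lemma Z2_cases (z : 'Z_2) : z = 0%R \/ z = 1%R.
Proof. by case: z => [[|[|//]]] p; [left|right]; apply/val_inj. Qed.

(** Adjoins a basis vector [x], with coordinate 0 as its exponent. *)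
Definition extend_hom n (phi : {ffun 'I_n -> 'Z_2} -> Q) (x : Q)
    (v : {ffun 'I_n.+1 -> 'Z_2}) : Q :=
  (if v ord0 == 0%R then 1 else x) * phi [ffun j => v (lift ord0 j)].

Lemma extend_homM n (phi : {ffun 'I_n -> 'Z_2} -> Q) x :
  {morph phi : u v / u * v} -> {morph extend_hom phi x : u v / u * v}.
Proof.
move=> phiM u v; rewrite /extend_hom.
have -> : [ffun j => (u * v) (lift ord0 j)] =
    [ffun j => u (lift ord0 j)] * [ffun j => v (lift ord0 j)].
  by apply/ffunP => j; rewrite !ffunE.
rewrite phiM ffunE; set p := phi _; set q := phi _.
have -> (z t : Q) : z * p * (t * q) = z * t * (p * q).
  by rewrite !mulgA; congr (_ * _); rewrite -!mulgA; congr (_ * _);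
    exact: exponent2_commutative.
congr (_ * _).
by case: (Z2_cases (u ord0)) => ->; case: (Z2_cases (v ord0)) => -> /=;
  rewrite ?(mul1g, mulg1, exp2).
Qed.

(** Greedy choice of a basis over F_2: an element is adjoined only when it is outside the image so
    far, which keeps the map injective. *)
Lemma elementary_basis (l : seq Q) : exists n (phi : {ffun 'I_n -> 'Z_2} -> Q),
  [/\ {morph phi : u v / u * v}, injective phi &
     forall x, x \in l -> exists v, phi v = x].
Proof.
elim: l => [|x l [n [phi [phiM phiI phil]]]].
  exists 0%N, (fun=> 1); split=> //.
  by move=> u v _; apply/ffunP => -[].
have [[v vx]|nx] := pselect (exists v, phi v = x).
  exists n, phi; split => // y; rewrite inE => /orP[/eqP->|]; last exact: phil.
  by exists v.
have phi1 : phi 1 = 1 by apply: (@mulgI _ (phi 1)); rewrite -phiM !mulg1.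
exists n.+1, (extend_hom phi x); split; first exact: extend_homM.
  have phix v : phi v != x by apply/eqP => h; apply: nx; exists v.
  have lift_eq (u v : {ffun 'I_n.+1 -> 'Z_2}) : u ord0 = v ord0 ->
      [ffun j => u (lift ord0 j)] = [ffun j => v (lift ord0 j)] -> u = v.
    move=> e0 /ffunP el; apply/ffunP => j.
    by case: (unliftP ord0 j) => [k ->|-> //]; have := el k; rewrite !ffunE.
  move=> u v; rewrite /extend_hom.
  case: (Z2_cases (u ord0)) => u0; case: (Z2_cases (v ord0)) => v0;
    rewrite u0 v0 /= ?mul1g.
  - by move=> /phiI; apply: lift_eq; rewrite u0 v0.
  - set p := finfun _; set q := finfun _ => e.
    have /eqP := phix (p * q); case; rewrite phiM e -mulgA -phiM.
    have -> : phi (q * q) = 1 by rewrite phiM exp2.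
    by rewrite mulg1.
  - set p := finfun _; set q := finfun _ => e.
    have /eqP := phix (q * p); case; rewrite phiM -e -mulgA -phiM.
    have -> : phi (p * p) = 1 by rewrite phiM exp2.
    by rewrite mulg1.
  - by move=> /mulgI/phiI; apply: lift_eq; rewrite u0 v0.
(* The argument [[ffun j => oapp v z (unlift ord0 j)]] is [v] with the coordinate [z] put in
   front. *)
have ext v z : extend_hom phi x [ffun j => oapp v z (unlift ord0 j)] =
    (if z == 0%R then 1 else x) * phi [ffun j => v j].
  rewrite /extend_hom ffunE unlift_none; congr (_ * phi _).
  by apply/ffunP => j; rewrite !ffunE liftK.
move=> y; rewrite inE => /orP[/eqP->|/phil[v <-]].
  exists [ffun j => oapp (fun=> 0%R) 1%R (unlift ord0 j)]; rewrite ext /=.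
  by rewrite (_ : finfun _ = 1) ?phi1 ?mulg1//; apply/ffunP => j; rewrite !ffunE.
exists [ffun j => oapp v 0%R (unlift ord0 j)]; rewrite ext /= mul1g.
by congr phi; apply/ffunP => j; rewrite !ffunE.
Qed.

Lemma elementary_abelian_iso (l : seq Q) :
  (forall P : set Q, P 1 -> (forall x y, P x -> P y -> P (x * y)) ->
     (forall x, x \in l -> P x) -> forall x, P x) ->
  exists n, group_isomorphic Q {ffun 'I_n -> 'Z_2}.
Proof.
move=> lgen; have [n [phi [phiM phiI phil]]] := elementary_basis l.
have phi1 : phi 1 = 1 by apply: (@mulgI _ (phi 1)); rewrite -phiM !mulg1.
have surj : forall x, exists v, phi v = x.
  apply: lgen => //; first by exists 1.
  by move=> _ _ [u <-] [v <-]; exists (u * v).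
pose psi x := projT1 (cid (surj x)).
have psiK : cancel psi phi by move=> x; rewrite /psi; case: cid.
have phiK : cancel phi psi by move=> v; apply: phiI; rewrite psiK.
have psiM : {morph psi : x y / x * y}.
  by move=> x y; apply: phiI; rewrite phiM !psiK.
pose m := isMultiplicative.Build _ _ psi psiM.
pose f : {multiplicative Q -> {ffun 'I_n -> 'Z_2}} := HB.pack psi m.
by exists n, f; exists phi.
Qed.

End ElementaryAbelian.

Section CriterionConclusion.
Local Open Scope group_scope.
Variable G : groupType.

Theorem lower_central_elementary (a b s : G) :
  (forall N : set G, normal_subset N -> N a -> N b -> N s -> forall x, N x) ->
  (exists x y, commute (a ^ x) (b ^ y)) ->
  tangency_relation s a -> tangency_relation s b ->
  forall i, (1 < i)%N -> exists n,
    group_isomorphic (lower_central_quotient G i) {ffun 'I_n -> 'Z_2}.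
Proof.
move=> gen ab as_ bs_ i i1.
have nG := normal_Gamma G.
have [S [SG Sgen]] := Gamma_fg gen (ltnW i1).
pose Q := lower_central_quotient G i; pose H := lower_central_group G i.
(* The default 1 is the value outside [Gamma i], so [eltK] needs membership. *)
pose elt (x : G) : H := insubd 1 x.
have eltK x : lower_central_series G i x -> val (elt x) = x.
  by move=> Gx; apply: insubdK; exact/mem_set.
pose cls (x : G) : Q := \pi_Q%qT (elt x).
have clsM x y : lower_central_series G i x -> lower_central_series G i y ->
    cls (x * y) = cls x * cls y.
  move=> Gx Gy; rewrite /cls [RHS]lcq_mulE; congr (\pi_Q%qT _).
  by apply/val_inj; rewrite valM !eltK//; exact: (normalM (nG _)).
have clsE x y : lower_central_series G i x -> lower_central_series G i y ->
    lower_central_series G i.+1 (x^-1 * y) -> cls x = cls y.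
  by move=> Gx Gy h; apply/lower_central_classP; rewrite !eltK.
have cls1 x : lower_central_series G i.+1 x -> cls x = 1.
  move=> Gx; rewrite (clsE x 1).
  - by apply: (@mulgI _ (cls 1)); rewrite -clsM ?mulg1//; exact: (normal1 (nG _)).
  - exact: lower_central_series_sub.
  - exact: (normal1 (nG _)).
  - by rewrite mulg1; exact: (normalV (nG _)).
have surj (q : Q) : exists2 x, lower_central_series G i x & q = cls x.
  elim/quotW: q => h; exists (val h); first exact/set_mem/(valP h).
  by congr (\pi_Q%qT _); apply/val_inj; rewrite eltK//; exact/set_mem/(valP h).
have clsV x : lower_central_series G i x -> cls x^-1 = (cls x)^-1.
  move=> Gx; apply: (@mulgI _ (cls x)); rewrite -clsM ?mulgV//; last exact: (normalV (nG _)).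
  by apply: cls1; exact: (normal1 (nG _)).
have exp2 (q : Q) : q * q = 1.
  have [x Gx ->] := surj q; rewrite -clsM//; apply/cls1.
  exact: (Gamma_square gen ab as_ bs_).
apply: (elementary_abelian_iso exp2 (l := [seq cls x | x <- S])) => P P1 PM PS q.
have [x Gx ->] := surj q.
have PV q' : P q' -> P q'^-1.
  by have -> : q'^-1 = q' by apply: (@mulgI _ q'); rewrite mulgV exp2.
suff /(_ x Gx)[] : lower_central_series G i `<=`
  [set x | lower_central_series G i x /\ P (cls x)] by [].
apply: Sgen.
- split=> [|u v [Gu Pu] [Gv Pv]|u [Gu Pu]|u v [Gu Pu]].
  + by split; rewrite ?cls1//; exact: (normal1 (nG _)).
  + by split; [exact: (normalM (nG _))|rewrite clsM//; exact: PM].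
  + by split; [exact: (normalV (nG _))|rewrite clsV//; exact: PV].
  + split; first exact: (normalJ (nG _)).
    (* [u] and [u ^ v] have the same class, as they differ by [u, v], which lies in the next
       term. *)
    rewrite -(clsE u)//; first exact: (normalJ (nG _)).
    by rewrite -commgEl; apply: GammaRr => //; exact: ltnW.
- move=> u Gu; split; [exact: lower_central_series_sub|by rewrite cls1].
- by move=> u uS; split; [exact: SG|apply: PS; exact: map_f].
Qed.

End CriterionConclusion.

Local Notation Re := complex.Re.
Local Notation Im := complex.Im.

(** * Transport along paths *)

Section ComplexContinuity.
Variable R : realType.
Local Notation C := R[i].

(** Continuity is tested on real and imaginary parts, which keeps the topology of the target over
    [R]. *)
Definition ccont (T : topologicalType) (f : T -> C) : Prop :=
  continuous (fun x => Re (f x)) /\ continuous (fun x => Im (f x)).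

Definition vcont (T : topologicalType) (f : T -> C * C) : Prop :=
  ccont (fun x => (f x).1) /\ ccont (fun x => (f x).2).

Section Closure.
Variable T : topologicalType.
Implicit Types f g : T -> C.

Lemma ccont_cst (c : C) : ccont (fun _ : T => c).
Proof. by split=> x; exact: cvg_cst. Qed.

Lemma ccontD f g : ccont f -> ccont g -> ccont (fun x => f x + g x).
Proof.
move=> [f1 f2] [g1 g2]; split=> x.
- rewrite (_ : (fun x => _) = fun x => Re (f x) + Re (g x)).
    by apply: cvgD; [exact: f1|exact: g1].
  by apply/funext => y; case: (f y) (g y) => ? ? [].
- rewrite (_ : (fun x => _) = fun x => Im (f x) + Im (g x)).
    by apply: cvgD; [exact: f2|exact: g2].
  by apply/funext => y; case: (f y) (g y) => ? ? [].
Qed.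

Lemma ccontN f : ccont f -> ccont (fun x => - f x).
Proof.
move=> [f1 f2]; split=> x.
- rewrite (_ : (fun x => _) = fun x => - Re (f x)).
    by apply: cvgN; exact: f1.
  by apply/funext => y; case: (f y).
- rewrite (_ : (fun x => _) = fun x => - Im (f x)).
    by apply: cvgN; exact: f2.
  by apply/funext => y; case: (f y).
Qed.

Lemma ccontM f g : ccont f -> ccont g -> ccont (fun x => f x * g x).
Proof.
move=> [f1 f2] [g1 g2]; split=> x.
- rewrite (_ : (fun x => _) = fun x => Re (f x) * Re (g x) - Im (f x) * Im (g x)).
    by apply: cvgB; apply: cvgM; [exact: f1|exact: g1|exact: f2|exact: g2].
  by apply/funext => y; case: (f y) (g y) => ? ? [].
- rewrite (_ : (fun x => _) = fun x => Re (f x) * Im (g x) + Im (f x) * Re (g x)).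
    by apply: cvgD; apply: cvgM; [exact: f1|exact: g2|exact: f2|exact: g1].
  by apply/funext => y; case: (f y) (g y) => ? ? [].
Qed.

Lemma ccontX f n : ccont f -> ccont (fun x => f x ^+ n).
Proof.
move=> cf; elim: n => [|n IH]; first exact: ccont_cst.
by under eq_fun do rewrite exprS; exact: ccontM.
Qed.

Lemma ccont_real (u : T -> R) : continuous u -> ccont (fun x => (u x)%:C).
Proof. by move=> cu; split=> // x; exact: cvg_cst. Qed.

End Closure.

Lemma ccont_comp (S T : topologicalType) (f : T -> C) (g : S -> T) :
  continuous g -> ccont f -> ccont (fun x => f (g x)).
Proof.
move=> cg [f1 f2]; split=> x.
- exact: (@continuous_comp _ _ _ g (fun y => Re (f y)) x (cg x) (f1 (g x))).
- exact: (@continuous_comp _ _ _ g (fun y => Im (f y)) x (cg x) (f2 (g x))).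
Qed.

Lemma vcont_comp (S T : topologicalType) (f : T -> C * C) (g : S -> T) :
  continuous g -> vcont f -> vcont (fun x => f (g x)).
Proof. by move=> cg [f1 f2]; split; [exact: (ccont_comp cg f1)|exact: (ccont_comp cg f2)]. Qed.

Lemma continuous_affine2 (c0 c1 c2 c3 : R) :
  continuous (fun p : R * R => c0 + c1 * p.1 + c2 * p.2 + c3 * (p.1 * p.2)).
Proof.
move=> p; have c1' : (fun p : R * R => p.1) @ p --> p.1 by exact: cvg_fst.
have c2' : (fun p : R * R => p.2) @ p --> p.2 by exact: cvg_snd.
apply: cvgD; first apply: cvgD; first apply: cvgD.
- exact: cvg_cst.
- by apply: cvgM => //; exact: cvg_cst.
- by apply: cvgM => //; exact: cvg_cst.
- by apply: cvgM; [exact: cvg_cst|exact: cvgM].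
Qed.

Lemma continuous_affine1 (c0 c1 : R) : continuous (fun t : R => c0 + c1 * t).
Proof.
by move=> t; apply: cvgD; [exact: cvg_cst|apply: cvgM; [exact: cvg_cst|exact: cvg_id]].
Qed.

Lemma convex_lt (p q e s : R) : 0 <= s <= 1 -> p < e -> q < e ->
  (1 - s) * p + s * q < e.
Proof.
move=> /andP[s0 s1] pe qe; have [pq|qp] := leP p q.
  by apply: le_lt_trans qe; nra.
by apply: le_lt_trans pe; nra.
Qed.

(** Continuous induction: the supremum of the points related to 0 is attained, and it can be passed
    unless it is 1. This replaces subdivision by a Lebesgue number. *)
Lemma interval_chain (P : R -> R -> Prop) :
  (forall a b c, 0 <= a <= 1 -> 0 <= b <= 1 -> 0 <= c <= 1 ->
     P a b -> P b c -> P a c) ->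
  (forall t, 0 <= t <= 1 -> exists2 e, 0 < e & forall a b, 0 <= a <= 1 ->
     0 <= b <= 1 -> `|a - t| < e -> `|b - t| < e -> P a b) ->
  P 0 1.
Proof.
move=> tr loc; pose S := [set t | 0 <= t <= 1 /\ P 0 t].
have i0 : 0 <= (0 : R) <= 1 by rewrite lexx ler01.
have S0 : S 0.
  split=> //; have [e e0 he] := loc 0 i0.
  by apply: he => //; rewrite subr0 normr0.
have supS : has_sup S.
  by split; [exists 0 | exists 1 => t [/andP[]]].
pose s := sup S.
have s0 : 0 <= s by apply: ub_le_sup => //; exact: supS.2.
have s1 : s <= 1 by apply: ge_sup; [exists 0|move=> t [/andP[]]].
have [e e0 he] := loc s (introT andP (conj s0 s1)).
have [t [/andP[t0 t1] Pt] st] := sup_adherent e0 supS.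
have ts : t <= s by apply: ub_le_sup; [exact: supS.2|split; rewrite ?t0].
pose b := Num.min 1 (s + e / 2).
have b01 : 0 <= b <= 1 by rewrite /b le_min ge_min lexx /= ler01 andbT; lra.
have Pb : P 0 b.
  apply: (tr _ t) => //; first by rewrite t0.
  apply: he => //; rewrite ?t0//.
    by rewrite ltr_norml -/s in st *; apply/andP; split; lra.
  rewrite ltr_norml /b; case: (leP 1 (s + e / 2)) => h; apply/andP; split; lra.
have bs : b <= s by apply: ub_le_sup; [exact: supS.2|split].
suff -> : 1 = b by [].
by move: bs; rewrite /b; case: (leP 1 (s + e / 2)) => //; lra.
Qed.

End ComplexContinuity.

Section Transport.
Variables (R : realType) (G : groupType).
Local Notation C := R[i].
Local Notation V := (R[i] * R[i])%type.

Definition zpath (S : set V) (f : R -> V) : Prop :=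
  vcont f /\ forall t, 0 <= t <= 1 -> S (f t).

(* The model is [transport_of]: map [f] to the configuration space and close the
   image up by fixed paths from the base point. *)
Record transport (Z : set V) (Phi : (R -> V) -> G) : Prop := Transport {
  transport_cst : forall z, Z z -> Phi (fun=> z) = 1%g;
  transport_rect : forall H : R -> R -> V,
    vcont (fun p : R * R => H p.1 p.2) ->
    (forall x y, 0 <= x <= 1 -> 0 <= y <= 1 -> Z (H x y)) ->
    (Phi (fun x => H x 0%R) * Phi (fun y => H 1%R y) =
     Phi (fun y => H 0%R y) * Phi (fun x => H x 1%R))%g }.

(** The case b < a is allowed and gives the reversed piece. *)
Definition subpath (f : R -> V) (a b : R) : R -> V := fun t => f (a + (b - a) * t).

Lemma zpath_sub S f a b : 0 <= a <= 1 -> 0 <= b <= 1 ->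
  zpath S f -> zpath S (subpath f a b).
Proof.
move=> a01 b01 [cf Sf]; split; first exact: (vcont_comp (@continuous_affine1 _ a (b - a)) cf).
by move=> t t01; apply: Sf; apply/andP; split; nra.
Qed.

Lemma zpathS S S' f : S `<=` S' -> zpath S f -> zpath S' f.
Proof. by move=> SS [cf Sf]; split=> // t /Sf/SS. Qed.

Lemma zpathSI S S' Y f : S `<=` S' -> zpath (S `&` Y) f -> zpath (S' `&` Y) f.
Proof. by move=> SS; apply: zpathS => z [/SS]. Qed.

Variables (Z : set V) (Phi : (R -> V) -> G).
Hypothesis tr : transport Z Phi.

Lemma Phi_homotopy (H : R -> R -> V) :
  vcont (fun p : R * R => H p.1 p.2) ->
  (forall x y, 0 <= x <= 1 -> 0 <= y <= 1 -> Z (H x y)) ->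
  (forall y, H 0 y = H 0 0) -> (forall y, H 1 y = H 1 0) ->
  Phi (fun x => H x 0) = Phi (fun x => H x 1).
Proof.
move=> cH ZH H0 H1; have := transport_rect tr cH ZH.
have c01 : 0 <= (0 : R) <= 1 by rewrite lexx ler01.
have c11 : 0 <= (1 : R) <= 1 by rewrite lexx ler01.
rewrite (_ : (fun y => H 1 y) = fun=> H 1 0); last exact/funext.
rewrite (_ : (fun y => H 0 y) = fun=> H 0 0); last exact/funext.
by rewrite !(transport_cst tr); [rewrite mulg1 mul1g|exact: ZH|exact: ZH].
Qed.

(** [Phi] takes functions on all of [R]. The straight homotopy from [f] to [g] is constant over
    [0, 1], so the values elsewhere do not matter. *)
Lemma Phi_ext f g : zpath Z f -> vcont g ->
  (forall t, 0 <= t <= 1 -> f t = g t) -> Phi f = Phi g.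
Proof.
move=> [cf Zf] cg fg.
pose mix (y : R) (p q : C) := (1 - y)%:C * p + y%:C * q.
pose H (x y : R) : V := (mix y (f x).1 (g x).1, mix y (f x).2 (g x).2).
have mixE y p : mix y p p = p by rewrite /mix -mulrDl -raddfD /= subrK mul1r.
have HE x y : 0 <= x <= 1 -> H x y = f x.
  by move=> /fg e; rewrite /H -e !mixE; case: (f x).
have mix0 p q : mix 0 p q = p by rewrite /mix subr0 mul1r mul0r addr0.
have mix1 p q : mix 1 p q = q by rewrite /mix subrr mul0r mul1r add0r.
have c01 : 0 <= (0 : R) <= 1 by rewrite lexx ler01.
have c11 : 0 <= (1 : R) <= 1 by rewrite lexx ler01.
have -> : f = fun x => H x 0 by apply/funext => x; rewrite /H !mix0; case: (f x).
have -> : g = fun x => H x 1 by apply/funext => x; rewrite /H !mix1; case: (g x).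
apply: Phi_homotopy => [|x y x01 _|y|y]; rewrite ?HE//; last exact: Zf.
have cfst : continuous (fun p : R * R => p.1) by move=> p; exact: cvg_fst.
have csnd : continuous (fun p : R * R => p.2) by move=> p; exact: cvg_snd.
have cB : continuous (fun p : R * R => 1 - p.2).
  by move=> p; apply: cvgB; [exact: cvg_cst|exact: csnd].
have [cf1 cf2] := vcont_comp cfst cf; have [cg1 cg2] := vcont_comp cfst cg.
by split; apply: ccontD; apply: ccontM => //; exact: ccont_real.
Qed.

(** A rectangle with left side constant at [f a], whose bottom, right and top sides are the three
    pieces. *)
Lemma Phi_sub f a b c : zpath Z f ->
  0 <= a <= 1 -> 0 <= b <= 1 -> 0 <= c <= 1 ->
  (Phi (subpath f a b) * Phi (subpath f b c) = Phi (subpath f a c))%g.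
Proof.
move=> [cf Zf] a01 b01 c01.
pose H x y := f (a + (b - a) * x + 0 * y + (c - b) * (x * y)).
have := transport_rect tr (H := H) _ _.
rewrite (_ : (fun x => H x 0) = subpath f a b); last first.
  by apply/funext => x; rewrite /H /subpath; congr f; ring.
rewrite (_ : (fun y => H 1 y) = subpath f b c); last first.
  by apply/funext => x; rewrite /H /subpath; congr f; ring.
rewrite (_ : (fun y => H 0 y) = fun=> f a); last first.
  by apply/funext => x; rewrite /H; congr f; ring.
rewrite (_ : (fun y => H y 1) = subpath f a c); last first.
  by apply/funext => x; rewrite /H /subpath; congr f; ring.
rewrite (transport_cst tr) ?mul1g; last exact: Zf.
apply.
  exact: (vcont_comp (@continuous_affine2 _ a (b - a) 0 (c - b)) cf).
move=> x y /andP[x0 x1] /andP[y0 y1]; apply: Zf.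
rewrite (_ : _ + _ = (1 - x) * a + x * ((1 - y) * b + y * c)); last by ring.
have h : 0 <= (1 - y) * b + y * c <= 1 by apply/andP; split; nra.
by apply/andP; split; nra.
Qed.

Lemma Phi_subV f a b : zpath Z f -> 0 <= a <= 1 -> 0 <= b <= 1 ->
  (Phi (subpath f b a) = (Phi (subpath f a b))^-1)%g.
Proof.
move=> Zf a01 b01; apply: (mulgI (Phi (subpath f a b))).
rewrite Phi_sub// mulgV -(transport_cst tr (z := f a)); last exact: Zf.2.
by congr Phi; apply/funext => x; rewrite /subpath subrr mul0r addr0.
Qed.

Lemma subpath01 f : subpath f 0 1 = f.
Proof. by apply/funext => t; rewrite /subpath subr0 mul1r add0r. Qed.

Lemma subpath_at0 f a b : subpath f a b 0 = f a.
Proof. by rewrite /subpath mulr0 addr0. Qed.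

Lemma subpath_at1 f a b : subpath f a b 1 = f b.
Proof. by rewrite /subpath mulr1 addrC subrK. Qed.

(** The vertical sides coincide, and their transport is the conjugating element. *)
Lemma Phi_free_homotopy (H : R -> R -> V) :
  vcont (fun p : R * R => H p.1 p.2) ->
  (forall x y, 0 <= x <= 1 -> 0 <= y <= 1 -> Z (H x y)) ->
  (forall y, H 0 y = H 1 y) ->
  exists g, (Phi (fun x => H x 1%R) = Phi (fun x => H x 0%R) ^ g)%g.
Proof.
move=> cH ZH H01; have := transport_rect tr cH ZH.
rewrite (_ : (fun y => H 0 y) = H 1); last exact/funext.
move=> e; exists (Phi (H 1)).
by rewrite conjgE e mulgA mulVg mul1g.
Qed.

(** * Potentials modulo a normal subgroup and their gluing *)

Variable N : set G.
Hypothesis nN : normal_subset N.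

(** [u] is a potential: modulo [N], [Phi f] is [(u (f 0))^-1 * u (f 1)]. Only paths within [Z] are
    tested, although [S] may leave [Z]. *)
Definition trivializes (u : V -> G) (S : set V) : Prop :=
  forall f, zpath (S `&` Z) f -> N (u (f 0%R) * Phi f * (u (f 1%R))^-1)%g.

Definition good (S : set V) : Prop := exists u, trivializes u S.

Lemma trivializesS u S S' : S' `<=` S -> trivializes u S -> trivializes u S'.
Proof. by move=> SS tS f /(zpathSI SS); exact: tS. Qed.

Lemma goodS S S' : S' `<=` S -> good S -> good S'.
Proof. by move=> SS [u /(trivializesS SS) tu]; exists u. Qed.

Lemma trivializes_loop S f : good S -> zpath (S `&` Z) f -> f 0 = f 1 -> N (Phi f).
Proof.
move=> [u tu] Sf f01; have := tu f Sf; rewrite -f01.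
by have := @normalJE _ N (Phi f) (u (f 0))^-1%g nN; rewrite conjgE invgK mulgA.
Qed.

Lemma trivializes_mul u c S : trivializes u S -> trivializes (fun z => c * u z)%g S.
Proof.
move=> tu f /tu h; rewrite invgM -!mulgA.
have := normalJ nN c^-1%g h; by rewrite conjgE invgK -!mulgA.
Qed.

(** Openness along paths, the form in which [interval_chain] can use it. *)
Definition vopen (K : set V) : Prop := forall f : R -> V, vcont f ->
  forall t, K (f t) -> exists2 e, 0 < e & forall s, `|s - t| < e -> K (f s).

Lemma trivializes_local (u : V -> G) (S : set V) :
  (forall z, S z -> Z z -> exists K, [/\ vopen K, K z & trivializes u (S `&` K)]) ->
  trivializes u S.
Proof.
move=> loc f [cf Sf].
pose P a b := N (u (f a) * Phi (subpath f a b) * (u (f b))^-1)%g.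
have Zf : zpath Z f by split=> // t /Sf[].
suff : P 0 1 by rewrite /P subpath01.
apply: interval_chain => [a b c a01 b01 c01 Pab Pbc|t t01].
  have := normalM nN Pab Pbc; rewrite /P -(Phi_sub Zf a01 b01 c01).
  by rewrite -!mulgA mulKg.
have [Sz Zz] := Sf t t01; have [K [oK Kz tK]] := loc _ Sz Zz.
have [e e0 he] := oK f cf t Kz; exists e => // a b a01 b01 ae be.
have := tK (subpath f a b); rewrite subpath_at0 subpath_at1; apply.
split; first exact: (vcont_comp (@continuous_affine1 _ a (b - a)) cf).
move=> s s01; have h : 0 <= a + (b - a) * s <= 1 by apply/andP; split; nra.
have [Ss Zs] := Sf _ h; split=> //; split=> //; apply: he.
have -> : a + (b - a) * s - t = (1 - s) * (a - t) + s * (b - t) by ring.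
apply: le_lt_trans (convex_lt s01 ae be).
have [s0 s1] := andP s01; apply: (le_trans (ler_normD _ _)).
by rewrite !normrM [`|1 - s|]ger0_norm ?subr_ge0// [`|s|]ger0_norm.
Qed.

(** Chains of paths, which avoid concatenating functions into a single path. *)
Inductive linked (S : set V) : V -> V -> Prop :=
| linked0 x : linked S x x
| linkedS f z : zpath (S `&` Z) f -> linked S (f 1) z -> linked S (f 0) z.

Lemma linked_trans S x y z : linked S x y -> linked S y z -> linked S x z.
Proof. by elim=> // f t Sf _ IH /IH; exact: linkedS. Qed.

Lemma linked_path (S : set V) f : zpath (S `&` Z) f -> linked S (f 0) (f 1).
Proof. by move=> Sf; apply: (linkedS Sf); exact: linked0. Qed.

Lemma linkedW S S' x y : S `<=` S' -> linked S x y -> linked S' x y.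
Proof.
move=> SS; elim=> [t|f t Sf _]; first exact: linked0.
by apply: linkedS; exact: zpathSI Sf.
Qed.

(** Along a common path two potentials differ by a constant modulo [N]. *)
Lemma trivializes_compare u v S S' x y : trivializes u S -> trivializes v S' ->
  linked (S `&` S') x y -> N (u x * (v x)^-1)%g -> N (u y * (v y)^-1)%g.
Proof.
move=> tu tv; elim=> // f z Sf _ IH h; apply: IH.
have := tu f (zpathSI (@subIsetl _ S S') Sf).
have := tv f (zpathSI (@subIsetr _ S S') Sf).
move=> h1 h2; have := normalM nN (normalV nN h2) (normalM nN h h1).
by rewrite !invgM !invgK -!mulgA !mulKg.
Qed.

Section Gluing.
Variables (J : Type) (K : J -> set V) (v : J -> V -> G).

Lemma glue : (forall j, vopen (K j)) -> (forall j, trivializes (v j) (K j)) ->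
  (forall k l z, K k z -> K l z -> Z z -> N (v k z * (v l z)^-1)%g) ->
  good (\bigcup_j K j).
Proof.
move=> oK tv cv.
(* Any member of the cover containing [z] will do, since the potentials agree modulo [N] on
   overlaps. *)
pose pick z : option J := if pselect (exists j, K j z) is left e then Some (projT1 (cid e)) else None.
pose u z := if pick z is Some j then v j z else 1%g.
have uv k z : K k z -> Z z -> N (u z * (v k z)^-1)%g.
  move=> Kz Zz; rewrite /u /pick; case: pselect => [e|[]]; last by exists k.
  by case: cid => /= j Kj; exact: cv.
exists u; apply: trivializes_local => z [k _ Kz] Zz.
exists (K k); split=> // f [cf Kf].
have c01 : 0 <= (0 : R) <= 1 by rewrite lexx ler01.
have c11 : 0 <= (1 : R) <= 1 by rewrite lexx ler01.
have [[_ K0] Z0] := Kf 0 c01; have [[_ K1] Z1] := Kf 1 c11.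
have h : zpath (K k `&` Z) f by split=> // t /Kf[[_ ?] ?].
have := normalM nN (normalM nN (uv _ _ K0 Z0) (tv k f h)) (normalV nN (uv _ _ K1 Z1)).
by rewrite !invgM !invgK -!mulgA !mulKg.
Qed.

End Gluing.

(** A van Kampen argument with a central member [K j0]: each potential is shifted by a constant so
    as to agree with that of [K j0]. Two shifted potentials then agree on their overlap, every point
    of which is linked to a point of [K j0]. *)
Lemma glue_star (J : Type) (K : J -> set V) (j0 : J) :
  (forall j, vopen (K j)) -> (forall j, good (K j)) ->
  (forall k l z, K k z -> K l z -> Z z ->
     exists2 w, (K j0 `&` (K k `&` K l) `&` Z) w & linked (K k `&` K l) w z) ->
  (forall k z w, (K j0 `&` K k `&` Z) z -> (K j0 `&` K k `&` Z) w ->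
     linked (K j0 `&` K k) z w) ->
  good (\bigcup_j K j).
Proof.
move=> oK /choice[u tu] meet conn.
pose base k : option V := if pselect (exists z, (K j0 `&` K k `&` Z) z) is left e
  then Some (projT1 (cid e)) else None.
pose v k z := if base k is Some w then (u j0 w * (u k w)^-1 * u k z)%g else u k z.
have tv k : trivializes (v k) (K k).
  rewrite /v; case: (base k) => [w|] //; exact: trivializes_mul.
have v0 k z : (K j0 `&` K k `&` Z) z -> N (u j0 z * (v k z)^-1)%g.
  rewrite /v /base; case: pselect => [e|/(_ (ex_intro _ z _))//] Kz.
  case: cid => /= w Kw.
  have := trivializes_compare (tu j0) (trivializes_mul (u j0 w * (u k w)^-1)%g (tu k))
    (conn k w z Kw Kz).
  by apply; rewrite mulgVK mulgV; exact: (normal1 nN).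
apply: (glue oK tv) => k l z Kk Kl Zz.
have [w [[Kj [Kwk Kwl]] Zw] lw] := meet k l z Kk Kl Zz.
apply: (trivializes_compare (tv k) (tv l) lw).
have hk := v0 k w (conj (conj Kj Kwk) Zw); have hl := v0 l w (conj (conj Kj Kwl) Zw).
by have := normalM nN (normalV nN hk) hl; rewrite !invgM !invgK -!mulgA mulKg.
Qed.

Inductive quarter := East | North | West | South.

Definition qnext q := match q with
  | East => North | North => West | West => South | South => East end.

Definition qstart q : R := match q with
  | East => 0 | North => 1 / 4 | West => 1 / 2 | South => 3 / 4 end.

(* The sets [K q] are arranged cyclically around a hole; going once around the
   hole is a loop whose transport is in [N]. *)
Lemma glue_cycle (K : quarter -> set V) (f : R -> V) :
  (forall q, vopen (K q)) -> (forall q, good (K q)) ->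
  (forall q z, Z z -> K q z -> ~ K (qnext (qnext q)) z) ->
  (forall q z, (K q `&` K (qnext q) `&` Z) z ->
     linked (K q `&` K (qnext q)) (f (qstart q + 1 / 4)) z) ->
  zpath Z f -> f 0 = f 1 ->
  (forall q t, qstart q <= t <= qstart q + 1 / 4 -> K q (f t)) ->
  N (Phi f) -> good (\bigcup_q K q).
Proof.
move=> oK /choice[u tu] opp conn Zf f01 Kf Nf.
pose c := fun q => f (qstart q).
(* Shift the potentials in turn so that neighbours agree at the three corners [c North], [c West],
   [c South]. The seam between South and East is left. *)
pose v1 z := (u East (c North) * (u North (c North))^-1 * u North z)%g.
pose v2 z := (v1 (c West) * (u West (c West))^-1 * u West z)%g.
pose v3 z := (v2 (c South) * (u South (c South))^-1 * u South z)%g.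
pose v q := match q with East => u East | North => v1 | West => v2 | South => v3 end.
have tv q : trivializes (v q) (K q) by case: q; rewrite //=; exact: trivializes_mul.
have a01 q : 0 <= qstart q <= 1 by case: q => /=; apply/andP; split; lra.
have b01 q : 0 <= qstart q + 1 / 4 <= 1 by case: q => /=; apply/andP; split; lra.
have e1 : u East (c North) = v1 (c North) by rewrite /v1 mulgVK.
have e2 : v1 (c West) = v2 (c West) by rewrite /v2 mulgVK.
have e3 : v2 (c South) = v3 (c South) by rewrite /v3 mulgVK.
clearbody v1 v2 v3.
have sub q : N (v q (f (qstart q)) * Phi (subpath f (qstart q) (qstart q + 1 / 4)%R) *
                (v q (f (qstart q + 1 / 4)%R))^-1)%g.
  have := tv q (subpath f (qstart q) (qstart q + 1 / 4)).
  rewrite subpath_at0 subpath_at1; apply; split.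
    exact: (zpath_sub (a01 q) (b01 q) Zf).1.
  move=> t t01; split; last exact: (zpath_sub (a01 q) (b01 q) Zf).2.
  by apply: Kf; apply/andP; split; nra.
have q1 : qstart East + 1 / 4 = qstart North by rewrite /= add0r.
have q2 : qstart North + 1 / 4 = qstart West by rewrite /=; lra.
have q3 : qstart West + 1 / 4 = qstart South by rewrite /=; lra.
have q4 : qstart South + 1 / 4 = 1 by rewrite /=; lra.
(* The mismatch at the last seam is, modulo [N], a conjugate of the transport round [f] or its
   inverse. *)
have e4 : N (v3 (f 1%R) * (u East (f 1%R))^-1)%g.
  have := normalM nN (normalM nN (sub East) (sub North))
    (normalM nN (sub West) (sub South)).
  rewrite q1 q2 q3 q4 /= -/(c North) -/(c West) -/(c South) e1 e2 e3.
  rewrite -!mulgA !mulKg.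
  have c11 : 0 <= (1 : R) <= 1 by rewrite lexx ler01.
  rewrite (mulgA (Phi _)) (Phi_sub Zf (a01 East) (a01 North) (a01 West)).
  rewrite (mulgA (Phi _)) (Phi_sub Zf (a01 East) (a01 West) (a01 South)).
  rewrite (mulgA (Phi _)) (Phi_sub Zf (a01 East) (a01 South) c11).
  rewrite subpath01 /= -f01 => h.
  have h1 := normalJ nN (u East (f 0))^-1%g Nf.
  have := normalM nN (normalV nN h) h1.
  by rewrite conjgE !invgM !invgK -!mulgA !mulKg.
have compat q z : (K q `&` K (qnext q) `&` Z) z -> N (v q z * (v (qnext q) z)^-1)%g.
  move=> Kz; apply: (trivializes_compare (tv q) (tv (qnext q)) (conn q z Kz)).
  case: q {Kz} => /=.
  - rewrite add0r -/(c North) e1 mulgV; exact: (normal1 nN).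
  - rewrite (_ : 1 / 4 + 1 / 4 = 1 / 2); last lra.
    rewrite -/(c West) e2 mulgV; exact: (normal1 nN).
  - rewrite (_ : 1 / 2 + 1 / 4 = 3 / 4); last lra.
    rewrite -/(c South) e3 mulgV; exact: (normal1 nN).
  - by rewrite (_ : 3 / 4 + 1 / 4 = 1); last lra.
have compatV q z : (K q `&` K (qnext q) `&` Z) z -> N (v (qnext q) z * (v q z)^-1)%g.
  by move=> /compat /(normalV nN); rewrite invgM invgK.
apply: (glue oK tv) => k l z Kk Kl Zz.
have eqN q : N (v q z * (v q z)^-1)%g by rewrite mulgV; exact: (normal1 nN).
have no q : K q z -> K (qnext (qnext q)) z -> False by move=> h1; exact: (opp q z Zz h1).
have adj q : K q z -> K (qnext q) z -> N (v q z * (v (qnext q) z)^-1)%g.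
  by move=> *; apply: compat; split.
have adjV q : K (qnext q) z -> K q z -> N (v (qnext q) z * (v q z)^-1)%g.
  by move=> *; apply: compatV; split.
case: k l Kk Kl => [] [] Kk Kl; try exact: eqN;
  try (by case: (no _ Kk Kl)); try (by case: (no _ Kl Kk));
  solve [exact: (adj East)|exact: (adj North)|exact: (adj West)|exact: (adj South)
    |exact: (adjV East)|exact: (adjV North)|exact: (adjV West)|exact: (adjV South)].
Qed.

(** The potential at [z] is the transport of the contraction path from [q] to [z]: the rectangle
    [c y (f x)] has constant bottom side and top side [f]. *)
Lemma good_starshaped (S : set V) (c : R -> V -> V) (q : V) :
  (forall f, vcont f -> vcont (fun p : R * R => c p.2 (f p.1))) ->
  (forall z, c 0 z = q) -> (forall z, c 1 z = z) ->
  (forall y z, 0 <= y <= 1 -> S z -> Z z -> Z (c y z)) -> good S.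
Proof.
move=> cc c0 c1 cZ; exists (fun z => Phi (c^~ z)) => f [cf Sf].
have c01 : 0 <= (0 : R) <= 1 by rewrite lexx ler01.
have Zq : Z q.
  by have [Sz Zz] := Sf 0 c01; rewrite -(c0 (f 0)); apply: cZ.
have := transport_rect tr (H := fun x y => c y (f x)) (cc f cf) _.
rewrite (_ : (fun x => c 0 (f x)) = fun=> q); last exact/funext.
rewrite (_ : (fun x => c 1 (f x)) = f); last exact/funext.
rewrite (transport_cst tr)// mul1g => <-.
  by rewrite mulgV; exact: (normal1 nN).
by move=> x y x01 y01; have [Sz Zz] := Sf x x01; exact: cZ.
Qed.

End Transport.

Ltac solve_ccont := repeat match goal with
  | |- ccont (fun _ => ?c) => exact: (ccont_cst _ c)
  | |- ccont (fun x => @?f x + @?g x) => apply: (@ccontD _ _ f g)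
  | |- ccont (fun x => - @?f x) => apply: (@ccontN _ _ f)
  | |- ccont (fun x => @?f x * @?g x) => apply: (@ccontM _ _ f g)
  | |- ccont (fun x => @?f x ^+ ?n) => apply: (@ccontX _ _ f n)
  | |- _ => assumption
  end.

(** * The complement of two lines and a tangent conic *)

Section Discriminant.
Variable R : realType.
Local Notation C := R[i].
Local Notation V := (R[i] * R[i])%type.

(* For z = (y1 y2, (1 - y1)(1 - y2)), [mid z] is (y1 + y2) / 2 and [dsc z] is
   ((y1 - y2) / 2)^2; [psi] is the inverse change of coordinates. *)
Definition mid (z : V) : C := (1 + z.1 - z.2) / 2.
Definition dsc (z : V) : C := mid z ^+ 2 - z.1.
Definition psi (b w : C) : V := (b ^+ 2 - w, (1 - b) ^+ 2 - w).

(** The three conditions say that neither y1 nor y2 is 0, that neither is 1, and that y1 and y2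
    differ. *)
Definition Zset : set V := [set z | [/\ z.1 != 0, z.2 != 0 & dsc z != 0]].

Lemma psiK z : psi (mid z) (dsc z) = z.
Proof. by case: z => a b; rewrite /psi /dsc /mid /=; congr pair; field. Qed.

Lemma mid_psi b w : mid (psi b w) = b.
Proof. by rewrite /mid /=; field. Qed.

Lemma dsc_psi b w : dsc (psi b w) = w.
Proof. by rewrite /dsc mid_psi /=; ring. Qed.

Lemma vcont_psi (T : topologicalType) (b w : T -> C) :
  ccont b -> ccont w -> vcont (fun x => psi (b x) (w x)).
Proof. by move=> cb cw; split => /=; solve_ccont. Qed.

Lemma ccont_mid (T : topologicalType) (z : T -> V) : vcont z ->
  ccont (fun x => mid (z x)).
Proof. by move=> [c1 c2]; rewrite /mid; solve_ccont. Qed.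

Lemma ccont_dsc (T : topologicalType) (z : T -> V) : vcont z ->
  ccont (fun x => dsc (z x)).
Proof. by move=> cz; have := ccont_mid cz; case: cz => ? ? ?; rewrite /dsc; solve_ccont. Qed.

Definition lin (x d : V) (s : C) : V := (x.1 + s * d.1, x.2 + s * d.2).

Definition dpoly (x d : V) : {poly C} :=
  let a := x.1%:P + d.1 *: 'X in let b := x.2%:P + d.2 *: 'X in
  (2^-1 *: (1 + a - b)) ^+ 2 - a.

(** The product of the three equations restricted to the complex line [lin x d]. *)
Definition zpoly (x d : V) : {poly C} :=
  (x.1%:P + d.1 *: 'X) * (x.2%:P + d.2 *: 'X) * dpoly x d.

Lemma dpolyE x d s : (dpoly x d).[s] = dsc (lin x d s).
Proof. by rewrite /dpoly /dsc /mid /lin !hornerE /=; ring. Qed.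

Lemma zpolyE x d s : (zpoly x d).[s] =
  (lin x d s).1 * (lin x d s).2 * dsc (lin x d s).
Proof. by rewrite /zpoly !hornerM dpolyE !hornerE ![_ * s]mulrC. Qed.

Lemma Zset_lin x d s : Zset (lin x d s) <-> (zpoly x d).[s] != 0.
Proof.
rewrite zpolyE !mulf_eq0 !negb_or /Zset /=.
by split=> [[-> -> ->]|/andP[/andP[-> ->] ->]].
Qed.

Lemma finite_roots (p : {poly C}) : p != 0 -> exists rs : seq C, forall z, root p z -> z \in rs.
Proof.
have [n] := ubnP (size p); elim: n p => // n IH p pn p0.
have [[z rz]|no] := pselect (exists z, root p z); last first.
  by exists [::] => z rz; case: no; exists z.
have [q pq] := factor_theorem p z rz.
have q0 : q != 0 by apply: contraNneq p0 => q0; rewrite pq q0 mul0r.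
have [|rs hrs] := IH q _ q0.
  by move: pn; rewrite pq size_Mmonic ?monicXsubC// size_XsubC addnC.
exists (z :: rs) => t; rewrite pq rootM root_XsubC inE => /orP[/hrs->|->//].
by rewrite orbT.
Qed.

Lemma avoid_finite (s : seq R) (e : R) : 0 < e ->
  exists t, [/\ 0 < t, t < e & t \notin s].
Proof.
move=> e0; pose c (k : nat) : R := e / (k.+2)%:R.
have cI : injective c.
  move=> j k /(mulfI (lt0r_neq0 e0)) /invr_inj /eqP.
  by rewrite eqr_nat => /eqP[].
have [/allP sub|/allPn[_ /mapP[k _ ->] ck]] :=
    boolP (all (mem s) [seq c k | k <- iota 0 (size s).+1]).
  have := uniq_leq_size _ sub; rewrite map_inj_uniq// iota_uniq => /(_ isT).
  by rewrite size_map size_iota ltnn.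
exists (c k); split=> //; first by rewrite divr_gt0.
by rewrite ltr_pdivrMr// ltr_pMr// ltr1n.
Qed.

Lemma avoid_roots (p : {poly C}) (e : R) : p != 0 -> 0 < e ->
  exists t : R, [/\ 0 < t, t < e & p.[t%:C] != 0].
Proof.
move=> /finite_roots[rs hrs] e0; have [t [t0 te tn]] := avoid_finite (map (fun z : C => Re z) rs) e0.
exists t; split=> //; apply: contra tn => /hrs/(map_f (fun z : C => Re z)).
by [].
Qed.

(* A broken line 0, m, 1 with m on the bisector of [0, 1] meets a given root of [p] for
   at most one m. *)
Lemma avoid_broken_line (p : {poly C}) (e : R) : p.[0] != 0 -> p.[1] != 0 -> 0 < e ->
  exists t : R, [/\ 0 < t, t < e &
    forall l, 0 <= l <= 1 -> let m := (1 / 2) +i* t in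
      p.[l%:C * m] != 0 /\ p.[m + l%:C * (1 - m)] != 0].
Proof.
move=> p0 p1 e0; have pn : p != 0.
  by apply: contraNneq p0 => ->; rewrite horner0.
have [rs hrs] := finite_roots pn.
have [t [t0 te tn]] := avoid_finite
  (map (fun z : C => Im z / (2 * Re z)) rs ++
   map (fun z : C => Im z / (2 * Re (1 - z))) rs) e0.
move: tn; rewrite mem_cat negb_or => /andP[tn1 tn2].
exists t; split=> // l /andP[l0 l1] m; split.
- have [l00|ln] := eqVneq l 0; first by rewrite l00 mul0r.
  apply: contra tn1 => /hrs hz; apply/mapP; eexists; first exact: hz.
  by rewrite /m /= !mul0r subr0 addr0; field.
- have [l00|ln] := eqVneq l 1.
    by rewrite l00 rmorph1 mul1r [X in p.[X]]addrC subrK.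
  apply: contra tn2 => /hrs hz; apply/mapP; eexists; first exact: hz.
  rewrite /m /=; field.
by apply: contra ln => /eqP h; apply/eqP; lra.
Qed.

Definition cvx (K : set V) : Prop := forall x y t, K x -> K y -> 0 <= t <= 1 ->
  K (lin x (y - x) t%:C).

Lemma lin_at0 x d : lin x d 0 = x.
Proof. by case: x => a b; rewrite /lin !mul0r !addr0. Qed.

Lemma lin_at1 x y : lin x (y - x) 1 = y.
Proof. by case: x y => a b [c d]; rewrite /lin /= !mul1r; congr pair; ring. Qed.

Lemma lin_lin x d s y : lin x d s = y -> forall t,
  lin y (lin x d 1 - y) t = lin x d (s + t * (1 - s)).
Proof. by move=> <- t; rewrite /lin /=; congr pair; ring. Qed.

Lemma vcont_lin (T : topologicalType) x d (s : T -> C) : ccont s ->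
  vcont (fun p => lin x d (s p)).
Proof. by move=> cs; split => /=; solve_ccont. Qed.

Lemma ccont_id_real : ccont (fun t : R => t%:C).
Proof. by apply: ccont_real => t; exact: cvg_id. Qed.

(** On the complex line through [x] and [y] the curves cut out finitely many points, so a broken
    line through a point near the midpoint avoids them. That point is in [K] by openness, and the
    two segments by convexity. *)
Lemma linked_convex K x y : vopen K -> cvx K -> K x -> K y -> Zset x -> Zset y ->
  linked Zset K x y.
Proof.
move=> oK cK Kx Ky Zx Zy; set d := y - x.
have cm : vcont (fun t : R => lin x d ((1 / 2) +i* t)).
  by apply: vcont_lin; split=> t; [exact: cvg_cst|exact: cvg_id].
have Km : K (lin x d ((1 / 2) +i* 0)).
  by apply: (cK x y (1 / 2)) => //; apply/andP; split; lra.
have [e e0 he] := oK _ cm 0 Km.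
have px : (zpoly x d).[0] != 0 by apply/Zset_lin; rewrite lin_at0.
have py : (zpoly x d).[1] != 0 by apply/Zset_lin; rewrite lin_at1.
have [t [t0 te ht]] := avoid_broken_line px py e0.
set m : C := (1 / 2) +i* t.
have Kt : K (lin x d m) by apply: he; rewrite subr0 gtr0_norm.
have s1 : zpath (K `&` Zset) (fun l => lin x d (l%:C * m)).
  split; first by apply: vcont_lin; apply: ccontM; [exact: ccont_id_real|exact: ccont_cst].
  move=> l l01; split; last by apply/Zset_lin; have [] := ht l l01.
  have := cK x _ l Kx Kt l01; congr K; rewrite /lin /=; congr pair; ring.
have s2 : zpath (K `&` Zset) (fun l => lin x d (m + l%:C * (1 - m))).
  split.
    apply: vcont_lin; apply: ccontD; first exact: ccont_cst.
    by apply: ccontM; [exact: ccont_id_real|exact: ccont_cst].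
  move=> l l01; split; last by apply/Zset_lin; have [] := ht l l01.
  have := cK _ y l Kt Ky l01; rewrite -{1}(lin_at1 x y) -/d.
  by rewrite (lin_lin (erefl _)).
have := linked_trans (linked_path s1) _.
rewrite /= mul0r mul1r lin_at0; apply.
have := linked_path s2; rewrite /= mul0r mul1r addr0.
by rewrite [m + _]addrC subrK lin_at1.
Qed.

Lemma dense_Zset K x : vopen K -> K x -> exists2 z, K z & Zset z.
Proof.
(* A direction in which no equation vanishes identically: [z.1] and [z.2] have slopes 1 and 2, and
   [dsc] has leading coefficient 1/4, detected below by its second difference 1/2. *)
move=> oK Kx; pose d : V := (1, 2).
have [] := oK (fun t : R => lin x d t%:C) _ 0.
- exact/vcont_lin/ccont_id_real.
- by rewrite lin_at0.
move=> e e0 he.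
have p0 : zpoly x d != 0.
  rewrite /zpoly !mulf_neq0//.
  - apply/eqP => /(congr1 (fun p : {poly C} => p`_1)).
    by rewrite coefD coefZ coefC coefX coef0 /= add0r mulr1 => /eqP; rewrite oner_eq0.
  - apply/eqP => /(congr1 (fun p : {poly C} => p`_1)).
    by rewrite coefD coefZ coefC coefX coef0 /= add0r mulr1 => /eqP; rewrite pnatr_eq0.
  - apply/eqP => q0.
    have := congr1 (fun p : {poly C} => p.[0] + p.[2] - 2 * p.[1]) q0.
    rewrite !dpolyE !horner0 mulr0 subr0 addr0 => /eqP.
    rewrite (_ : _ - _ = 1 / 2); last by rewrite /dsc /mid /lin /=; field.
    by rewrite mulf_eq0 oner_eq0 invr_eq0 pnatr_eq0.
have [t [t0 te ht]] := avoid_roots p0 e0.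
exists (lin x d t%:C); last exact/Zset_lin.
by apply: he; rewrite subr0 gtr0_norm.
Qed.

Lemma cvxI K L : cvx K -> cvx L -> cvx (K `&` L).
Proof. by move=> cK cL x y t [? ?] [? ?] ?; split; [exact: cK|exact: cL]. Qed.

Lemma vopenI (K L : set V) : vopen K -> vopen L -> vopen (K `&` L).
Proof.
move=> oK oL f cf t [/(oK f cf)[e e0 he] /(oL f cf)[e' e0' he']].
exists (Num.min e e') => [|s]; first by rewrite lt_min e0.
by rewrite lt_min => /andP[/he ? /he'].
Qed.

Lemma vopen_bigcup (J : Type) (K : J -> set V) : (forall j, vopen (K j)) ->
  vopen (\bigcup_j K j).
Proof.
move=> oK f cf t [j _ /(oK j f cf)[e e0 he]]; exists e => // s /he h.
by exists j.
Qed.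

Lemma open_near (T : topologicalType) (f : R -> T) (A : set T) :
  continuous f -> open A -> forall t, A (f t) ->
  exists2 e, 0 < e & forall s, `|s - t| < e -> A (f s).
Proof.
move=> cf oA t At.
have : \forall s \near t, A (f s) by apply: (cf t); exact: open_nbhs_nbhs.
move=> /nbhs_ballP[e /= e0 he]; exists e => // s st; apply: he.
by rewrite /ball /= distrC.
Qed.

Definition co (k : nat) (z : V) : R :=
  match k with 0 => Re z.1 | 1 => Im z.1 | 2 => Re z.2 | _ => Im z.2 end.

Definition of_co (f : nat -> R) : V := (f 0 +i* f 1, f 2 +i* f 3).

Lemma co_of_co f k : (k < 4)%N -> co k (of_co f) = f k.
Proof. by case: k => [|[|[|[|]]]]. Qed.

Lemma continuous_co (T : topologicalType) (f : T -> V) k : vcont f ->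
  continuous (fun x => co k (f x)).
Proof. by move=> [[? ?] [? ?]]; case: k => [|[|[|k]]]. Qed.

Lemma co_lin k x d (t : R) : co k (lin x d t%:C) = co k x + t * co k d.
Proof.
case: x d => [[a b] [c e]] [[a' b'] [c' e']].
by case: k => [|[|[|k]]] /=; ring.
Qed.

Lemma coB k x y : co k (x - y) = co k x - co k y.
Proof.
case: x y => [[a b] [c e]] [[a' b'] [c' e']].
by case: k => [|[|[|k]]] /=.
Qed.

Definition box (l r : nat -> R) : set V :=
  [set z | forall k, (k < 4)%N -> l k < co k z < r k].

Lemma vopen_co k (a b : R) : vopen [set z | a < co k z < b].
Proof.
move=> f cf t /=.
have -> : (a < co k (f t) < b) = (co k (f t) \in `]a, b[) by rewrite in_itv.
move=> h; have := open_near (@continuous_co _ _ k cf) (interval_open (a := BRight a) (b := BLeft b) isT isT) (t := t) h.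
by move=> [e e0 he]; exists e => // s /he /=; rewrite in_itv.
Qed.

Lemma cvx_co k (a b : R) : cvx [set z | a < co k z < b].
Proof.
move=> x y t /= /andP[x1 x2] /andP[y1 y2] t01; rewrite co_lin coB.
have -> : co k x + t * (co k y - co k x) = (1 - t) * co k x + t * co k y by ring.
rewrite convex_lt// andbT -ltrN2.
have -> : - ((1 - t) * co k x + t * co k y) = (1 - t) * (- co k x) + t * (- co k y).
  by ring.
by rewrite convex_lt// ltrN2.
Qed.

Lemma boxE l r : box l r = [set z | l 0 < co 0 z < r 0] `&` [set z | l 1 < co 1 z < r 1]
  `&` [set z | l 2 < co 2 z < r 2] `&` [set z | l 3 < co 3 z < r 3].
Proof.
apply/seteqP; split=> z; first by move=> h; do ![split]; exact: h.
by move=> [[[h0 h1] h2] h3] [|[|[|[|]]]].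
Qed.

Lemma vopen_box l r : vopen (box l r).
Proof. by rewrite boxE; do ![apply: vopenI]; exact: vopen_co. Qed.

Lemma cvx_box l r : cvx (box l r).
Proof. by rewrite boxE; do ![apply: cvxI]; exact: cvx_co. Qed.

Lemma box_sub l r l' r' : (forall k, (k < 4)%N -> l' k <= l k) ->
  (forall k, (k < 4)%N -> r k <= r' k) -> box l r `<=` box l' r'.
Proof.
move=> hl hr z h k k4; have /andP[h1 h2] := h k k4.
by rewrite (le_lt_trans (hl k k4))// (lt_le_trans h2)// hr.
Qed.

Definition cube z (e : R) := box (fun k => co k z - e) (fun k => co k z + e).

End Discriminant.

(** * A piecewise linear loop round the origin *)

Section Square.
Variable R : realType.
Local Notation C := R[i].

Definition clip (x : R) : R := Num.max (-1) (Num.min 1 x).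

Definition sqx (t : R) : R := Num.max (clip (3 - 8 * t)) (clip (8 * t - 7)).
Definition sqy (t : R) : R := Num.min (clip (8 * t - 1)) (clip (5 - 8 * t)).

(* The boundary of the square [-1, 1] + i[-1, 1], run through counterclockwise
   from the corner 1 - i. *)
Definition sq (t : R) : C := sqx t +i* sqy t.

Let le_N11 : (-1 : R) <= 1.
Proof. by lra. Qed.

Lemma clip_bound x : -1 <= clip x <= 1.
Proof. by rewrite /clip le_max lexx /= ge_max ge_min lexx /= andbT. Qed.

Lemma clip_id x : -1 <= x <= 1 -> clip x = x.
Proof. by move=> /andP[h1 h2]; rewrite /clip (min_idPr h2) (max_idPr h1). Qed.

Lemma clip_lo x : x <= -1 -> clip x = -1.
Proof.
move=> h; rewrite /clip (min_idPr _); last exact: le_trans h le_N11.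
exact: (max_idPl h).
Qed.

Lemma clip_hi x : 1 <= x -> clip x = 1.
Proof.
by move=> h; rewrite /clip (min_idPl h); exact/max_idPr.
Qed.

Lemma sq_bound t : (-1 <= Re (sq t) <= 1) /\ (-1 <= Im (sq t) <= 1).
Proof.
rewrite /sq /= /sqx /sqy le_max ge_max le_min ge_min.
have h x := andP (clip_bound x).
by rewrite !(h _).1 !(h _).2.
Qed.

Lemma sq_east t : 0 <= t <= 1 / 4 -> sq t = 1 +i* (8 * t - 1).
Proof.
move=> /andP[t0 t1]; rewrite /sq /sqx /sqy; congr Complex.
  rewrite (@clip_hi (3 - 8 * t)) ?(@clip_lo (8 * t - 7)); try lra.
  by apply/max_idPl; lra.
rewrite (@clip_id (8 * t - 1)); last by apply/andP; split; lra.
rewrite (@clip_hi (5 - 8 * t)); last by lra.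
by apply/min_idPl; lra.
Qed.

Lemma sq_north t : 1 / 4 <= t <= 1 / 2 -> sq t = (3 - 8 * t) +i* 1.
Proof.
move=> /andP[t0 t1]; rewrite /sq /sqx /sqy; congr Complex.
  rewrite (@clip_id (3 - 8 * t)) ?(@clip_lo (8 * t - 7)); try lra.
  by apply/max_idPl; lra.
rewrite (@clip_hi (8 * t - 1)) ?(@clip_hi (5 - 8 * t)); try lra.
by apply/min_idPl; lra.
Qed.

Lemma sq_west t : 1 / 2 <= t <= 3 / 4 -> sq t = (-1) +i* (5 - 8 * t).
Proof.
move=> /andP[t0 t1]; rewrite /sq /sqx /sqy; congr Complex.
  rewrite (@clip_lo (3 - 8 * t)) ?(@clip_lo (8 * t - 7)); try lra.
  by apply/max_idPl; lra.
rewrite (@clip_hi (8 * t - 1)) ?(@clip_id (5 - 8 * t)); try lra.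
by apply/min_idPr; lra.
Qed.

Lemma sq_south t : 3 / 4 <= t <= 1 -> sq t = (8 * t - 7) +i* (-1).
Proof.
move=> /andP[t0 t1]; rewrite /sq /sqx /sqy; congr Complex.
  rewrite (@clip_lo (3 - 8 * t)) ?(@clip_id (8 * t - 7)); try lra.
  by apply/max_idPr; lra.
rewrite (@clip_hi (8 * t - 1)) ?(@clip_lo (5 - 8 * t)); try lra.
by apply/min_idPr; lra.
Qed.

(** Positive on the open half-plane facing [q]. The four half-planes cover C minus 0, and opposite
    ones are disjoint. *)
Definition side (q : quarter) (z : C) : R :=
  match q with East => Re z | North => Im z | West => - Re z | South => - Im z end.

Lemma side_sq q t : qstart R q <= t <= qstart R q + 1 / 4 -> side q (sq t) = 1.
Proof.
case: q => h; have [h1 h2] := andP h; rewrite /qstart in h1 h2.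
- by rewrite sq_east//; apply/andP; split; lra.
- by rewrite sq_north//; apply/andP; split; lra.
- by rewrite sq_west /= ?opprK//; apply/andP; split; lra.
- by rewrite sq_south /= ?opprK//; apply/andP; split; lra.
Qed.

Lemma qstart_cover t : 0 <= t <= 1 -> exists q, qstart R q <= t <= qstart R q + 1 / 4.
Proof.
move=> /andP[t0 t1].
have [h|h] := leP t (1 / 4); first by exists East; rewrite /= add0r t0.
have [h2|h2] := leP t (1 / 2).
  by exists North => /=; apply/andP; split; lra.
have [h3|h3] := leP t (3 / 4).
  by exists West => /=; apply/andP; split; lra.
by exists South => /=; apply/andP; split; lra.
Qed.

Lemma side_neq0 q z : 0 < side q z -> z != 0.
Proof. by apply: contraTneq => ->; case: q => /=; rewrite ?oppr0 ltxx. Qed.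

Lemma neq0_side z : z != 0 -> exists q, 0 < side q z.
Proof.
case: z => x y; rewrite eq_complex /= negb_and => h.
have [x0|x0|x0] := ltgtP x 0.
- by exists West; rewrite /= oppr_gt0.
- by exists East.
have [y0|y0|y0] := ltgtP y 0.
- by exists South; rewrite /= oppr_gt0.
- by exists North.
by move: h; rewrite x0 y0 eqxx.
Qed.

Lemma sq_neq0 t : 0 <= t <= 1 -> sq t != 0.
Proof.
move=> /qstart_cover[q /side_sq h]; apply: (@side_neq0 q).
by rewrite h ltr01.
Qed.

Lemma side_opp q z : 0 < side q z -> ~ 0 < side (qnext (qnext q)) z.
Proof. by case: q => /= h; apply/negP; rewrite -leNgt; lra. Qed.

Lemma side_corner q : side (qnext q) (sq (qstart R q + 1 / 4)) = 1.
Proof.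
case: q; rewrite /qstart.
- by rewrite sq_north//; apply/andP; split; lra.
- by rewrite sq_west /= ?opprK//; apply/andP; split; lra.
- by rewrite sq_south /= ?opprK//; apply/andP; split; lra.
- by rewrite sq_south /=; lra.
Qed.

Lemma sideN q z : side q (- z) = side (qnext (qnext q)) z.
Proof. by case: z => x y; case: q => /=; rewrite ?opprK. Qed.

Lemma sideZ q (r : R) z : side q (r%:C * z) = r * side q z.
Proof. by case: z => x y; case: q => /=; ring. Qed.

Lemma sideD q z w : side q (z + w) = side q z + side q w.
Proof. by case: z w => x y [x' y']; case: q => /=; rewrite ?opprD. Qed.

Lemma continuous_side (T : topologicalType) q (f : T -> C) : ccont f ->
  continuous (fun x => side q (f x)).
Proof. by move=> [c1 c2]; case: q => //= x; apply: cvgN; [exact: c1|exact: c2]. Qed.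

Lemma sq0 : sq 0 = 1 -i* 1.
Proof. by rewrite sq_east; [rewrite mulr0 sub0r|rewrite lexx /=; lra]. Qed.

Lemma sq1 : sq 1 = 1 -i* 1.
Proof. by rewrite sq_south; [congr Complex; ring|rewrite lexx andbT; lra]. Qed.

(** Central symmetry makes [sq ^+ 2] run twice through one loop on [0, 1]; this is the source of the
    square in [weightedE]. *)
Lemma sq_half t : 0 <= t <= 1 / 2 -> sq (1 / 2 + t) = - sq t.
Proof.
move=> /andP[t0 t1]; have [h|h] := leP t (1 / 4).
  rewrite (@sq_east t) ?t0// sq_west; last by apply/andP; split; lra.
  by rewrite /=; congr Complex; lra.
rewrite (@sq_north t); last by apply/andP; split; lra.
rewrite sq_south; last by apply/andP; split; lra.
by rewrite /=; congr Complex; lra.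
Qed.

Lemma continuous_clip_affine (T : topologicalType) (u : T -> R) (c d : R) :
  continuous u -> continuous (fun x => clip (c + d * u x)).
Proof.
move=> cu; rewrite /clip.
have cv : continuous (fun x => c + d * u x).
  by move=> x; apply: cvgD; [exact: cvg_cst|apply: cvgM; [exact: cvg_cst|exact: cu]].
have cm : continuous (fun x => Num.min 1 (c + d * u x)).
  by move=> x; apply: (@continuous_min R T (cst 1) _ x (@cvg_cst _ _ _ _ _)); exact: cv.
by move=> x; apply: (@continuous_max R T (cst (-1)) _ x (@cvg_cst _ _ _ _ _)); exact: cm.
Qed.

Lemma ccont_sq (T : topologicalType) (u : T -> R) : continuous u ->
  ccont (fun x => sq (u x)).
Proof.
move=> cu.
have e c d : (fun x => clip (c + d * u x)) = fun x => clip (d * u x + c).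
  by apply/funext => x; rewrite addrC.
have c1 : continuous (fun x => clip (3 - 8 * u x)).
  by have := @continuous_clip_affine _ _ 3 (- 8) cu; under eq_fun do rewrite mulNr.
have c2 : continuous (fun x => clip (8 * u x - 7)).
  by have := @continuous_clip_affine _ _ (- 7) 8 cu; rewrite e.
have c3 : continuous (fun x => clip (8 * u x - 1)).
  by have := @continuous_clip_affine _ _ (- 1) 8 cu; rewrite e.
have c4 : continuous (fun x => clip (5 - 8 * u x)).
  by have := @continuous_clip_affine _ _ 5 (- 8) cu; under eq_fun do rewrite mulNr.
split=> x.
- exact: (@continuous_max R T _ _ x (c1 x) (c2 x)).
- exact: (@continuous_min R T _ _ x (c3 x) (c4 x)).
Qed.

End Square.

(** * Small neighbourhoods in C^2 *)

Section Neighbourhoods.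
Variable R : realType.
Local Notation C := R[i].
Local Notation V := (R[i] * R[i])%type.
Local Notation R4 := ((R * R) * (R * R))%type.

Definition of_R4 (q : R4) : V := (q.1.1 +i* q.1.2, q.2.1 +i* q.2.2).
Definition to_R4 (z : V) : R4 := ((Re z.1, Im z.1), (Re z.2, Im z.2)).

Lemma to_R4K z : of_R4 (to_R4 z) = z.
Proof. by case: z => [[a b] [c d]]. Qed.

Lemma vcont_of_R4 : vcont of_R4.
Proof.
have c1 : continuous (fun q : R4 => q.1) by move=> q; exact: cvg_fst.
have c2 : continuous (fun q : R4 => q.2) by move=> q; exact: cvg_snd.
split; split=> q /=.
- exact: (@continuous_comp _ _ _ fst fst q (c1 q) (@cvg_fst _ _ _ _ _)).
- exact: (@continuous_comp _ _ _ fst snd q (c1 q) (@cvg_snd _ _ _ _ _)).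
- exact: (@continuous_comp _ _ _ snd fst q (c2 q) (@cvg_fst _ _ _ _ _)).
- exact: (@continuous_comp _ _ _ snd snd q (c2 q) (@cvg_snd _ _ _ _ _)).
Qed.

Lemma cube_near (P : set V) z : (\forall q \near to_R4 z, P (of_R4 q)) ->
  exists2 e, 0 < e & cube z e `<=` P.
Proof.
move=> /nbhs_ballP[e /= e0 he]; exists e => // z' zz'; rewrite -(to_R4K z').
have h k (k4 : (k < 4)%N) : `|co k z - co k z'| < e.
  by rewrite distrC ltr_distl; exact: zz'.
apply: he; split; split; rewrite /ball /=.
- exact: (h 0%N).
- exact: (h 1%N).
- exact: (h 2%N).
- exact: (h 3%N).
Qed.

Lemma near_neq0 (T : topologicalType) (f : T -> C) x : ccont f -> f x != 0 ->
  \forall y \near x, f y != 0.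
Proof.
move=> cf /neq0_side[q sq0].
have h := cvgr_gt _ (@continuous_side R T q f cf x) _ sq0.
near=> y; apply: (@side_neq0 R q); near: y; exact: h.
Unshelve. all: by end_near.
Qed.

Lemma near_cube (T : topologicalType) (f : T -> V) x e : vcont f -> 0 < e ->
  \forall y \near x, cube (f x) e (f y).
Proof.
move=> cf e0.
have h k : \forall y \near x, co k (f x) - e < co k (f y) < co k (f x) + e.
  have ck := @continuous_co R T f k cf x.
  have l1 : co k (f x) - e < co k (f x) by rewrite ltrBlDr ltrDl.
  have l2 : co k (f x) < co k (f x) + e by rewrite ltrDl.
  have h1 := cvgr_gt _ ck _ l1; have h2 := cvgr_lt _ ck _ l2.
  by near=> y; apply/andP; split; near: y; [exact: h1|exact: h2].
near=> y; case=> [|[|[|[|//]]]] _; near: y; exact: h.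
Unshelve. all: by end_near.
Qed.

Lemma cube_center (z : V) (e : R) : 0 < e -> cube z e z.
Proof. by move=> e0 k _; rewrite ltrBlDr !ltrDl e0. Qed.

Lemma Zset_near z : Zset z -> \forall q \near to_R4 z, Zset (of_R4 q).
Proof.
move=> [z1 z2 z3]; have [c1 c2] := vcont_of_R4; have c3 := ccont_dsc vcont_of_R4.
have h1 : \forall q \near to_R4 z, (of_R4 q).1 != 0 by apply: near_neq0 => //; rewrite to_R4K.
have h2 : \forall q \near to_R4 z, (of_R4 q).2 != 0 by apply: near_neq0 => //; rewrite to_R4K.
have h3 : \forall q \near to_R4 z, dsc (of_R4 q) != 0 by apply: near_neq0 => //; rewrite to_R4K.
near=> q; split; near: q; [exact: h1|exact: h2|exact: h3].
Unshelve. all: by end_near.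
Qed.

Definition nrm (z : C) : R := Re z ^+ 2 + Im z ^+ 2.

Lemma nrmM z w : nrm (z * w) = nrm z * nrm w.
Proof. by case: z w => a b [c d]; rewrite /nrm /=; ring. Qed.

Lemma nrm_gt0 z : z != 0 -> 0 < nrm z.
Proof.
case: z => a b; rewrite eq_complex /= negb_and /nrm /= => /orP[] h.
  by rewrite ltr_wpDr// ?sqr_ge0// exprn_even_gt0.
by rewrite ltr_pwDr// ?sqr_ge0// exprn_even_gt0.
Qed.

Lemma continuous_nrm (T : topologicalType) (f : T -> C) : ccont f ->
  continuous (fun x => nrm (f x)).
Proof.
move=> [c1 c2] x; apply: cvgD; rewrite /=.
  by apply: (cvgM (c1 x) (c1 x)).
by apply: (cvgM (c2 x) (c2 x)).
Qed.

(** [nrm] is |z|^2. Since |r sq t| <= sqrt(2) r < 2 r <= |b|^2, and likewise for 1 - b, the loop in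
    the w-plane misses b^2 and (1 - b)^2, where the lines are. *)
Lemma Zset_meridian (b : C) (r : R) t : 0 <= t <= 1 ->
  0 < r -> 2 * r <= nrm b -> 2 * r <= nrm (1 - b) -> Zset (psi b (r%:C * sq t)).
Proof.
move=> t01 r0 rb rb'.
have small (c : C) : 2 * r <= nrm c -> c ^+ 2 - r%:C * sq t != 0.
  move=> rc; rewrite subr_eq0; apply/eqP => /(congr1 nrm).
  rewrite expr2 !nrmM => e.
  have [/andP[x1 x2] /andP[y1 y2]] := sq_bound t.
  have : nrm r%:C = r ^+ 2 by rewrite /nrm /=; ring.
  have : nrm (sq t) <= 2 by rewrite /nrm; nra.
  move: e; move: (nrm (sq t)) (nrm r%:C) (nrm c) rc => n m k rc e n2 mE; nra.
split; rewrite ?dsc_psi /=; [exact: small|exact: small|].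
rewrite mulf_neq0 ?sq_neq0//.
by apply/eqP => -[] h; move: r0; rewrite h ltxx.
Qed.

End Neighbourhoods.

(** * Meridians of the conic *)

Section Generation.
Variables (R : realType) (G : groupType).
Local Notation C := R[i].
Local Notation V := (R[i] * R[i])%type.
Variable (Phi : (R -> V) -> G).
Hypothesis tr : transport (@Zset R) Phi.
Variable N : set G.
Hypothesis nN : normal_subset N.

Local Notation good := (good (@Zset R) Phi N).

Definition circle_w (b : C) (r : R) : R -> V := fun t => psi b (r%:C * sq t).

Lemma loop_free_homotopy (H : R -> R -> V) :
  vcont (fun p : R * R => H p.1 p.2) ->
  (forall x y, 0 <= x <= 1 -> 0 <= y <= 1 -> Zset (H x y)) ->
  (forall y, H 0 y = H 1 y) ->
  N (Phi (fun x => H x 0)) -> N (Phi (fun x => H x 1)).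
Proof.
move=> cH ZH H01 h; have [g ->] := Phi_free_homotopy tr cH ZH H01.
exact: normalJ.
Qed.

Let cont1 : continuous (fun p : R * R => p.1).
Proof. by move=> p; exact: cvg_fst. Qed.

Let cont2 : continuous (fun p : R * R => p.2).
Proof. by move=> p; exact: cvg_snd. Qed.

Lemma meridian_step (b : R -> C) (r : R -> R) : ccont b -> continuous r ->
  (forall y, 0 <= y <= 1 ->
     [/\ 0 < r y, 2 * r y <= nrm (b y) & 2 * r y <= nrm (1 - b y)]) ->
  N (Phi (circle_w (b 0) (r 0))) -> N (Phi (circle_w (b 1) (r 1))).
Proof.
move=> cb cr h; apply: (@loop_free_homotopy (fun x y => psi (b y) ((r y)%:C * sq x))).
- apply: vcont_psi; first exact: (ccont_comp cont2 cb).
  apply: ccontM; last exact: ccont_sq.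
  by apply: ccont_real => p; apply: continuous_comp; [exact: cont2|exact: cr].
- by move=> x y x01 /h[? ? ?]; exact: Zset_meridian.
- by move=> y; rewrite sq0 sq1.
Qed.

(** The largest radius that [Zset_meridian] allows at [b]. *)
Definition safe (b : C) : R := Num.min (nrm b) (nrm (1 - b)) / 2.

Lemma meridian_segment (b : R -> C) u v : ccont b -> b 0 = u -> b 1 = v ->
  (forall y, 0 <= y <= 1 -> b y != 0 /\ 1 - b y != 0) ->
  N (Phi (circle_w u (safe u))) -> N (Phi (circle_w v (safe v))).
Proof.
move=> cb <- <- h; apply: (@meridian_step b (fun y => safe (b y))) => //.
  have cb' : ccont (fun y => 1 - b y) by solve_ccont.
  have cm : continuous (fun y => Num.min (nrm (b y)) (nrm (1 - b y))).
    move=> y; have h1 := continuous_nrm cb (x := y).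
    exact: (@continuous_min R R _ _ y h1 (continuous_nrm cb' (x := y))).
  by move=> y; apply: cvgM; [exact: cm|exact: cvg_cst].
move=> y /h[/nrm_gt0 h1 /nrm_gt0 h2]; rewrite /safe.
by case: (leP (nrm (b y)) (nrm (1 - b y))) => h3; split; lra.
Qed.

Variable h0 : R.
Hypothesis h0E : h0 = 1 / 32.

Hypothesis Ns : N (Phi (circle_w (1 / 4)%:C h0)).

(** The conic is parametrized by [b], with its tangency points at b = 0 and b = 1. It stays
    connected without them, so all its meridians are freely homotopic to the one at 1/4. *)
Lemma meridian_all (b : C) (r : R) : b != 0 -> 1 - b != 0 -> 0 < r -> r <= safe b ->
  N (Phi (circle_w b r)).
Proof.
move=> b0 b1 r0 rs.
have Nb : N (Phi (circle_w b (safe b))).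
  pose x : C := (1 / 4)%:C; pose d := b - x.
  pose l := x%:P + d *: 'X; pose p : {poly C} := l * (1 - l).
  have lE s : l.[s] = x + s * d by rewrite /l !hornerE mulrC.
  clearbody l.
  have pE s : (p.[s] != 0) = (x + s * d != 0) && (1 - (x + s * d) != 0).
    by rewrite /p hornerM mulf_eq0 negb_or !hornerE lE.
  (* The value 1/32 of [h0] is the safe radius at 1/4, half of |1/4|^2. *)
  have xE : safe x = h0.
    rewrite /safe h0E (_ : nrm x = 1 / 16); last by rewrite /nrm /=; field.
    rewrite (_ : nrm (1 - x) = 9 / 16); last by rewrite /nrm /=; field.
    by case: leP; lra.
  have x0 : x != 0 by apply/eqP => -[]; lra.
  have x1 : 1 - x != 0 by apply/eqP => -[]; lra.
  have [||t [_ _ ht]] := @avoid_broken_line R p 1 _ _ ltr01.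
  - by rewrite pE mul0r addr0 x0.
  - by rewrite pE mul1r /d [x + _]addrC subrK b0.
  set m : C := (1 / 2) +i* t in ht.
  have N1 : N (Phi (circle_w (x + m * d) (safe (x + m * d)))).
    have := @meridian_segment (fun l => x + l%:C * m * d) x (x + m * d).
    rewrite !mul0r addr0 mul1r xE; apply => //.
      by have := @ccont_id_real R; move=> ?; solve_ccont.
    by move=> y y01; have [] := ht y y01; rewrite pE => /andP[].
  have := @meridian_segment (fun l => x + (m + l%:C * (1 - m)) * d) (x + m * d) b.
  apply => //.
  - by have := @ccont_id_real R; move=> ?; solve_ccont.
  - by rewrite mul0r addr0.
  - by rewrite mul1r /d; ring.
  - by move=> y y01; have [_] := ht y y01; rewrite pE => /andP[].
have := @meridian_step (fun=> b) (fun y => safe b + (r - safe b) * y) _ _ _ _.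
rewrite mulr1 mulr0 addr0 [safe b + _]addrC subrK; apply => //.
- exact: ccont_cst.
- exact: continuous_affine1.
move=> y /andP[y0 y1].
have h1 : 2 * safe b <= nrm b by rewrite /safe; case: (leP (nrm b) (nrm (1 - b))) => h; lra.
have h2 : 2 * safe b <= nrm (1 - b) by rewrite /safe; case: (leP (nrm b) (nrm (1 - b))) => h; lra.
have h3 : safe b + (r - safe b) * y <= safe b by nra.
have h4 : 0 < safe b + (r - safe b) * y by nra.
by split=> //; lra.
Qed.

Lemma good_Zset z : Zset z -> exists2 e, 0 < e & good (cube z e).
Proof.
move=> /Zset_near/cube_near[e e0 he]; exists e => //.
apply: (good_starshaped tr nN (c := fun y x => lin z (x - z) y%:C) (q := z)).
- move=> f cf; have [[d1 d2] [d3 d4]] := vcont_comp cont1 cf.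
  have [e1 e2] : ccont (fun p : R * R => p.2%:C) by exact: ccont_real.
  by split; rewrite /lin /=; apply: ccontD; try exact: ccont_cst;
    apply: ccontM => //; apply: ccontD => //; exact: ccont_cst.
- by move=> x; rewrite lin_at0.
- by move=> x; rewrite lin_at1.
- move=> y x y01 Kx _; apply: he; apply: cvx_box => //.
  exact: cube_center.
Qed.

End Generation.

Section Conic.
Variables (R : realType) (G : groupType).
Local Notation C := R[i].
Local Notation V := (R[i] * R[i])%type.
Variable (Phi : (R -> V) -> G).
Hypothesis tr : transport (@Zset R) Phi.
Variable N : set G.
Hypothesis nN : normal_subset N.
Variable h0 : R.
Hypothesis h0E : h0 = 1 / 32.
Hypothesis Ns : N (Phi (circle_w (1 / 4)%:C h0)).

Local Notation good := (good (@Zset R) Phi N).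

Lemma goodZ (S T : set V) : (forall z, S z -> Zset z -> T z) -> good T -> good S.
Proof.
move=> ST [u tu]; exists u => f Sf; apply: tu.
by apply: (zpathS _ Sf) => z [Sz Zz]; split=> //; exact: ST.
Qed.

Definition coords (z : V) : V := (mid z, dsc z).

Lemma vcont_coords (T : topologicalType) (z : T -> V) : vcont z ->
  vcont (fun x => coords (z x)).
Proof. by move=> cz; split; [exact: ccont_mid|exact: ccont_dsc]. Qed.

Lemma vcont_psi_pair (T : topologicalType) (z : T -> V) : vcont z ->
  vcont (fun x => psi (z x).1 (z x).2).
Proof. by move=> [? ?]; exact: vcont_psi. Qed.

Lemma vopen_side (f : V -> C) q : (forall g : R -> V, vcont g -> ccont (fun t => f (g t))) ->
  vopen [set z | 0 < side q (f z)].
Proof.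
move=> cf g cg t /= h.
have cs := @continuous_side R R q _ (cf g cg).
have [e e0 he] := open_near cs (@open_gt R 0) (t := t) h.
by exists e.
Qed.

Lemma cvx_side (f : V -> C) q : (forall x d s, f (lin x d s) = f x + s * (f (x + d) - f x)) ->
  cvx [set z : V | 0 < side q (f z)].
Proof.
move=> fl x y t /= fx fy t01; rewrite fl (_ : x + (y - x) = y); last first.
  by rewrite addrC subrK.
rewrite sideD sideZ (_ : f y - f x = f y + (-1)%:C * f x).
  rewrite sideD sideZ.
  rewrite (_ : _ + _ = (1 - t) * side q (f x) + t * side q (f y)); last by ring.
  rewrite -ltrN2 oppr0 opprD -!mulrN.
  by apply: convex_lt; rewrite // oppr_lt0.
by rewrite rmorphN1 mulN1r.
Qed.

(** In the coordinates (mid, dsc) the conic is w = 0, and a small cube misses the lines. The part w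
    != 0 is covered by four convex pieces, one for each half-plane of w, arranged cyclically round
    the conic; the loop that [glue_cycle] asks for is a meridian. *)
Lemma conic_good (b : C) : b != 0 -> 1 - b != 0 ->
  exists2 e, 0 < e & good (cube (psi b 0) e).
Proof.
move=> b0 b1.
have [e e0 he] : exists2 e, 0 < e & cube (b, 0) e `<=`
    [set y : V | y.1 ^+ 2 - y.2 != 0 /\ (1 - y.1) ^+ 2 - y.2 != 0].
  apply: cube_near; have [c1 c2] := @vcont_of_R4 R.
  have [d1 d2] := vcont_psi_pair (@vcont_of_R4 R).
  have n1 := @near_neq0 R _ _ (to_R4 (b, 0)) d1.
  have n2 := @near_neq0 R _ _ (to_R4 (b, 0)) d2.
  rewrite to_R4K /= !subr0 in n1 n2.
  have {}n1 := n1 (expf_neq0 2 b0); have {}n2 := n2 (expf_neq0 2 b1).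
  near=> q; split; near: q; [exact: n1|exact: n2].
pose K q : set V := [set z | cube (b, 0) e (coords z) /\ 0 < side q (dsc z)].
pose L q : set V := [set y | cube (b, 0) e y /\ 0 < side q y.2].
have KL q z : L q z -> K q (psi z.1 z.2).
  by case: z => x y [h1 h2]; split; rewrite /coords ?mid_psi dsc_psi.
have LK q z : K q z -> L q (coords z) by [].
have LZ q y : L q y -> Zset (psi y.1 y.2).
  move=> [/he[h1 h2] /side_neq0 h3]; split => //=.
  by rewrite dsc_psi.
have cL q : cvx (L q).
  move=> x y t [x1 x2] [y1 y2] t01; split; first exact: cvx_box.
  have cs : cvx [set z : V | 0 < side q z.2].
    by apply: cvx_side => x' d s; rewrite /= [x'.2 + d.2]addrC addrK.
  exact: (cs x y t).
have oK q : vopen (K q).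
  apply: vopenI; last by apply: vopen_side => g; exact: ccont_dsc.
  by move=> f cf t; exact: (vopen_box (vcont_coords cf)).
(* Small enough to stay in the cube and to satisfy [meridian_all]. *)
pose r : R := Num.min (e / 2) (safe b).
have sb : 0 < safe b.
  by rewrite /safe divr_gt0// lt_min !nrm_gt0.
have r0 : 0 < r by rewrite /r lt_min sb divr_gt0.
have re : r < e by rewrite /r gt_min ltr_pdivrMr// ltr_pMr// ltr1n.
have Lsq q t : side q (sq t) = 1 -> L q (b, r%:C * sq t).
  move=> s1; split; last by rewrite /= sideZ s1 mulr1.
  have [/andP[x1 x2] /andP[y1 y2]] := sq_bound t.
  rewrite /= in x1 x2 y1 y2.
  by move=> [|[|[|[|//]]]] _ /=; apply/andP; split; nra.
have corner q : side q (sq (qstart R q + 1 / 4)) = 1.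
  by apply: side_sq; rewrite lerDl lexx andbT; lra.
have gK q : good (K q).
  have mid_q : side q (sq (qstart R q + 1 / 8)) = 1.
    by apply: side_sq; apply/andP; split; lra.
  pose y0 : V := (b, r%:C * sq (qstart R q + 1 / 8)).
  pose c (y : R) (z : V) := let m := lin y0 (coords z - y0) y%:C in psi m.1 m.2.
  apply: (good_starshaped tr nN (c := c) (q := psi y0.1 y0.2)).
  - move=> f cf; apply: vcont_psi_pair.
    have c1 : continuous (fun p : R * R => p.1) by move=> p; exact: cvg_fst.
    have c2 : ccont (fun p : R * R => p.2%:C).
      by apply: ccont_real => p; exact: cvg_snd.
    have [d1 d2] := vcont_coords (vcont_comp c1 cf).
    by split; rewrite /lin /=; solve_ccont.
  - by move=> z; rewrite /c lin_at0.
  - by move=> z; rewrite /c lin_at1 psiK.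
  - by move=> y z y01 /LK Lz _; apply: (LZ q); apply: cL => //; exact: Lsq.
have conn q z : (K q `&` K (qnext q) `&` @Zset R) z ->
    linked (@Zset R) (K q `&` K (qnext q)) (circle_w b r (qstart R q + 1 / 4)) z.
  move=> [[/LK L1 /LK L2] _]; pose y0 : V := (b, r%:C * sq (qstart R q + 1 / 4)).
  pose f (y : R) := let m := lin y0 (coords z - y0) y%:C in psi m.1 m.2.
  have := @linked_path R (@Zset R) (K q `&` K (qnext q)) f.
  rewrite {2}/f lin_at0 {2}/f lin_at1 psiK; apply; split.
    by apply: vcont_psi_pair; apply: vcont_lin; exact: ccont_id_real.
  move=> t t01.
  have h1 : L q (lin y0 (coords z - y0) t%:C) by apply: cL => //; exact: Lsq.
  have h2 : L (qnext q) (lin y0 (coords z - y0) t%:C).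
    by apply: cL => //; apply: Lsq; exact: side_corner.
  by split; [split; exact: KL|exact: LZ h1].
have gU : good (\bigcup_q K q).
  apply: (glue_cycle tr nN oK gK _ conn).
  - by move=> q z _ [_ /side_opp h] [_]; exact: h.
  - have cm : vcont (circle_w b r).
      apply: vcont_psi; first exact: ccont_cst.
      apply: ccontM; first exact: ccont_cst.
      by apply: ccont_sq => t; exact: cvg_id.
    split=> // t /qstart_cover[q /side_sq h].
    by apply: (LZ q (b, r%:C * sq t)); exact: Lsq.
  - by rewrite /circle_w sq0 sq1.
  - by move=> q t /side_sq h; apply: (KL q (b, r%:C * sq t)); exact: Lsq.
  - by apply: (meridian_all tr nN h0E Ns) => //; rewrite /r ge_min lexx orbT.
have [d d0 hd] : exists2 d, 0 < d & cube (psi b 0) d `<=`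
    [set z | cube (coords (psi b 0)) e (coords z)].
  apply: cube_near.
  have := @near_cube R _ _ (to_R4 (psi b 0)) _ (vcont_coords (@vcont_of_R4 R)) e0.
  by rewrite to_R4K.
exists d => //; apply: (goodZ _ gU) => z /hd h [_ _ /neq0_side[q sq0']].
by exists q => //; split=> //; move: h; rewrite /= {1}/coords mid_psi dsc_psi.
Unshelve. all: by end_near.
Qed.

(** The tangency points lie on the lines, so a point of the conic off the lines is covered by
    [conic_good]. *)
Lemma good_local (z : V) : z.1 != 0 -> z.2 != 0 -> exists2 e, 0 < e & good (cube z e).
Proof.
move=> z1 z2; have [d0|d0] := eqVneq (dsc z) 0; last exact: good_Zset.
have zE : z = psi (mid z) 0 by rewrite -d0 psiK.
rewrite zE; apply: conic_good.
  by apply: contraNneq z1 => m0; rewrite zE /psi m0 /= expr0n subr0.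
by apply: contraNneq z2 => m0; rewrite zE /psi m0 /= expr0n subr0.
Qed.

Lemma good_glue2 (K L : set V) : vopen K -> vopen L -> cvx K -> cvx L ->
  good K -> good L -> K `&` L !=set0 -> good (K `|` L).
Proof.
move=> oK oL cK cL gK gL [x KLx].
pose F (j : bool) := if j then K else L.
have oF j : vopen (F j) by case: j.
have cF j : cvx (F j) by case: j.
have inter j k : exists2 w, (F true `&` (F j `&` F k)) w & Zset w.
  have oI : vopen (F true `&` (F j `&` F k)) by do ![apply: vopenI].
  apply: (dense_Zset oI (x := x)); case: KLx => Kx Lx {oI}.
  by case: j; case: k.
have : good (\bigcup_j F j).
  apply: (glue_star tr nN (j0 := true)) => //; first by case.
    move=> k l z Fk Fl Zz; have [w [w1 w2] Zw] := inter k l; exists w => //.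
    by apply: linked_convex => //; [exact: vopenI|exact: cvxI].
  move=> k z w [z1 Zz] [w1 Zw].
  by apply: linked_convex => //; [exact: vopenI|exact: cvxI].
by apply: goodS => z [h|h]; [exists true|exists false].
Qed.

End Conic.

(** * From small cubes to products of half-planes *)

Section Boxes.
Variables (R : realType) (G : groupType).
Local Notation C := R[i].
Local Notation V := (R[i] * R[i])%type.
Variable (Phi : (R -> V) -> G).
Hypothesis tr : transport (@Zset R) Phi.
Variable N : set G.
Hypothesis nN : normal_subset N.
Variable h0 : R.
Hypothesis h0E : h0 = 1 / 32.
Hypothesis Ns : N (Phi (circle_w (1 / 4)%:C h0)).

Local Notation good := (good (@Zset R) Phi N).

Section OneBox.
Variables l r : nat -> R.
Hypothesis lr : forall k, (k < 4)%N -> l k <= r k.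
Hypothesis lr0 : forall z, (forall k, (k < 4)%N -> l k <= co k z <= r k) ->
  z.1 != 0 /\ z.2 != 0.

(** Intermediate shape for adding dimensions one by one: coordinates below [k] are already free,
    coordinate [k] is partly so, the others are still fixed at [p], and all is thickened by [e]. *)
Definition slab (k : nat) (p : nat -> R) (u v e : R) : set V :=
  box (fun j => (if (j < k)%N then l j else if j == k then u else p j) - e)
      (fun j => (if (j < k)%N then r j else if j == k then v else p j) + e).

Lemma slab_glue k p a b c e1 e2 : (k < 4)%N ->
  (forall j, (j < 4)%N -> l j <= p j <= r j) -> 0 < e1 -> 0 < e2 ->
  good (slab k p (Num.min a b) (Num.max a b) e1) ->
  good (slab k p (Num.min b c) (Num.max b c) e2) ->
  good (slab k p (Num.min a c) (Num.max a c) (Num.min e1 e2)).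
Proof.
move=> k4 pb e10 e20 g1 g2; set e := Num.min e1 e2.
have e0 : 0 < e by rewrite lt_min e10.
have ee1 : e <= e1 by rewrite ge_min lexx.
have ee2 : e <= e2 by rewrite ge_min lexx orbT.
have sub u v e' : e <= e' -> slab k p u v e `<=` slab k p u v e'.
  by move=> ee; apply: box_sub => j _; rewrite ?lerD2l// lerN2.
have : good (slab k p (Num.min a b) (Num.max a b) e `|`
             slab k p (Num.min b c) (Num.max b c) e).
  apply: (good_glue2 tr nN); try exact: vopen_box; try exact: cvx_box.
  - exact: goodS (sub _ _ _ ee1) g1.
  - exact: goodS (sub _ _ _ ee2) g2.
  exists (of_co (fun j => if (j < k)%N then l j else if j == k then b else p j)).
  have mb (x y : R) : Num.min x y <= x <= Num.max x y /\ Num.min x y <= y <= Num.max x y.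
    by rewrite !ge_min !le_max !lexx !orbT.
  have [[/andP[a1 a2] /andP[b1 b2]] [/andP[c1 c2] /andP[d1 d2]]] := (mb a b, mb b c).
  split=> j j4; rewrite co_of_co//; case: ltngtP => _;
    have /andP[? ?] := pb j j4; apply/andP; split; lra.
apply: goodS => z h; have /andP[] := h k k4; rewrite ltnn eqxx => h1 h2.
have out (j : nat) : (j < 4)%N -> j != k ->
    (if (j < k)%N then l j else p j) - e < co j z < (if (j < k)%N then r j else p j) + e.
  by move=> j4 jk; have := h j j4; rewrite (negPf jk).
have [hz|hz] := boolP ((Num.min a b - e < co k z) && (co k z < Num.max a b + e)).
  left=> j j4; have [->|jk] := eqVneq j k; first by rewrite ltnn.
  exact: out.
right=> j j4; have [->|jk] := eqVneq j k; last exact: out.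
rewrite ltnn; move: h1 h2 hz.
case: (leP a c); case: (leP a b); case: (leP b c) => ? ? ? ? ?; rewrite negb_and -!leNgt => /orP[] ?;
  apply/andP; split; lra.
Qed.

(** Compactness one coordinate at a time: the induction hypothesis gives slabs over short intervals
    of coordinate [k], and [interval_chain] joins them. *)
Lemma slab_good k p : (k <= 4)%N -> (forall j, (j < 4)%N -> l j <= p j <= r j) ->
  exists2 e, 0 < e & good (slab k p (p k) (p k) e).
Proof.
elim: k p => [|k IH] p k4 pb.
  have [] := lr0 (z := of_co p); first by move=> k ?; rewrite co_of_co// pb.
  move=> p1 p2; have [e e0 ge] := good_local tr nN h0E Ns p1 p2.
  exists e => //; apply: goodS ge; apply: box_sub => j j4; rewrite co_of_co//=;
    by case: eqVneq => [->|].
pose c t := l k + t * (r k - l k).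
have lrk := lr k4.
have c01 t : 0 <= t <= 1 -> l k <= c t <= r k.
  by move=> /andP[t0 t1]; rewrite /c; apply/andP; split; nra.
(* [interval_chain] does not order its endpoints, hence [Num.min] and [Num.max]. *)
pose P a b := exists2 e, 0 < e &
  good (slab k p (Num.min (c a) (c b)) (Num.max (c a) (c b)) e).
have : P 0 1.
  apply: interval_chain => [a b d _ _ _ [e1 e10 g1] [e2 e20 g2]|t t01].
    exists (Num.min e1 e2); first by rewrite lt_min e10.
    exact: (slab_glue k4 pb e10 e20 g1 g2).
  pose p' j := if j == k then c t else p j.
  have [|e e0 ge] := IH p' (ltnW k4).
    by move=> j j4; rewrite /p'; case: eqVneq => [->|_]; [exact: c01|exact: pb].
  pose d := 1 + (r k - l k); have d0 : 0 < d by rewrite /d; lra.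
  exists (e / 2 / d) => [|a b a01 b01 ta tb]; first by rewrite !divr_gt0.
  have close s : `|s - t| < e / 2 / d -> `|c s - c t| < e / 2.
    rewrite ltr_pdivlMr// => h; apply: le_lt_trans h.
    rewrite (_ : c s - c t = (s - t) * (r k - l k)); last by rewrite /c; ring.
    by rewrite normrM ler_wpM2l// ger0_norm /d; lra.
  have /close := ta; have /close := tb; rewrite !ltr_norml => /andP[? ?] /andP[? ?].
  exists (e / 2); first by rewrite divr_gt0.
  apply: goodS ge; apply: box_sub => j _; rewrite /p' eqxx; case: ltngtP => _; try lra.
    by case: (leP (c a) (c b)) => _; lra.
  by case: (leP (c a) (c b)) => _; lra.
have -> : P 0 1 = exists2 e, 0 < e & good (slab k p (l k) (r k) e).
  rewrite /P /c mul0r addr0 mul1r addrC subrK.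
  by rewrite (min_idPl lrk) (max_idPr lrk).
move=> [e e0 ge]; exists e => //; apply: goodS ge.
have jE j : (j < k.+1)%N = (j == k) || (j < k)%N by rewrite ltnS leq_eqVlt.
have pE j : (if j == k.+1 then p k.+1 else p j) = p j by case: eqVneq => [->|].
by apply: box_sub => j _; rewrite jE pE; case: (eqVneq j k) => [->|jk] /=;
  rewrite ?ltnn.
Qed.

Lemma box_good : good (box l r).
Proof.
have [|e e0 ge] := @slab_good 4 l (leqnn _).
  by move=> j j4; rewrite lexx lr.
apply: goodS ge; apply: box_sub => j j4; rewrite j4; lra.
Qed.

End OneBox.

Definition half_planes (q q' : quarter) : set V :=
  [set z | 0 < side q z.1] `&` [set z | 0 < side q' z.2].

Lemma vopen_half_planes q q' : vopen (half_planes q q').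
Proof. by apply: vopenI; apply: vopen_side => g []. Qed.

Lemma cvx_half_planes q q' : cvx (half_planes q q').
Proof.
apply: cvxI; apply: cvx_side => x d s /=.
  by rewrite [x.1 + d.1]addrC addrK.
by rewrite [x.2 + d.2]addrC addrK.
Qed.

(** With [upper], a half-plane cut down to a rectangle: the coordinate measured by [side q] is kept
    away from 0 by [m^-1], and both are bounded by [m]. *)
Definition lower (q : quarter) (m : R) : R * R := match q with
  | East => (m^-1, - m) | North => (- m, m^-1) | _ => (- m, - m) end.
Definition upper (q : quarter) (m : R) : R * R := match q with
  | West => (- m^-1, m) | South => (m, - m^-1) | _ => (m, m) end.
Definition pairs (u v : R * R) (k : nat) : R :=
  match k with 0 => u.1 | 1 => u.2 | 2 => v.1 | _ => v.2 end.

Definition truncation (q q' : quarter) (m : R) : set V :=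
  box (pairs (lower q m) (lower q' m)) (pairs (upper q m) (upper q' m)).

Lemma truncation_mono q q' m m' : 0 < m -> m <= m' ->
  truncation q q' m `<=` truncation q q' m'.
Proof.
move=> m0 mm; have m'0 := lt_le_trans m0 mm.
have mV : m'^-1 <= m^-1 by rewrite lef_pV2.
by apply: box_sub => -[|[|[|[|//]]]] _; case: q; case: q' => /=; lra.
Qed.

Lemma truncation_good q q' m : 1 < m -> good (truncation q q' m).
Proof.
move=> m1; have m0 : 0 < m by rewrite (lt_trans ltr01).
have mV1 : m^-1 < 1 by rewrite invf_lt1.
have mV : 0 < m^-1 by rewrite invr_gt0.
apply: box_good.
  by move=> [|[|[|[|//]]]] _; case: q; case: q' => /=; lra.
move=> z h; have := h 0%N isT; have := h 1%N isT; have := h 2%N isT; have := h 3%N isT.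
move=> /= h3 h2 h1 h0'; split.
- apply: (@side_neq0 R q); move: h0' h1; case: (q) => /= /andP[? ?] /andP[? ?]; lra.
- apply: (@side_neq0 R q'); move: h2 h3; case: (q') => /= /andP[? ?] /andP[? ?]; lra.
Qed.

(** An increasing union of truncations; the one of index 0 lies in all others and is the centre for
    [glue_star]. *)
Lemma half_planes_good q q' : good (half_planes q q').
Proof.
pose K (M : R) := truncation q q' (2 + `|M|).
have m0 M : 0 < 2 + `|M| by rewrite ltr_wpDr.
have oK M : vopen (K M) by exact: vopen_box.
have cK M : cvx (K M) by exact: cvx_box.
have K0 M : K 0 `<=` K M.
  apply: truncation_mono; first exact: m0.
  by rewrite normr0 addr0 lerDl.
pose dir q : C := match q with East => 1 | North => 0 +i* 1 | West => -1 | South => 0 -i* 1 end.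
have K0x : K 0 (dir q, dir q').
  move=> [|[|[|[|//]]]] _; rewrite /K normr0 addr0; case: (q); case: (q') => /=;
    rewrite ?oppr0; apply/andP; split; lra.
have gU : good (\bigcup_M K M).
  apply: (glue_star tr nN (j0 := 0)) => //.
  - move=> M; apply: truncation_good; have := normr_ge0 M; lra.
  - move=> k l z Kk Kl Zz.
    have [w K0w Zw] := dense_Zset (oK 0) K0x.
    exists w; first by split=> //; split=> //; split; exact: K0.
    by apply: linked_convex => //; [exact: vopenI|exact: cvxI|split; exact: K0].
  - move=> k z w [Kz Zz] [Kw Zw].
    by apply: linked_convex => //; [exact: vopenI|exact: cvxI].
apply: goodS gU => z [/= z1 z2].
(* Bounds the coordinates and the reciprocals of the distances to the edges of the half-planes. *)
pose M := (side q z.1)^-1 + (side q' z.2)^-1 + `|Re z.1| + `|Im z.1| + `|Re z.2| + `|Im z.2|.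
have i1 : 0 < (side q z.1)^-1 by rewrite invr_gt0.
have i2 : 0 < (side q' z.2)^-1 by rewrite invr_gt0.
have [n1 n2 n3 n4] : [/\ 0 <= `|Re z.1|, 0 <= `|Im z.1|, 0 <= `|Re z.2| & 0 <= `|Im z.2|].
  by [].
have Mge : M <= `|M| by exact: ler_norm.
set m := 2 + `|M|.
have Mm : M < m by rewrite /m; lra.
have b1 : m^-1 < side q z.1.
  by rewrite invf_plt ?posrE// ?m0//; apply: le_lt_trans Mm; rewrite /M; lra.
have b2 : m^-1 < side q' z.2.
  by rewrite invf_plt ?posrE// ?m0//; apply: le_lt_trans Mm; rewrite /M; lra.
have r1 : `|Re z.1| < m by apply: le_lt_trans Mm; rewrite /M; lra.
have r2 : `|Im z.1| < m by apply: le_lt_trans Mm; rewrite /M; lra.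
have r3 : `|Re z.2| < m by apply: le_lt_trans Mm; rewrite /M; lra.
have r4 : `|Im z.2| < m by apply: le_lt_trans Mm; rewrite /M; lra.
exists M => //; rewrite /K -/m => -[|[|[|[|//]]]] _ /=.
- move: b1 r1; rewrite ltr_norml => b1 /andP[? ?]; case: (q) b1 => /= b1; apply/andP; split; lra.
- move: b1 r2; rewrite ltr_norml => b1 /andP[? ?]; case: (q) b1 => /= b1; apply/andP; split; lra.
- move: b2 r3; rewrite ltr_norml => b2 /andP[? ?]; case: (q') b2 => /= b2; apply/andP; split; lra.
- move: b2 r4; rewrite ltr_norml => b2 /andP[? ?]; case: (q') b2 => /= b2; apply/andP; split; lra.
Qed.

End Boxes.

(** * Meridians of the three curves, and the torus at the crossing of the lines *)

Section Loops.
Variable (R : realType).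
Local Notation C := R[i].
Local Notation V := (R[i] * R[i])%type.

(** In the fibre b = 1/4 the conic is at w = 0 and the line A = 0 at w = 1/16. With half side 1/32
    the squares round these two points share an edge, as [big_pants] requires. *)
Definition meridian_size : R := 1 / 32.
Local Notation eps := meridian_size.

(* Meridians of the conic, of the line A = 0 and of the line B = 0. *)
Definition loop_s : R -> V := circle_w (1 / 4)%:C eps.
Definition loop_a : R -> V := fun t => psi (1 / 4)%:C ((2 * eps)%:C + eps%:C * sq t).
(** Induced by y -> 1 - y: [mid] becomes 1 - mid and [dsc] is unchanged. Through it, results on the
    line A = 0 carry over to B = 0. *)
Definition swap (z : V) : V := (z.2, z.1).
Definition loop_b : R -> V := fun t => swap (loop_a t).

(** The minus sign matches the first component in [loop_aE]. *)
Definition torus (u v : R) : V := ((- eps)%:C * sq u, (- eps)%:C * sq v).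

Lemma eps_gt0 : 0 < eps. Proof. by rewrite /meridian_size; lra. Qed.

Lemma realC_neq0 (x : R) : x != 0 -> x%:C != 0.
Proof. by move=> x0; apply/eqP => -[/eqP]; apply/negP. Qed.

Lemma neq0_Re (z : C) : 0 < Re z -> z != 0.
Proof. exact: (@side_neq0 R East). Qed.

(** 4 dsc = (1 + A - B)^2 - 4 A has positive real part as long as A is small and B stays between 0
    and 1/2, up to [eps]: the conic is not met. *)
Lemma Zset_corner (A B : C) : A != 0 -> B != 0 ->
  - eps <= Re A <= eps -> - eps <= Im A <= eps ->
  - eps <= Re B <= 1 / 2 + eps -> - eps <= Im B <= eps -> Zset (A, B).
Proof.
move=> A0 B0; case: A B A0 B0 => a a' [b b'] A0 B0 /=; rewrite /meridian_size.
move=> /andP[? ?] /andP[? ?] /andP[? ?] /andP[? ?]; split=> //.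
have -> : dsc (a +i* a', b +i* b') =
    ((1 + a +i* a' - b +i* b') ^+ 2 - 4 * (a +i* a')) / 4.
  by rewrite /dsc /mid /=; field.
rewrite mulf_neq0 ?invr_eq0 ?pnatr_eq0//; apply: neq0_Re.
rewrite (_ : Re _ = (1 + a - b) ^+ 2 - (a' - b') ^+ 2 - 4 * a).
  have : 7 / 16 <= 1 + a - b by lra.
  have : -1 / 16 <= a' - b' <= 1 / 16 by lra.
  by move: (1 + a - b) (a' - b') => x y /andP[? ?] ?; nra.
have -> (z : C) : 4 * z = z + z + z + z by ring.
by rewrite expr2 /=; ring.
Qed.

Lemma Zset_torus u v : 0 <= u <= 1 -> 0 <= v <= 1 -> Zset (torus u v).
Proof.
move=> u01 v01; have e0 := eps_gt0.
have [/andP[h1 h2] /andP[h3 h4]] := sq_bound u.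
have [/andP[h5 h6] /andP[h7 h8]] := sq_bound v.
have en : (- eps)%:C != 0 :> C by apply: realC_neq0; rewrite oppr_eq0 lt0r_neq0.
rewrite /torus; apply: Zset_corner; rewrite ?mulf_neq0 ?sq_neq0//=;
  rewrite /= in h1 h2 h3 h4 h5 h6 h7 h8; apply/andP; split; nra.
Qed.

Lemma Zset_swap z : Zset z -> Zset (swap z).
Proof.
move=> [z1 z2 z3]; split=> //; move: z3; congr (_ != 0).
by rewrite /dsc /mid /=; field.
Qed.

(** Near the tangency point on A = 0 the line B = 0 is out of reach, since Re (1 - u)^2 >= (11/16)^2
    - (5/16)^2 = 3/8 > Re W. *)
Lemma Zset_small (u W : C) : W != 0 -> u ^+ 2 != W ->
  - (5 / 16) <= Re u <= 5 / 16 -> - (5 / 16) <= Im u <= 5 / 16 -> Re W < 3 / 8 ->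
  Zset (psi u W).
Proof.
move=> W0 uW ru iu rW; split; rewrite ?dsc_psi//=; first by rewrite subr_eq0.
apply: neq0_Re; rewrite expr2.
case: u W ru iu rW {W0 uW} => x y [w w'] /= /andP[? ?] /andP[? ?] ?.
by nra.
Qed.

Lemma loop_aE t : loop_a t =
  ((- eps)%:C * sq t, (1 / 2)%:C - eps%:C * sq t).
Proof.
rewrite /loop_a /psi; case: (sq t) => x y.
by congr pair; rewrite expr2 /meridian_size; congr Complex; rewrite /=; field.
Qed.

End Loops.

Section Torus.
Variables (R : realType) (G : groupType).
Local Notation C := R[i].
Local Notation V := (R[i] * R[i])%type.
Variable (Phi : (R -> V) -> G).
Hypothesis tr : transport (@Zset R) Phi.
Local Notation eps := (meridian_size R).

Let cont1 : continuous (fun p : R * R => p.1).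
Proof. by move=> p; exact: cvg_fst. Qed.

Let cont2 : continuous (fun p : R * R => p.2).
Proof. by move=> p; exact: cvg_snd. Qed.

Let csq1 : ccont (fun p : R * R => sq p.1).
Proof. exact: ccont_sq. Qed.

Let cy : ccont (fun p : R * R => p.2%:C).
Proof. exact: ccont_real. Qed.

Lemma continuous_affine_snd (c0 c1 : R) : continuous (fun p : R * R => c0 + c1 * p.2).
Proof.
move=> p; apply: cvgD; first exact: cvg_cst.
by apply: cvgM; [exact: cvg_cst|exact: cont2].
Qed.

Lemma vcont_torus (T : topologicalType) (u v : T -> R) : continuous u -> continuous v ->
  vcont (fun x => torus (u x) (v x)).
Proof.
by move=> cu cv; split; apply: ccontM; try exact: ccont_cst; exact: ccont_sq.
Qed.

Definition is_conj (x y : G) : Prop := exists g, (y = x ^ g)%g.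

Lemma is_conj_trans x y z : is_conj x y -> is_conj y z -> is_conj x z.
Proof. by move=> [g ->] [h ->]; exists (g * h)%g; rewrite conjgM. Qed.

Lemma is_conj_homotopy (H : R -> R -> V) f g :
  vcont (fun p : R * R => H p.1 p.2) ->
  (forall x y, 0 <= x <= 1 -> 0 <= y <= 1 -> Zset (H x y)) ->
  (forall y, H 0 y = H 1 y) -> f = H^~ 0 -> g = H^~ 1 ->
  is_conj (Phi f) (Phi g).
Proof.
move=> cH ZH H01 -> ->; have [k ->] := Phi_free_homotopy tr cH ZH H01.
by exists k.
Qed.

Lemma torus_closed1 (v : R) : torus 0 v = torus 1 v :> V.
Proof. by rewrite /torus sq0 sq1. Qed.

Lemma torus_closed2 (u : R) : torus u 0 = torus u 1 :> V.
Proof. by rewrite /torus sq0 sq1. Qed.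

Lemma in01_0 : 0 <= (0 : R) <= 1. Proof. by rewrite lexx ler01. Qed.
Lemma in01_1 : 0 <= (1 : R) <= 1. Proof. by rewrite lexx ler01. Qed.

Lemma in01_half : 0 <= (1 / 2 : R) <= 1. Proof. by apply/andP; split; lra. Qed.

Lemma in01_convex (a b y : R) : 0 <= a <= 1 -> 0 <= b <= 1 -> 0 <= y <= 1 ->
  0 <= a + (b - a) * y <= 1.
Proof. by move=> /andP[? ?] /andP[? ?] /andP[? ?]; apply/andP; split; nra. Qed.

Lemma loop_a_torus (v : R) : 0 <= v <= 1 -> is_conj (Phi (@loop_a R)) (Phi ((@torus R)^~ v)).
Proof.
move=> v01.
(* At v = 1/2 the torus has B = eps (1 - i), with positive real part, so B can be moved straight
   there from 1/2 - eps sq x without meeting 0. *)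
have half : sq (1 / 2 : R) = (-1) +i* 1.
  by rewrite sq_north; [congr Complex; lra|apply/andP; split; lra].
apply: (@is_conj_trans _ (Phi ((@torus R)^~ (1 / 2)))).
  pose H (x y : R) : V := ((- eps)%:C * sq x,
    (1 - y)%:C * ((1 / 2)%:C - eps%:C * sq x) + y%:C * ((- eps)%:C * sq (1 / 2))).
  apply: (@is_conj_homotopy H).
  - have cy' : ccont (fun p : R * R => (1 - p.2)%:C).
      by apply: ccont_real => p; apply: cvgB; [exact: cvg_cst|exact: cont2].
    by split; rewrite /H /=; solve_ccont.
  - move=> x y x01 y01; rewrite /H half; have e0 := eps_gt0 R.
    have [/andP[h1 h2] /andP[h3 h4]] := sq_bound x; rewrite /= in h1 h2 h3 h4.
    have [y0 y1] := andP y01.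
    have q0 : 0 < 1 / 2 - eps * sqx x by rewrite /meridian_size; lra.
    apply: Zset_corner.
    + by rewrite mulf_neq0 ?sq_neq0// realC_neq0// oppr_eq0 lt0r_neq0.
    + apply: neq0_Re; rewrite /= !mul0r !mul1r !subr0.
      rewrite /meridian_size in q0 *; nra.
    + by rewrite /= mul0r subr0; apply/andP; split; nra.
    + by rewrite /= mul0r addr0; apply/andP; split; nra.
    + by rewrite /= /meridian_size; apply/andP; split; nra.
    + by rewrite /= /meridian_size; apply/andP; split; nra.
  - by move=> y; rewrite /H sq0 sq1.
  - apply/funext => x; rewrite loop_aE /H subr0.
    by rewrite rmorph1 rmorph0 !mul1r mul0r addr0.
  - by apply/funext => x; rewrite /H subrr /torus rmorph0 rmorph1 mul0r add0r !mul1r.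
apply: (@is_conj_homotopy (fun x y => torus x (1 / 2 + (v - 1 / 2) * y))).
- by apply: (vcont_torus cont1); exact: continuous_affine_snd.
- by move=> x y x01 y01; apply: Zset_torus => //; exact: in01_convex in01_half _ _.
- by move=> y; exact: torus_closed1.
- by apply/funext => x; rewrite mulr0 addr0.
- by apply/funext => x; rewrite mulr1 addrC subrK.
Qed.

(** Opposite sides of the rectangle [torus] coincide. *)
Lemma torus_commute : commute (Phi ((@torus R)^~ 0)) (Phi (torus 0)).
Proof.
have := transport_rect tr (H := @torus R) _ _.
rewrite /commute (_ : torus 1 = torus 0); last first.
  by apply/funext => v; rewrite torus_closed1.
rewrite (_ : (fun x => torus x 1) = (@torus R)^~ 0); last first.
  by apply/funext => v; rewrite torus_closed2.
by apply; [exact: vcont_torus|move=> x y; exact: Zset_torus].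
Qed.

End Torus.

Section Swap.
Variables (R : realType) (G : groupType).
Local Notation V := (R[i] * R[i])%type.
Variable (Phi : (R -> V) -> G).
Hypothesis tr : transport (@Zset R) Phi.

Definition swap_transport (f : R -> V) : G := Phi (fun t => swap (f t)).

Lemma transport_swap : transport (@Zset R) swap_transport.
Proof.
split=> [z Zz|H [c1 c2] ZH]; first exact/(transport_cst tr)/Zset_swap.
apply: (transport_rect tr (H := fun x y => swap (H x y))); first by split.
by move=> x y x01 y01; apply/Zset_swap/ZH.
Qed.

Lemma loop_b_torus (u : R) : 0 <= u <= 1 -> is_conj (Phi (@loop_b R)) (Phi (torus u)).
Proof. exact: (loop_a_torus transport_swap). Qed.

End Swap.

(** * Generation by the three meridians *)

Section Generated.
Variables (R : realType) (G : groupType).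
Local Notation C := R[i].
Local Notation V := (R[i] * R[i])%type.
Variable (Phi : (R -> V) -> G).
Hypothesis tr : transport (@Zset R) Phi.
Variable N : set G.
Hypothesis nN : normal_subset N.
Hypothesis Na : N (Phi (@loop_a R)).
Hypothesis Nb : N (Phi (@loop_b R)).
Hypothesis Ns : N (Phi (@loop_s R)).

Local Notation good := (good (@Zset R) Phi N).

Definition opp q := qnext (qnext q).

Lemma side_torus q t : side (opp q) (sq t) = 1 -> 0 < side q ((- meridian_size R)%:C * sq t).
Proof.
by rewrite rmorphN /= mulNr sideN sideZ => ->; rewrite mulr1 eps_gt0.
Qed.

Lemma side_torus_opp q t : side q (sq t) = 1 -> 0 < side (opp q) ((- meridian_size R)%:C * sq t).
Proof. by move=> h; apply: side_torus; case: q h. Qed.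

Lemma corner_side q : side q (sq (qstart R q + 1 / 4)) = 1.
Proof. by apply: side_sq; apply/andP; split; lra. Qed.

Lemma qstart_opp q : exists2 v, 0 <= v <= 1 & side (opp q) (sq v) = 1 :> R.
Proof.
exists (qstart R (opp q) + 1 / 8); last by apply: side_sq; apply/andP; split; lra.
by case: q => /=; apply/andP; split; lra.
Qed.

Lemma qstart01 q : 0 <= qstart R q + 1 / 4 <= 1.
Proof. by case: q => /=; apply/andP; split; lra. Qed.

(** C minus 0, times a half-plane. The index is [opp q] because of the sign in [torus]: during
    quarter [q] of its parameter the torus is on the opposite side. *)
Definition ring_set q' : set V := \bigcup_q half_planes (opp q) q'.

Let gh q q' : good (half_planes q q').
Proof. exact: (half_planes_good tr nN (erefl _) Ns). Qed.

Let oh q q' : vopen (@half_planes R q q').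
Proof. exact: vopen_half_planes. Qed.

Let ch q q' : cvx (@half_planes R q q').
Proof. exact: cvx_half_planes. Qed.

Let zpath_torus1 (v : R) : 0 <= v <= 1 -> zpath (@Zset R) ((@torus R)^~ v).
Proof.
move=> v01; split; last by move=> t t01; exact: Zset_torus.
by apply: vcont_torus => t; [exact: cvg_id|exact: cvg_cst].
Qed.

Let zpath_torus2 (u : R) : 0 <= u <= 1 -> zpath (@Zset R) (torus u).
Proof.
move=> u01; split; last by move=> t t01; exact: Zset_torus.
by apply: vcont_torus => t; [exact: cvg_cst|exact: cvg_id].
Qed.

Lemma ring_good q' : good (ring_set q').
Proof.
have [v v01 sv] := qstart_opp q'.
have h2 := side_torus sv.
apply: (glue_cycle tr nN (f := (@torus R)^~ v)) => //.
- by move=> q z _ [/side_opp h _] [].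
- move=> q z [[K1 K2] Zz]; apply: linked_convex => //.
  + exact: vopenI.
  + exact: cvxI.
  + by split; split=> //; apply: side_torus_opp; [exact: corner_side|exact: side_corner].
  + by apply: Zset_torus => //; exact: qstart01.
- exact: zpath_torus1.
- exact: torus_closed1.
- by move=> q t /side_sq h; split=> //; exact: side_torus_opp.
- by have [g ->] := loop_a_torus tr v01; exact: normalJ.
Qed.

(** The second coordinates share a convex set, and the first can be turned round 0 from one
    half-plane to the next. *)
Lemma ring_linked q1 q2 x y : Zset x -> Zset y ->
  0 < side q1 x.2 -> 0 < side q2 x.2 -> 0 < side q1 y.2 -> 0 < side q2 y.2 ->
  linked (@Zset R) (ring_set q1 `&` ring_set q2) x y.
Proof.
move=> Zx Zy x1 x2 y1 y2.
pose K q : set V := half_planes q q1 `&` half_planes q q2.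
have oK q : vopen (K q) by exact: vopenI.
have cK q : cvx (K q) by exact: cvxI.
have KT q : K q `<=` ring_set q1 `&` ring_set q2.
  have -> : q = opp (opp q) by case: q.
  by move=> z [? ?]; split; exists (opp q).
have step q z z' : K q z -> K q z' -> Zset z -> Zset z' ->
    linked (@Zset R) (ring_set q1 `&` ring_set q2) z z'.
  by move=> *; apply: (linkedW (KT q)); exact: linked_convex.
have mid q : exists2 p, (K q `&` K (qnext q)) p & Zset p.
  apply: (dense_Zset _ (x := (sq (qstart R q + 1 / 4), x.2) : V)); first exact: vopenI.
  by do ![split => //=]; rewrite ?corner_side ?side_corner ltr01.
pose L q q' := forall z z', K q z -> K q' z' -> Zset z -> Zset z' ->
    linked (@Zset R) (ring_set q1 `&` ring_set q2) z z'.
have Ltr q q' : L q q' -> L q (qnext q').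
  move=> Lq z z' Kz Kz' Zz Zz'; have [p [p1 p2] Zp] := mid q'.
  exact: linked_trans (Lq z p Kz p1 Zz Zp) (step _ _ _ p2 Kz' Zp Zz').
have L0 q : L q q by move=> z z'; exact: step.
have LL q q' : L q q'.
  have := L0 q; have := Ltr _ _ (L0 q); have := Ltr _ _ (Ltr _ _ (L0 q)).
  have := Ltr _ _ (Ltr _ _ (Ltr _ _ (L0 q))).
  by case: q; case: q'.
have [/neq0_side[q xq] _ _] := Zx; have [/neq0_side[q' yq] _ _] := Zy.
by apply: (LL q q').
Qed.

(** Cyclic gluing round B = 0, each piece having been glued round A = 0 in [ring_good]. The union is
    the complement of the lines with the conic filled in, and a potential on it puts every closed
    path in [N]. *)
Theorem Phi_generated f : zpath (@Zset R) f -> f 0 = f 1 -> N (Phi f).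
Proof.
have gZ : good (\bigcup_q ring_set (opp q)).
  apply: (glue_cycle tr nN (f := torus 0)).
  - by move=> q; apply: vopen_bigcup.
  - by move=> q; exact: ring_good.
  - by move=> q z _ [? _ [_ /side_opp h]] [? _ [_]].
  - move=> q z [[[q1 _ [_ K1]] [q2 _ [_ K2]]] Zz]; apply: ring_linked => //.
    + by apply: Zset_torus; [exact: in01_0|exact: qstart01].
    + by apply: side_torus_opp; exact: corner_side.
    + by apply: side_torus_opp; exact: side_corner.
  - exact/zpath_torus2/in01_0.
  - exact: torus_closed2.
  - move=> q t /side_sq h.
    have [q' q'h] : exists q', 0 < side q' ((- meridian_size R)%:C * sq 0).
      by apply: neq0_side; have [] := Zset_torus (in01_0 R) (in01_0 R).
    have oo : opp (opp q') = q' by case: (q').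
    by exists (opp q') => //; split; [rewrite /= oo|exact: side_torus_opp].
  - by have [g ->] := loop_b_torus tr (in01_0 R); exact: normalJ.
move=> Zf f01; apply: (trivializes_loop nN gZ) => //.
apply: (zpathS _ Zf) => z Zz; split=> //.
have [/neq0_side[q xq] /neq0_side[q' yq] _] := Zz.
have oo p : opp (opp p) = p by case: p.
by exists (opp q') => //; exists (opp q) => //; split; rewrite /= oo.
Qed.

End Generated.

(** * The relation at a tangency point *)

Section Tangency.
Variables (R : realType) (G : groupType).
Local Notation C := R[i].
Local Notation V := (R[i] * R[i])%type.
Variable (Phi : (R -> V) -> G).
Hypothesis tr : transport (@Zset R) Phi.
Local Notation eps := (meridian_size R).
Local Notation b0 := ((1 / 4)%:C : C).

Let cont1 : continuous (fun p : R * R => p.1).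
Proof. by move=> p; exact: cvg_fst. Qed.

Let cont2 : continuous (fun p : R * R => p.2).
Proof. by move=> p; exact: cvg_snd. Qed.

Let csq1 : ccont (fun p : R * R => sq p.1).
Proof. exact: ccont_sq. Qed.

Let ccont_affine (a b : R) : continuous (fun t : R => a * t + b).
Proof.
move=> t; apply: cvgD; last exact: cvg_cst.
by apply: cvgM; [exact: cvg_cst|exact: cvg_id].
Qed.

Lemma Re_sqr_le (c w : C) (m : R) : -1 <= Re c <= 1 -> -1 <= Im c <= 1 ->
  - m <= Re w <= m -> - m <= Im w <= m -> Re (c ^+ 2 * w) <= 3 * m.
Proof.
case: c w => x y [u v]; rewrite expr2 /= => /andP[x1 x2] /andP[y1 y2] /andP[? ?] /andP[? ?].
have h1 : -1 <= x * x - y * y <= 1 by apply/andP; split; nra.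
have h2 : -2 <= x * y + y * x <= 2 by apply/andP; split; nra.
by move: h1 h2; move: (x * x - y * y) (x * y + y * x) => p q /andP[? ?] /andP[? ?]; nra.
Qed.

(** The action multiplies both A = b0^2 - w and [dsc] by c^2, so neither becomes 0. *)
Lemma Zset_worbit (c w : C) : c != 0 -> w != 0 -> b0 ^+ 2 != w ->
  -1 <= Re c <= 1 -> -1 <= Im c <= 1 -> - eps <= Re w <= eps -> - eps <= Im w <= eps ->
  Zset (psi (b0 * c) (c ^+ 2 * w)).
Proof.
move=> c0 w0 bw rc ic rw iw; apply: Zset_small.
- by rewrite mulf_neq0// expf_neq0.
- apply: contra bw => /eqP h; apply/eqP/(mulfI (expf_neq0 2 c0)).
  by rewrite -h exprMn mulrC.
- by case: c rc {ic c0} => x y /= /andP[? ?]; apply/andP; split; nra.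
- by case: c ic {rc c0} => x y /= /andP[? ?]; apply/andP; split; nra.
- by apply: (le_lt_trans (Re_sqr_le rc ic rw iw)); rewrite /meridian_size; lra.
Qed.

Lemma eps_sq_bound t : (- eps <= Re (eps%:C * sq t) <= eps) /\
  (- eps <= Im (eps%:C * sq t) <= eps).
Proof.
have e0 := eps_gt0 R; have [/andP[h1 h2] /andP[h3 h4]] := sq_bound t.
by rewrite /= in h1 h2 h3 h4 *; split; apply/andP; split; nra.
Qed.

Lemma eps_sq_neq0 t : 0 <= t <= 1 -> eps%:C * sq t != 0.
Proof.
by move=> t01; rewrite mulf_neq0 ?sq_neq0// realC_neq0// lt0r_neq0// eps_gt0.
Qed.

Lemma eps_sq_neq t : b0 ^+ 2 != eps%:C * sq t.
Proof.
rewrite eq_sym -subr_eq0 -oppr_eq0; apply: neq0_Re.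
have [/andP[h1 h2] /andP[h3 h4]] := eps_sq_bound t.
by rewrite opprB expr2; rewrite /= in h1 h2 *; rewrite /meridian_size in h1 h2 *; lra.
Qed.

(* The orbit of the meridian [loop_s] under the weighted circle action
   [(beta, w) -> (c beta, c ^ 2 w)], which preserves both branches of the curve
   near the tangency point [beta = w = 0]. *)
Definition worbit (x y : R) : V := psi (b0 * sq x) (sq x ^+ 2 * (eps%:C * sq y)).

Lemma Zset_worbit_sq x y : 0 <= x <= 1 -> 0 <= y <= 1 -> Zset (worbit x y).
Proof.
move=> x01 y01; have [? ?] := sq_bound x; have [? ?] := eps_sq_bound y.
by apply: Zset_worbit => //; [exact: sq_neq0|exact: eps_sq_neq0|exact: eps_sq_neq].
Qed.

Lemma vcont_worbit (T : topologicalType) (u v : T -> R) : continuous u -> continuous v ->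
  vcont (fun x => worbit (u x) (v x)).
Proof.
move=> cu cv; have c1 := ccont_sq cu; have c2 := ccont_sq cv.
by apply: vcont_psi; solve_ccont.
Qed.

Lemma worbit_commute : commute (Phi ((@worbit)^~ 0)) (Phi (worbit 0)).
Proof.
have := transport_rect tr (H := worbit) _ _.
rewrite /commute (_ : worbit 1 = worbit 0); last first.
  by apply/funext => v; rewrite /worbit sq0 sq1.
rewrite (_ : (fun x => worbit x 1) = (@worbit)^~ 0); last first.
  by apply/funext => v; rewrite /worbit sq0 sq1.
by apply; [exact: vcont_worbit|move=> x y; exact: Zset_worbit_sq].
Qed.

Lemma worbit_s : is_conj (Phi (@loop_s R)) (Phi (worbit 0)).
Proof.
(* [c] moves from 1 to 1 - i, the starting corner of [sq]. *)
pose c (y : R) : C := 1 -i* y.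
apply: (is_conj_homotopy tr (H := fun x y => psi (b0 * c y) (c y ^+ 2 * (eps%:C * sq x)))).
- have cc : ccont (fun p : R * R => c p.2).
    by split=> p; [exact: cvg_cst|apply: cvgN; exact: cont2].
  by apply: vcont_psi; solve_ccont.
- move=> x y x01 /andP[y0 y1]; have [? ?] := eps_sq_bound x.
  apply: Zset_worbit => //; [|exact: eps_sq_neq0|exact: eps_sq_neq| |].
  + by apply: neq0_Re; rewrite /= ltr01.
  + by rewrite /=; apply/andP; split; lra.
  + by rewrite /=; apply/andP; split; lra.
- by move=> y; rewrite sq0 sq1.
- apply/funext => x; rewrite (_ : c 0 = 1); last by rewrite /c oppr0.
  by rewrite /loop_s /circle_w mulr1 expr1n !mul1r.
- by apply/funext => x; rewrite /worbit sq0.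
Qed.

(** An orbit in the fibre b = 0, where the conic and the line A = 0 both sit at w = 0. *)
Definition weighted : R -> V := fun x => psi 0 (eps%:C * sq x ^+ 2).
Definition half_turn : R -> V := fun x => psi 0 (eps%:C * sq (x / 2) ^+ 2).
(** Boundary of the rectangle [-eps, 3 eps] x [-eps, eps], the union of the squares round w = 0 and
    w = 1/16. *)
Definition outer_square (t : R) : C := (eps + 2 * eps * sqx t) +i* (eps * sqy t).

Lemma sq_eighth : sq (1 / 8 : R) = 1.
Proof. by rewrite sq_east; [congr Complex; lra|apply/andP; split; lra]. Qed.

Lemma worbit_weighted : is_conj (Phi ((@worbit)^~ 0)) (Phi weighted).
Proof.
(* At 1/8 [sq] is 1, so w becomes the real number eps times sq x ^ 2. *)
apply: (@is_conj_trans _ _ (Phi ((@worbit)^~ (1 / 8)))).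
  apply: (is_conj_homotopy tr (H := fun x y => worbit x (0 + 1 / 8 * y))).
  - by apply: (vcont_worbit cont1); exact: continuous_affine_snd.
  - move=> x y x01 /andP[y0 y1]; apply: Zset_worbit_sq => //.
    by apply/andP; split; lra.
  - by move=> y; rewrite /worbit sq0 sq1.
  - by apply/funext => x; rewrite mulr0 addr0.
  - by apply/funext => x; rewrite mulr1 add0r.
(* [b] goes from 1/4 to 0 along an arc off the real axis, since the real segment contains a root of
   b^2 = eps, where A = 0. *)
pose b (y : R) : C := (1 / 4 * (1 - y)) +i* (1 / 4 * (1 - y) * y).
apply: (is_conj_homotopy tr (H := fun x y => psi (b y * sq x) (eps%:C * sq x ^+ 2))).
- have cb : ccont (fun p : R * R => b p.2).
    have c1 : continuous (fun p : R * R => 1 / 4 * (1 - p.2)).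
      move=> p; apply: cvgM; first exact: cvg_cst.
      by apply: cvgB; [exact: cvg_cst|exact: cont2].
    by split=> p; [exact: c1|apply: cvgM; [exact: c1|exact: cont2]].
  by apply: vcont_psi; solve_ccont.
- move=> x y x01 /andP[y0 y1]; have e0 := eps_gt0 R; have ysq := sqr_ge0 (y - 1 / 2).
  have s0 := sq_neq0 x01; have [rs is_] := sq_bound x.
  have bE : b y ^+ 2 != eps%:C.
    rewrite expr2; apply/eqP => -[h1 h2].
    have {h2} : y * (1 - y) ^+ 2 = 0 by lra.
    move=> /eqP; rewrite mulf_eq0 expf_eq0 /= => /orP[/eqP h|/eqP h].
      by move: h1; rewrite h /meridian_size; lra.
    by move: h1; rewrite h !(mulr0, mul0r) subrr /meridian_size; lra.
  apply: Zset_small.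
  + by rewrite mulf_neq0 ?expf_neq0// realC_neq0// lt0r_neq0.
  + apply: contra bE => /eqP h; apply/eqP/(mulfI (expf_neq0 2 s0)).
    by rewrite [RHS]mulrC -h exprMn mulrC.
  + case: (sq x) rs is_ => u v /= /andP[? ?] /andP[? ?].
    have h1 : 0 <= 1 / 4 * (1 - y) <= 1 / 4 by apply/andP; split; lra.
    have h2 : 0 <= 1 / 4 * (1 - y) * y <= 1 / 16 by apply/andP; split; nra.
    move: h1 h2; set q := 1 / 4 * (1 - y) * y; set p := 1 / 4 * (1 - y).
    clearbody p q => /andP[? ?] /andP[? ?]; apply/andP; split; nra.
  + case: (sq x) rs is_ => u v /= /andP[? ?] /andP[? ?].
    have h1 : 0 <= 1 / 4 * (1 - y) <= 1 / 4 by apply/andP; split; lra.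
    have h2 : 0 <= 1 / 4 * (1 - y) * y <= 1 / 16 by apply/andP; split; nra.
    move: h1 h2; set q := 1 / 4 * (1 - y) * y; set p := 1 / 4 * (1 - y).
    clearbody p q => /andP[? ?] /andP[? ?]; apply/andP; split; nra.
  + rewrite [_%:C * _]mulrC; apply: (@le_lt_trans _ _ (3 * eps)); last by rewrite /meridian_size; lra.
    by apply: Re_sqr_le => //=; apply/andP; split; lra.
- by move=> y; rewrite sq0 sq1.
- apply/funext => x; rewrite /worbit sq_eighth mulr1 [eps%:C * _]mulrC.
  by rewrite /b subr0 mulr1 mulr0.
- by apply/funext => x; rewrite /weighted /b subrr mulr0 !mul0r.
Qed.

Lemma weightedE : Phi weighted = (Phi half_turn * Phi half_turn)%g.
Proof.
have cw (c : R) : vcont (fun x : R => psi 0 (eps%:C * sq (c * x + 0) ^+ 2)).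
  have cs := ccont_sq (@ccont_affine c 0).
  by apply: vcont_psi; solve_ccont.
have ZW x : 0 <= x <= 1 -> Zset (weighted x).
  move=> x01; have e0 : eps%:C * sq x ^+ 2 != 0.
    by rewrite mulf_neq0 ?expf_neq0 ?sq_neq0// realC_neq0// lt0r_neq0 ?eps_gt0.
  apply: Zset_small => //.
  - by rewrite expr0n eq_sym.
  - by rewrite /=; apply/andP; split; lra.
  - by rewrite /=; apply/andP; split; lra.
  have [? ?] := sq_bound x; rewrite [_%:C * _]mulrC.
  apply: (@le_lt_trans _ _ (3 * eps)); last by rewrite /meridian_size; lra.
  by have e1 := eps_gt0 R; apply: Re_sqr_le => //=; apply/andP; split; lra.
have Zw : zpath (@Zset R) weighted.
  split=> //; have := cw 1; rewrite /weighted.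
  by under eq_fun do rewrite mul1r addr0.
have h01 := in01_half R; have z01 := in01_0 R; have o01 := in01_1 R.
rewrite -(subpath01 weighted) -(Phi_sub tr Zw z01 h01 o01).
have ch : vcont half_turn.
  have := cw (2^-1); congr vcont; apply/funext => x.
  by rewrite /half_turn; congr (psi 0 (_ * sq _ ^+ 2)); lra.
congr (_ * _)%g.
  apply: (Phi_ext tr (zpath_sub z01 h01 Zw) ch) => t _.
  by rewrite /subpath /weighted /half_turn; congr (psi 0 (_ * sq _ ^+ 2)); lra.
apply: (Phi_ext tr (zpath_sub h01 o01 Zw) ch) => t /andP[t0 t1].
rewrite /subpath /weighted /half_turn (_ : 1 / 2 + _ = 1 / 2 + t / 2); last by lra.
by rewrite sq_half ?sqrrN//; apply/andP; split; lra.
Qed.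

End Tangency.

(** * The outer loop of a fibre as a product of two meridians *)

Section Pants.
Variables (R : realType) (G : groupType).
Local Notation C := R[i].
Local Notation V := (R[i] * R[i])%type.
Variable (Phi : (R -> V) -> G).
Hypothesis tr : transport (@Zset R) Phi.
Local Notation eps := (meridian_size R).
Local Notation b0 := ((1 / 4)%:C : C).
Local Notation big := (@outer_square R).

Let cont1 : continuous (fun p : R * R => p.1).
Proof. by move=> p; exact: cvg_fst. Qed.

Let cont2 : continuous (fun p : R * R => p.2).
Proof. by move=> p; exact: cvg_snd. Qed.

Let cy : ccont (fun p : R * R => p.2%:C).
Proof. exact: ccont_real. Qed.

Lemma ccont_big (T : topologicalType) (u : T -> R) : continuous u ->
  ccont (fun x => big (u x)).
Proof.
move=> /ccont_sq[c1 c2]; split=> x /=.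
  apply: cvgD; first exact: cvg_cst.
  by apply: cvgM; [exact: cvg_cst|exact: c1].
by apply: cvgM; [exact: cvg_cst|exact: c2].
Qed.

Lemma big_closed : big 0 = big 1.
Proof.
have : sq (0 : R) = sq 1 by rewrite sq0 sq1.
by rewrite /sq /outer_square => -[-> ->].
Qed.

Lemma big_side q t : qstart R q <= t <= qstart R q + 1 / 4 ->
  eps <= side q (big t) /\ (q = East -> Re (big t) = 3 * eps).
Proof.
have e0 := eps_gt0 R.
move=> /side_sq; rewrite /sq /outer_square; case: q => /= h; split=> //; nra.
Qed.

Lemma Re_big t : Re (big t) <= 3 * eps.
Proof.
have e0 := eps_gt0 R; have [/andP[h1 h2] _] := sq_bound t.
by rewrite /= in h1 h2 *; nra.
Qed.

(** As the fibre moves, its puncture y^2 / 16 stays in [0, 1/16], inside the rectangle, whose right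
    edge is at 3/32. *)
Lemma Zset_big y t : 0 <= y <= 1 -> 0 <= t <= 1 -> Zset (psi (y%:C * b0) (big t)).
Proof.
move=> /andP[y0 y1] t01; have e0 := eps_gt0 R.
have [q qt] := qstart_cover t01; have [sb e3] := big_side qt.
apply: Zset_small.
- by apply: (@side_neq0 R q); exact: lt_le_trans sb.
- have uE : (y%:C * b0) ^+ 2 = (y ^+ 2 / 16)%:C.
    by rewrite expr2 /=; congr Complex; field.
  rewrite uE; apply/eqP => e; move: sb e3; rewrite -e; case: (q) => /= h.
  + by move=> /(_ erefl); rewrite /meridian_size; nra.
  + by move: h; lra.
  + by have := sqr_ge0 y; lra.
  + by move: h; lra.
- by rewrite /=; apply/andP; split; lra.
- by rewrite /=; apply/andP; split; lra.
- by apply: (le_lt_trans (Re_big t)); rewrite /meridian_size; lra.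
Qed.

(** Together with [big_side] this puts [sq (t / 2) ^+ 2] and [big t] in one closed half-plane, the
    latter in its interior, so the straight homotopy between them avoids 0. *)
Lemma half_turn_east t : 0 <= t <= 1 -> forall q, qstart R q <= t <= qstart R q + 1 / 4 ->
  0 <= side q (sq (t / 2) ^+ 2).
Proof.
move=> t01 q; rewrite expr2; case: q; rewrite /qstart => /andP[h1 h2].
- rewrite sq_east /=; last by apply/andP; split; lra.
  by nra.
- rewrite sq_east /=; last by apply/andP; split; lra.
  by nra.
- rewrite sq_north /=; last by apply/andP; split; lra.
  by nra.
- rewrite sq_north /=; last by apply/andP; split; lra.
  by nra.
Qed.

Lemma half_turn_big : is_conj (Phi (@half_turn R)) (Phi (fun t => psi b0 (big t))).
Proof.
apply: (@is_conj_trans _ _ (Phi (fun t => psi 0 (big t)))).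
  pose w (x y : R) : C := (1 - y)%:C * (eps%:C * sq (x / 2) ^+ 2) + y%:C * big x.
  apply: (is_conj_homotopy tr (H := fun x y => psi 0 (w x y))).
  - have c1 : ccont (fun p : R * R => (1 - p.2)%:C).
      by apply: ccont_real => p; apply: cvgB; [exact: cvg_cst|exact: cont2].
    have c2 : ccont (fun p : R * R => sq (p.1 / 2)).
      apply: (@ccont_sq R _ (fun p : R * R => p.1 / 2)) => p.
      by apply: cvgM; [exact: cont1|exact: cvg_cst].
    have c3 := ccont_big cont1.
    by apply: vcont_psi; rewrite /w; solve_ccont.
  - move=> x y x01 /andP[y0 y1]; have e0 := eps_gt0 R.
    have [q qx] := qstart_cover x01; have [sb _] := big_side qx.
    have sh := half_turn_east x01 qx.
    have hx : 0 <= x / 2 <= 1 by have [? ?] := andP x01; apply/andP; split; lra.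
    have w0 : w x y != 0.
      have [y00|yn] := eqVneq y 0.
        rewrite /w y00 subr0 rmorph1 rmorph0 mul1r mul0r addr0.
        by rewrite mulf_neq0 ?expf_neq0 ?sq_neq0// realC_neq0// lt0r_neq0.
      apply: (@side_neq0 R q); rewrite /w sideD !sideZ.
      have yp : 0 < y by rewrite lt_neqAle eq_sym yn.
      have h : 0 < y * side q (big x) by rewrite mulr_gt0// (lt_le_trans e0).
      apply: ltr_wpDl => //; apply: mulr_ge0; first by lra.
      by apply: mulr_ge0; [exact: ltW|exact: sh].
    apply: Zset_small => //.
    + by rewrite expr0n eq_sym.
    + by rewrite /=; apply/andP; split; lra.
    + by rewrite /=; apply/andP; split; lra.
    + have [rs is_] := sq_bound (x / 2).
      have h1 : Re (sq (x / 2) ^+ 2 * eps%:C) <= 3 * eps.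
        by apply: Re_sqr_le => //=; apply/andP; split; lra.
      have h2 := Re_big x.
      have -> : Re (w x y) = (1 - y) * Re (sq (x / 2) ^+ 2 * eps%:C) + y * Re (big x).
        rewrite /w [eps%:C * _]mulrC.
        have e1 := sideZ East (1 - y) (sq (x / 2) ^+ 2 * eps%:C).
        have e2 := sideZ East y (big x).
        by rewrite -[LHS]/(side East _) sideD e1 e2.
      by move: h1 h2; move: (Re _) (Re _) => p r; rewrite /meridian_size; nra.
  - move=> y; rewrite /w big_closed; congr (psi 0 (_ * (_ * _) + _)).
    rewrite mul0r sq0 sq_north; last by apply/andP; split; lra.
    by rewrite !expr2 /=; congr Complex; field.
  - apply/funext => x; rewrite /half_turn /w subr0.
    by rewrite rmorph1 rmorph0 mul1r mul0r addr0.
  - by apply/funext => x; rewrite /w subrr rmorph1 rmorph0 mul1r mul0r add0r.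
apply: (is_conj_homotopy tr (H := fun x y => psi (y%:C * b0) (big x))).
- have c3 := ccont_big cont1.
  by apply: vcont_psi; solve_ccont.
- by move=> x y x01 y01; exact: Zset_big.
- by move=> y; rewrite big_closed.
- by apply/funext => x; rewrite rmorph0 mul0r.
- by apply/funext => x; rewrite rmorph1 !mul1r.
Qed.

Lemma zpath_big : zpath (@Zset R) (fun t => psi b0 (big t)).
Proof.
split; last by move=> t t01; have := Zset_big (in01_1 R) t01; rewrite rmorph1 !mul1r.
apply: vcont_psi; first exact: ccont_cst.
by apply: ccont_big => t; exact: cvg_id.
Qed.

Lemma zpath_a : zpath (@Zset R) (@loop_a R).
Proof.
have e0 := eps_gt0 R; split.
  have cs : ccont (fun t : R => sq t) by apply: ccont_sq => t; exact: cvg_id.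
  by apply: vcont_psi; solve_ccont.
move=> t t01; rewrite loop_aE; have [/andP[h1 h2] /andP[h3 h4]] := sq_bound t.
rewrite /= in h1 h2 h3 h4; apply: Zset_corner.
- by rewrite mulf_neq0 ?sq_neq0// realC_neq0// oppr_eq0 lt0r_neq0.
- by apply: neq0_Re; rewrite /= /meridian_size; lra.
- by rewrite /=; apply/andP; split; nra.
- by rewrite /=; apply/andP; split; nra.
- by rewrite /= /meridian_size; apply/andP; split; lra.
- by rewrite /= /meridian_size; apply/andP; split; lra.
Qed.

Lemma zpath_s : zpath (@Zset R) (@loop_s R).
Proof.
split.
  have cs : ccont (fun t : R => sq t) by apply: ccont_sq => t; exact: cvg_id.
  by apply: vcont_psi; solve_ccont.
move=> t t01; rewrite /loop_s /circle_w; apply: Zset_meridian => //; first exact: eps_gt0.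
  by rewrite /nrm /= /meridian_size; lra.
by rewrite /nrm /= /meridian_size; lra.
Qed.

Lemma sub_match (u v : R -> C) (a b c d : R) :
  (forall t, 0 <= t <= 1 -> u (a + (b - a) * t) = v (c + (d - c) * t)) ->
  0 <= a <= 1 -> 0 <= b <= 1 -> 0 <= c <= 1 -> 0 <= d <= 1 ->
  zpath (@Zset R) (fun t => psi b0 (u t)) -> zpath (@Zset R) (fun t => psi b0 (v t)) ->
  Phi (subpath (fun t => psi b0 (u t)) a b) = Phi (subpath (fun t => psi b0 (v t)) c d).
Proof.
move=> uv a01 b01 c01 d01 Zu Zv; apply: (Phi_ext tr (zpath_sub a01 b01 Zu)).
  exact: (zpath_sub c01 d01 Zv).1.
by move=> t /uv; rewrite /subpath => ->.
Qed.

(** The rectangle is cut along the common edge of the two squares. The conjugating element is the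
    transport along the lower edge of the square of [loop_a], which joins the two base points. *)
Lemma big_pants : exists g, (Phi (fun t => psi b0 (big t)) =
  Phi (@loop_a R) * Phi (@loop_s R) ^ g)%g.
Proof.
pose wa (t : R) : C := (2 * eps)%:C + eps%:C * sq t.
pose ws (t : R) : C := eps%:C * sq t.
have Zb := zpath_big; have Za : zpath (@Zset R) (fun t => psi b0 (wa t)) := zpath_a.
have Zs : zpath (@Zset R) (fun t => psi b0 (ws t)) := zpath_s.
pose B a b := Phi (subpath (fun t => psi b0 (big t)) a b).
pose A a b := Phi (subpath (fun t => psi b0 (wa t)) a b).
pose S a b := Phi (subpath (fun t => psi b0 (ws t)) a b).
have in01 (x : R) : (0 <= x) && (x <= 1) -> 0 <= x <= 1 by [].
have i0 := in01_0 R; have i1 := in01_1 R; have i4 : 0 <= (1 / 2 : R) <= 1 by apply/andP; split; lra.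
have i2 : 0 <= (1 / 4 : R) <= 1 by apply/andP; split; lra.
have i3 : 0 <= (3 / 8 : R) <= 1 by apply/andP; split; lra.
have i6 : 0 <= (3 / 4 : R) <= 1 by apply/andP; split; lra.
have i7 : 0 <= (7 / 8 : R) <= 1 by apply/andP; split; lra.
have bigE' t x y : sq t = x +i* y -> big t = (eps + 2 * eps * x) +i* (eps * y).
  by rewrite /sq /outer_square => -[-> ->].
have waE t x y : sq t = x +i* y -> wa t = (2 * eps + eps * x) +i* (eps * y).
  by rewrite /wa => -> /=; congr Complex; ring.
have wsE t x y : sq t = x +i* y -> ws t = (eps * x) +i* (eps * y).
  by rewrite /ws => -> /=; congr Complex; ring.
have m1 : B 0 (1 / 4) = A 0 (1 / 4).
  apply: sub_match => // t /andP[t0 t1].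
  rewrite (bigE' _ _ _ (sq_east _)) ?(waE _ _ _ (sq_east _)); try (apply/andP; split; lra).
  by congr Complex; ring.
have m2 : B (1 / 4) (3 / 8) = A (1 / 4) (1 / 2).
  apply: sub_match => // t /andP[t0 t1].
  rewrite (bigE' _ _ _ (sq_north _)) ?(waE _ _ _ (sq_north _)); try (apply/andP; split; lra).
  by congr Complex; field.
have m3 : B (3 / 8) (1 / 2) = S (1 / 4) (1 / 2).
  apply: sub_match => // t /andP[t0 t1].
  rewrite (bigE' _ _ _ (sq_north _)) ?(wsE _ _ _ (sq_north _)); try (apply/andP; split; lra).
  by congr Complex; field.
have m4 : B (1 / 2) (3 / 4) = S (1 / 2) (3 / 4).
  apply: sub_match => // t /andP[t0 t1].
  rewrite (bigE' _ _ _ (sq_west _)) ?(wsE _ _ _ (sq_west _)); try (apply/andP; split; lra).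
  by congr Complex; field.
have m5 : B (3 / 4) (7 / 8) = S (3 / 4) 1.
  apply: sub_match => // t /andP[t0 t1].
  rewrite (bigE' _ _ _ (sq_south _)) ?(wsE _ _ _ (sq_south _)); try (apply/andP; split; lra).
  by congr Complex; field.
have m6 : B (7 / 8) 1 = A (3 / 4) 1.
  apply: sub_match => // t /andP[t0 t1].
  rewrite (bigE' _ _ _ (sq_south _)) ?(waE _ _ _ (sq_south _)); try (apply/andP; split; lra).
  by congr Complex; field.
(* The common edge, which the two squares traverse in opposite directions. *)
have m7 : S 0 (1 / 4) = A (3 / 4) (1 / 2).
  apply: sub_match => // t /andP[t0 t1].
  rewrite (wsE _ _ _ (sq_east _)) ?(waE _ _ _ (sq_west _)); try (apply/andP; split; lra).
  by congr Complex; field.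
have eB : Phi (fun t => psi b0 (big t)) =
    (B 0%R (1 / 4)%R * (B (1 / 4)%R (3 / 8)%R * (B (3 / 8)%R (1 / 2)%R * (B (1 / 2)%R (3 / 4)%R *
      (B (3 / 4)%R (7 / 8)%R * B (7 / 8)%R 1%R)))))%g.
  by rewrite /B !(Phi_sub tr Zb)// subpath01.
have eA : Phi (@loop_a R) =
    (A 0%R (1 / 4)%R * (A (1 / 4)%R (1 / 2)%R * (A (1 / 2)%R (3 / 4)%R * A (3 / 4)%R 1%R)))%g.
  by rewrite /A !(Phi_sub tr Za)// subpath01.
have eS : Phi (@loop_s R) =
    (S 0%R (1 / 4)%R * (S (1 / 4)%R (1 / 2)%R * (S (1 / 2)%R (3 / 4)%R * S (3 / 4)%R 1%R)))%g.
  by rewrite /S !(Phi_sub tr Zs)// subpath01.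
exists (A (3 / 4) 1); rewrite eB eA eS m1 m2 m3 m4 m5 m6 m7.
have -> : A (3 / 4) (1 / 2) = ((A (1 / 2)%R (3 / 4)%R)^-1)%g by apply: (Phi_subV tr Za).
by rewrite conjgE -!mulgA !mulVKg.
Qed.

(** The orbit is conjugate to the square of the half turn, which is conjugate to a product of
    conjugates of [s] and [a]; the torus [worbit] supplies the commutation. *)
Theorem transport_tangency : tangency_relation (Phi (@loop_s R)) (Phi (@loop_a R)).
Proof.
have [g1 e1] := worbit_weighted tr; have [g2 e2] := half_turn_big.
have [g3 e3] := big_pants; have [g4 e4] := worbit_s tr.
have e5 := worbit_commute tr; rewrite (weightedE tr) in e1.
set E := Phi (@half_turn R) in e1 e2; set a := Phi (@loop_a R) in e3 *.
set s := Phi (@loop_s R) in e3 e4 *.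
(* [k] is chosen so that a s^g3 = s^k a. *)
set k := (g3 * a^-1)%g; set x := (s ^ k * a ^ 1)%g.
have ex : (E ^ g2)%g = x.
  by rewrite -e2 e3 /x /k conjg1 conjgM [X in (X * a)%g]conjgE invgK -mulgA mulgVK.
exists k, 1%g, (g2^-1 * g1^-1)%g, g4; rewrite -/x -e4.
have -> : ((x * x) ^ (g2^-1 * g1^-1))%g = Phi ((@worbit R)^~ 0).
  by rewrite conjgM (conjMg x x) -ex conjgK e1 conjgK.
exact: e5.
Qed.

End Pants.

Section TransportMain.
Variables (R : realType) (G : groupType).
Local Notation V := (R[i] * R[i])%type.
Variable (Phi : (R -> V) -> G).
Hypothesis tr : transport (@Zset R) Phi.

Lemma transport_meridian_commute :
  exists x y, commute (Phi (@loop_a R) ^ x)%g (Phi (@loop_b R) ^ y)%g.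
Proof.
have [x ex] := loop_a_torus tr (in01_0 R); have [y ey] := loop_b_torus tr (in01_0 R).
by exists x, y; rewrite -ex -ey; exact: torus_commute.
Qed.

Lemma transport_tangency_b : tangency_relation (Phi (@loop_s R)) (Phi (@loop_b R)).
Proof.
have [g1 [g2 [g3 [g4]]]] := transport_tangency (transport_swap tr).
have [g e] : is_conj (Phi (@loop_s R)) (swap_transport Phi (@loop_s R)).
  (* [swap] sends [loop_s] to the meridian at b = 3/4; the base point slides there from 1/4 along
     the real axis. *)
  pose b (y : R) : R[i] := (1 / 4 + 1 / 2 * y)%:C.
  apply: (is_conj_homotopy tr (H := fun x y => circle_w (b y) (meridian_size R) x)).
  - have cb : ccont (fun p : R * R => b p.2) by apply: ccont_real; exact: continuous_affine_snd.
    have cs : ccont (fun p : R * R => sq p.1) by apply: ccont_sq => p; exact: cvg_fst.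
    by apply: vcont_psi; solve_ccont.
  - move=> x y x01 /andP[y0 y1]; apply: Zset_meridian => //; first exact: eps_gt0.
      by rewrite /nrm /= /meridian_size; nra.
    by rewrite /nrm /= /meridian_size; nra.
  - by move=> y; rewrite /circle_w sq0 sq1.
  - by apply/funext => x; rewrite /b mulr0 addr0.
  - by apply/funext => x; rewrite /swap /circle_w /psi /=; congr pair;
      congr (_ - _); rewrite /b !expr2 /=; congr Complex; field.
rewrite e -!conjgM => h; exists (g * g1)%g, g2, g3, (g * g4)%g.
exact: h.
Qed.

End TransportMain.

Local Open Scope quotient_scope.

(** * From paths in C^2 to the fundamental group *)

Section PathClasses.
Variables (R : realType) (X : topologicalType) (c : X).
Local Notation I := (unit_interval R).
Local Notation G := (fundamental_group R c).
Local Open Scope group_scope.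

Variable delta : forall x : X, {path I from c to x in X}.

Definition loop_class (p : loop R c) : G := \pi_G p.

(** The map from the fundamental groupoid to the group at [c] given by a choice of paths [delta]. *)
Definition path_class x y (p : {path I from x to y in X}) : G :=
  loop_class (concat_path (concat_path (delta x) p) (Defs.rev_path (delta y))).

Lemma loop_classM p q : loop_class p * loop_class q = loop_class (concat_path p q).
Proof. exact: pi1_mulE. Qed.

Lemma loop_class_homotopic p q : path_homotopic p q -> loop_class p = loop_class q.
Proof. by move=> h; apply/loop_classP. Qed.

Lemma path_class_homotopic x y (p q : {path I from x to y in X}) :
  path_homotopic p q -> path_class p = path_class q.
Proof.
move=> h; apply: loop_class_homotopic.
apply: concat_path_homotopic; last exact: path_homotopic_refl.
by apply: concat_path_homotopic => //; exact: path_homotopic_refl.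
Qed.

Lemma path_classM x y z (p : {path I from x to y in X}) (q : {path I from y to z in X}) :
  path_class p * path_class q = path_class (concat_path p q).
Proof.
rewrite loop_classM; apply: loop_class_homotopic.
apply: path_homotopic_trans (concat_pathA _ _ _) _.
apply: concat_path_homotopic; last exact: path_homotopic_refl.
apply: path_homotopic_trans (path_homotopic_sym (concat_pathA _ _ _)) _.
apply: path_homotopic_trans; last exact: path_homotopic_sym (concat_pathA _ _ _).
apply: concat_path_homotopic; first exact: path_homotopic_refl.
apply: path_homotopic_trans (concat_pathA _ _ _) _.
apply: path_homotopic_trans (concat_cst_path q).
apply: concat_path_homotopic; last exact: path_homotopic_refl.
exact: concat_rev_path.
Qed.

(** An idempotent of a group is 1. *)
Lemma path_class_cst x : path_class (cst_path R x) = 1.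
Proof.
apply: (@mulgI _ (path_class (cst_path R x))); rewrite mulg1 path_classM.
exact/path_class_homotopic/concat_cst_path.
Qed.

Lemma path_homotopic_ext x y (p q : {path I from x to y in X}) : p =1 q ->
  path_homotopic p q.
Proof.
move=> pq; apply: (@reparam_homotopic R X x y x y q id id) => // t; exact: cvg_id.
Qed.

(** Endpoints belong to the type of a path; this compares paths whose endpoints are only provably
    equal. *)
Lemma path_class_ext x y x' y' (p : {path I from x to y in X})
    (q : {path I from x' to y' in X}) : x = x' -> y = y' -> p =1 q ->
  path_class p = path_class q.
Proof.
move=> xx yy; case: x' / xx q => q; case: y' / yy q => q pq.
exact/path_class_homotopic/path_homotopic_ext.
Qed.

Lemma path_class_loop (p : loop R c) :
  path_class p = loop_class p ^ (loop_class (delta c))^-1.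
Proof.
rewrite conjgE invgK mulgA /path_class -!loop_classM; congr (_ * _).
by rewrite -[RHS]/(pi1_inv _) pi1_invE.
Qed.

End PathClasses.

Section TransportOfSpace.
Variables (R : realType) (X : topologicalType) (c : X).
Local Notation I := (unit_interval R).
Local Notation G := (fundamental_group R c).
Local Notation C := R[i].
Local Notation V := (R[i] * R[i])%type.

Variables (g : V -> X) (F : X -> V).
Hypothesis g_cont : forall (T : topologicalType) (f : T -> V), vcont f ->
  (forall x, Zset (f x)) -> continuous (g \o f).
Hypothesis F_cont : vcont F.
Hypothesis F_Z : forall x, Zset (F x).
Hypothesis gF : forall x, g (F x) = x.

Section PathOf.
Variable f : R -> V.
Hypothesis Zf : zpath (@Zset R) f.

Lemma path_of_continuous : continuous (fun t : I => g (f (val t))).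
Proof.
apply: (@g_cont I (fun t => f (val t))).
  exact: (vcont_comp (@val_unit_interval_continuous R) Zf.1).
by move=> t; apply: Zf.2; exact: unit_interval_bounds.
Qed.

Lemma path_of_zero : g (f (val (zero : I))) = g (f 0).
Proof. by rewrite val_zero. Qed.

Lemma path_of_one : g (f (val (one : I))) = g (f 1).
Proof. by rewrite val_one. Qed.

Definition path_of : {path I from g (f 0) to g (f 1) in X} :=
  mk_path path_of_continuous path_of_zero path_of_one.

Lemma path_ofE t : path_of t = g (f (val t)).
Proof. by []. Qed.

End PathOf.

(** All of C^2 is open and convex, so [linked_convex] joins [F x] to [F y]. *)
Lemma path_connected_space x y : inhabited {path I from x to y in X}.
Proof.
have cT : cvx [set: V] by [].
have oT : vopen [set: V] by move=> f cf t _; exists 1.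
have TF x' : [set: V] (F x') by [].
have := linked_convex oT cT (TF x) (TF y) (F_Z x) (F_Z y).
suff h v w : linked (@Zset R) [set: V] v w -> inhabited {path I from g v to g w in X}.
  by move=> /h; rewrite !gF.
elim=> [u|f u Sf _ [p]]; first by split; exact: cst_path.
have Zf : zpath (@Zset R) f by apply: (zpathS _ Sf) => z [].
by split; exact: (concat_path (path_of Zf) p).
Qed.

Definition delta_path x : {path I from c to x in X} :=
  projT1 (cid (let: inhabits p := path_connected_space c x in
    ex_intro (fun _ : {path I from c to x in X} => True) p Logic.I)).

(** The value 1 off the paths of [Zset] is junk. *)
Definition transport_of (f : R -> V) : G :=
  if pselect (zpath (@Zset R) f) is left Zf then path_class delta_path (path_of Zf)
  else 1%g.

Lemma transport_ofE f (Zf : zpath (@Zset R) f) :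
  transport_of f = path_class delta_path (path_of Zf).
Proof.
rewrite /transport_of; case: pselect => [Zf'|//].
exact: path_class_ext.
Qed.

Section Rectangle.
Variable H : R -> R -> V.
Hypothesis cH : vcont (fun p : R * R => H p.1 p.2).
Hypothesis ZH : forall x y, 0 <= x <= 1 -> 0 <= y <= 1 -> Zset (H x y).

(** The two paths come from paths of the unit square between (0, 0) and (1, 1), which a straight
    homotopy joins. *)
Lemma rectangle_homotopic (p q : {path I from g (H 0 0) to g (H 1 1) in X})
    (p1 p2 q1 q2 : R -> R) :
  continuous p1 -> continuous p2 -> continuous q1 -> continuous q2 ->
  (forall t, 0 <= t <= 1 -> [/\ 0 <= p1 t <= 1, 0 <= p2 t <= 1, 0 <= q1 t <= 1 & 0 <= q2 t <= 1]) ->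
  p1 0 = 0 -> p2 0 = 0 -> q1 0 = 0 -> q2 0 = 0 ->
  p1 1 = 1 -> p2 1 = 1 -> q1 1 = 1 -> q2 1 = 1 ->
  (forall t, p t = g (H (p1 (val t)) (p2 (val t)))) ->
  (forall t, q t = g (H (q1 (val t)) (q2 (val t)))) ->
  path_homotopic p q.
Proof.
move=> cp1 cp2 cq1 cq2 h p10 p20 q10 q20 p11 p21 q11 q21 pE qE.
pose mix (u v : R -> R) (x : I * I) := (1 - val x.2) * u (val x.1) + val x.2 * v (val x.1).
have cv1 : continuous (fun x : I * I => val x.1).
  move=> x; apply: (@continuous_comp (I * I)%type I R fst (fun y : I => val y) x).
    exact: cvg_fst.
  exact: val_unit_interval_continuous.
have cv2 : continuous (fun x : I * I => val x.2).
  move=> x; apply: (@continuous_comp (I * I)%type I R snd (fun y : I => val y) x).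
    exact: cvg_snd.
  exact: val_unit_interval_continuous.
have cmix u v : continuous u -> continuous v -> continuous (mix u v).
  move=> cu cv x; apply: cvgD; apply: cvgM.
  - by apply: cvgB; [exact: cvg_cst|exact: cv2].
  - exact: (@continuous_comp _ _ _ (fun x : I * I => val x.1) u x (cv1 x) (cu _)).
  - exact: cv2.
  - exact: (@continuous_comp _ _ _ (fun x : I * I => val x.1) v x (cv1 x) (cv _)).
have mix01 u v : (forall t, 0 <= t <= 1 -> 0 <= u t <= 1) ->
    (forall t, 0 <= t <= 1 -> 0 <= v t <= 1) -> forall x, 0 <= mix u v x <= 1.
  move=> hu hv x; have /andP[s0 s1] := unit_interval_bounds x.2.
  have /andP[? ?] := hu _ (unit_interval_bounds x.1).
  have /andP[? ?] := hv _ (unit_interval_bounds x.1).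
  by rewrite /mix; apply/andP; split; nra.
have mixE u v x (a : R) : u (val x.1) = a -> v (val x.1) = a -> mix u v x = a.
  by rewrite /mix => -> ->; ring.
exists (fun x => g (H (mix p1 q1 x) (mix p2 q2 x))); split.
- apply: (@g_cont _ (fun x => H (mix p1 q1 x) (mix p2 q2 x))).
    apply: (@vcont_comp R _ _ (fun p : R * R => H p.1 p.2)
      (fun x => (mix p1 q1 x, mix p2 q2 x))) => //.
    by move=> x; apply: pair_continuous; [exact: cmix|exact: cmix].
  move=> x; apply: ZH; apply: mix01 => t /h; by case.
- move=> t; have e : val ((t, zero : I).2) = 0 := val_zero R.
  by rewrite pE /mix e; congr (g (H _ _)); rewrite subr0 mul1r mul0r addr0.
- move=> t; have e : val ((t, one : I).2) = 1 := val_one R.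
  by rewrite qE /mix e; congr (g (H _ _)); rewrite subrr mul1r mul0r add0r.
- move=> s; have e : val ((zero : I, s).1) = 0 := val_zero R.
  by rewrite (mixE p1 q1 _ 0) ?(mixE p2 q2 _ 0)// e.
- move=> s; have e : val ((one : I, s).1) = 1 := val_one R.
  by rewrite (mixE p1 q1 _ 1) ?(mixE p2 q2 _ 1)// e.
Qed.

End Rectangle.

Lemma transport_of_transport : transport (@Zset R) transport_of.
Proof.
split=> [z Zz|H cH ZH].
  have Zc : zpath (@Zset R) (fun=> z) by split=> //; split; exact: ccont_cst.
  rewrite (transport_ofE Zc) -(path_class_cst delta_path (g z)).
  exact: path_class_ext.
have c0 : continuous (fun _ : R => 0 : R) by move=> x; exact: cvg_cst.
have c1 : continuous (fun _ : R => 1 : R) by move=> x; exact: cvg_cst.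
have cid : continuous (fun x : R => x) by move=> x; exact: cvg_id.
have cpair (u v : R -> R) : continuous u -> continuous v -> continuous (fun x => (u x, v x)).
  by move=> cu cv x; apply: pair_continuous; [exact: cu|exact: cv].
have i0 := in01_0 R; have i1 := in01_1 R.
have Zb : zpath (@Zset R) (fun x => H x 0).
  by split=> [|t t01]; [exact: (vcont_comp (cpair _ _ cid c0) cH)|exact: ZH].
have Zt : zpath (@Zset R) (fun x => H x 1).
  by split=> [|t t01]; [exact: (vcont_comp (cpair _ _ cid c1) cH)|exact: ZH].
have Zl : zpath (@Zset R) (fun y => H 0 y).
  by split=> [|t t01]; [exact: (vcont_comp (cpair _ _ c0 cid) cH)|exact: ZH].
have Zr : zpath (@Zset R) (fun y => H 1 y).
  by split=> [|t t01]; [exact: (vcont_comp (cpair _ _ c1 cid) cH)|exact: ZH].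
rewrite (transport_ofE Zb) (transport_ofE Zt) (transport_ofE Zl) (transport_ofE Zr).
rewrite !path_classM; apply: path_class_homotopic.
(* (lo, hi) runs along the bottom and then the right side of the square, (hi, lo) along the left and
   then the top side. *)
pose lo (t : R) : R := Num.min 1 (2 * t + 0); pose hi (t : R) : R := Num.max 0 (2 * t + - 1).
have caff (b : R) : continuous (fun t : R => 2 * t + b).
  by move=> t; apply: cvgD; [apply: cvgM; [exact: cvg_cst|exact: cvg_id]|exact: cvg_cst].
have clo : continuous lo by move=> t; exact: (@continuous_min R R _ _ t (c1 t) (caff 0 t)).
have chi : continuous hi by move=> t; exact: (@continuous_max R R _ _ t (c0 t) (caff (-1) t)).
have lo01 t : 0 <= t <= 1 -> 0 <= lo t <= 1.
  by move=> /andP[? ?]; rewrite /lo; case: (leP 1 (2 * t + 0)) => ?; apply/andP; split; lra.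
have hi01 t : 0 <= t <= 1 -> 0 <= hi t <= 1.
  by move=> /andP[? ?]; rewrite /hi; case: (leP 0 (2 * t + - 1)) => ?; apply/andP; split; lra.
have lo0 : lo 0 = 0 by rewrite /lo; case: leP => ?; lra.
have hi0 : hi 0 = 0 by rewrite /hi; case: leP => ?; lra.
have lo1 : lo 1 = 1 by rewrite /lo; case: leP => ?; lra.
have hi1 : hi 1 = 1 by rewrite /hi; case: leP => ?; lra.
have lohi (t : I) : val t <= 2^-1 ->
    lo (val t) = val (clamp (2 * val t)) /\ hi (val t) = 0.
  have /andP[? ?] := unit_interval_bounds t => ht.
  rewrite clampK; last by apply/andP; split; lra.
  by split; rewrite /lo /hi; case: leP => ?; lra.
have hilo (t : I) : 2^-1 < val t ->
    hi (val t) = val (clamp (2 * val t - 1)) /\ lo (val t) = 1.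
  have /andP[? ?] := unit_interval_bounds t => ht.
  rewrite clampK; last by apply/andP; split; lra.
  by split; rewrite /lo /hi; case: leP => ?; lra.
apply: (rectangle_homotopic cH ZH clo chi chi clo) => //.
- by move=> t t01; split; [exact: lo01|exact: hi01|exact: hi01|exact: lo01].
- move=> t; rewrite -[LHS]/(concat_fun _ _ t) /concat_fun; case: leP => ht.
    by have [-> ->] := lohi t ht.
  by have [-> ->] := hilo t ht.
- move=> t; rewrite -[LHS]/(concat_fun _ _ t) /concat_fun; case: leP => ht.
    by have [-> ->] := lohi t ht.
  by have [-> ->] := hilo t ht.
Qed.

(** [F] lifts the loop to C^2, [clamp] extends it to [R], and [gF] brings it back. *)
Lemma transport_of_surj (p : loop R c) : exists f,
  [/\ zpath (@Zset R) f, f 0 = f 1 &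
    transport_of f = (loop_class p ^ (loop_class (delta_path c))^-1)%g].
Proof.
pose f (t : R) := F (p (clamp t)).
have cp : continuous p by exact: (@cts_fun I X p).
have cf : vcont f.
  apply: (vcont_comp _ F_cont (g := fun t : R => p (clamp t))) => t.
  apply: (@continuous_comp _ _ _ (@clamp R) p t); last exact: cp.
  exact: clamp_continuous.
have Zf : zpath (@Zset R) f by split=> // t _; exact: F_Z.
have f0 : f 0 = F c by rewrite /f -[clamp 0]/(zero : I) path_zero.
have f1 : f 1 = F c by rewrite /f -[clamp 1]/(one : I) path_one.
exists f; split=> //; first by rewrite f0 f1.
rewrite (transport_ofE Zf) -path_class_loop.
apply: path_class_ext; rewrite ?f0 ?f1 ?gF// => t.
by rewrite path_ofE /f valK_clamp gF.
Qed.

Theorem pi1_lower_central_elementary (i : nat) : (1 < i)%N -> exists n,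
  group_isomorphic (lower_central_quotient G i) {ffun 'I_n -> 'Z_2}.
Proof.
have tr := transport_of_transport.
apply: (@lower_central_elementary G (transport_of (@loop_a R))
  (transport_of (@loop_b R)) (transport_of (@loop_s R))).
- move=> N nN Na Nb Ns x.
  have -> : x = loop_class (repr x) by rewrite /loop_class reprK.
  have [f [Zf f01 fE]] := transport_of_surj (repr x).
  have := Phi_generated tr nN Na Nb Ns Zf f01.
  by rewrite fE => /normalJE; apply.
- exact: transport_meridian_commute.
- exact: transport_tangency.
- exact: transport_tangency_b.
Qed.

End TransportOfSpace.

(** * Continuous branches of the square root *)

Section Continuity.
Variable R : realType.
Local Notation C := R[i].

Lemma ptws_continuous (T M : topologicalType) (I : Type) (f : T -> {ptws I -> M}) :
  (forall i, continuous (fun t => f t i)) -> continuous f.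
Proof.
move=> cf t; apply/cvg_sup => i U [V [[W oW <-] WfN WU]].
by apply: (filterS WU); apply: (cf i t); exact: open_nbhs_nbhs.
Qed.

Lemma continuous_at_open (T X : topologicalType) (U : set T) (h k : T -> X) (t : T) :
  open U -> U t -> continuous (sigL U k) -> (forall x, U x -> h x = k x) ->
  {for t, continuous h}.
Proof.
move=> oU Ut /subspace_sigL_continuousP; rewrite continuous_open_subspace// => ck hk.
have ct : {for t, continuous k} by apply: ck; rewrite inE.
rewrite /prop_for /continuous_at (hk t Ut); apply: cvg_trans ct.
apply: near_eq_cvg; near=> x; rewrite hk//; near: x.
exact: open_nbhs_nbhs.
Unshelve. all: by end_near. Qed.

Lemma ccont_sigL (T : topologicalType) (U : set T) (f : T -> C) :
  ccont f -> ccont (fun t : U => f (val t)).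
Proof. by apply: ccont_comp; exact: initial_continuous. Qed.

(* The principal root, continuous off the slit Re d <= 0 = Im d. *)
Definition proot (d : C) : C :=
  let x := Num.sqrt ((Num.sqrt (Re d ^+ 2 + Im d ^+ 2) + Re d) / 2) in
  x +i* (Im d / (2 * x)).

(** |d| + Re d vanishes exactly on the slit; off it, the denominator in [proot] is nonzero. *)
Lemma slit_gt0 (d : C) : (0 < Num.sqrt (Re d ^+ 2 + Im d ^+ 2) + Re d) =
  ~~ ((Re d <= 0) && (Im d == 0)).
Proof.
have s0 := sqrtr_ge0 (Re d ^+ 2 + Im d ^+ 2).
have sE : Num.sqrt (Re d ^+ 2 + Im d ^+ 2) ^+ 2 = Re d ^+ 2 + Im d ^+ 2.
  by rewrite sqr_sqrtr// addr_ge0 ?sqr_ge0.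
move: s0 sE; set n := Num.sqrt _ => n0 nE.
have [d0|d0] := leP (Re d) 0; last by rewrite ltr_wpDl.
have [i0|i0] /= := eqVneq (Im d) 0.
  apply/negbTE; rewrite -leNgt; rewrite i0 in nE; nra.
have i2 : 0 < Im d ^+ 2 by rewrite exprn_even_gt0.
rewrite ltNge; apply/negP => h; nra.
Qed.

Lemma sqr_proot d : ~~ ((Re d <= 0) && (Im d == 0)) -> proot d ^+ 2 = d.
Proof.
rewrite -slit_gt0 /proot.
have sE : Num.sqrt (Re d ^+ 2 + Im d ^+ 2) ^+ 2 = Re d ^+ 2 + Im d ^+ 2.
  by rewrite sqr_sqrtr// addr_ge0 ?sqr_ge0.
move: sE; set n := Num.sqrt _ => nE n0.
have x0 : 0 < Num.sqrt ((n + Re d) / 2) by rewrite sqrtr_gt0 divr_gt0.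
have xE : Num.sqrt ((n + Re d) / 2) ^+ 2 = (n + Re d) / 2.
  by rewrite sqr_sqrtr// ltW// divr_gt0.
move: x0 xE; set x := Num.sqrt _ => x0 xE.
have xn : x != 0 by rewrite gt_eqF.
have nn : n + Re d != 0 by rewrite gt_eqF.
clearbody x n; case: d nE n0 xE nn => a b /= nE n0 xE nn.
set y := b / (2 * x); have yE : 2 * (x * y) = b by rewrite /y; field.
have y2 : y ^+ 2 = (n - a) / 2.
  apply: (mulfI nn); transitivity (b ^+ 2 / 2); last by nra.
  by rewrite -yE !exprMn xE; field.
rewrite expr2; apply/eqP; rewrite eq_complex /=; apply/andP; split; apply/eqP.
  by rewrite -!expr2 xE y2; field.
by rewrite [y * x]mulrC -yE; ring.
Qed.

Lemma ccont_proot (T : topologicalType) (d : T -> C) : ccont d ->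
  (forall t, ~~ ((Re (d t) <= 0) && (Im (d t) == 0))) ->
  ccont (fun t => proot (d t)).
Proof.
move=> [cr ci] h.
have cn : continuous (fun t => Num.sqrt (Re (d t) ^+ 2 + Im (d t) ^+ 2)).
  move=> t; apply: (@continuous_comp _ _ _ (fun t => Re (d t) ^+ 2 + Im (d t) ^+ 2) Num.sqrt);
    last exact: sqrt_continuous.
  by rewrite /prop_for; under eq_fun do rewrite !expr2; apply: cvgD; apply: cvgM;
    [exact: cr|exact: cr|exact: ci|exact: ci].
have cx : continuous (fun t => Re (proot (d t))).
  move=> t; apply: (@continuous_comp _ _ _ (fun t =>
    (Num.sqrt (Re (d t) ^+ 2 + Im (d t) ^+ 2) + Re (d t)) / 2) Num.sqrt);
    last exact: sqrt_continuous.
  by apply: cvgM; [apply: cvgD; [exact: cn|exact: cr]|exact: cvg_cst].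
split=> // t; apply: cvgM; first exact: ci.
apply: cvgV; last by apply: cvgM; [exact: cvg_cst|exact: cx].
by rewrite mulf_neq0// gt_eqF// sqrtr_gt0 divr_gt0// slit_gt0.
Qed.

Lemma open_slit (T : topologicalType) (d : T -> C) : ccont d ->
  open [set t | ~~ ((Re (d t) <= 0) && (Im (d t) == 0))].
Proof.
move=> [cr ci]; rewrite (_ : mkset _ =
  [set t | 0 < Re (d t)] `|` [set t | Im (d t) != 0]).
  apply: openU.
    by apply: (@open_comp _ _ (fun t => Re (d t)) [set x | 0 < x]) => [t _|]; [exact: cr|exact: open_gt].
  by apply: (@open_comp _ _ (fun t => Im (d t)) [set x | x != 0]) => [t _|]; [exact: ci|exact: open_neq].
apply/seteqP; split=> t /=; rewrite negb_and -ltNge.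
  by case/orP; [left|right].
by case=> ->; rewrite ?orbT.
Qed.

End Continuity.

(** * Unordered pairs of points and their coefficients *)

Section PairOfPoints.
Variables (R : realType) (M : topologicalType).
Local Notation C := R[i].
Local Notation V := (R[i] * R[i])%type.
Local Notation Conf := (configuration_space 2 M).
Local Notation X := (unordered_configuration_space 2 M).

Variables (zeta : M -> C) (sg : C -> M) (c : X).
Hypothesis zeta_cont : ccont zeta.
Hypothesis zeta0 : forall y, zeta y != 0.
Hypothesis zeta1 : forall y, zeta y != 1.
Hypothesis sgK : forall z, z != 0 -> z != 1 -> zeta (sg z) = z.
Hypothesis zetaK : cancel zeta sg.
Hypothesis sg_cont : forall (T : topologicalType) (w : T -> C), ccont w ->
  (forall t, w t != 0) -> (forall t, w t != 1) -> continuous (sg \o w).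

Definition pair_of (y z : M) : {ptws 'I_2 -> M} := fun i => if i == ord0 then y else z.

Lemma ord2 (i : 'I_2) : i = ord0 \/ i = ord_max.
Proof. by case: i => [[|[|//]]] h; [left|right]; exact: val_inj. Qed.

Lemma pair_of_neq y z : y <> z ->
  pair_of y z \in [set y : {ptws 'I_2 -> M} | forall i j : 'I_2, i != j -> y i <> y j].
Proof.
move=> yz; rewrite inE /= => i j.
by case: (ord2 i) => ->; case: (ord2 j) => ->; rewrite /pair_of //= => _ /esym.
Qed.

(* Junk (the base configuration) when y = z. *)
Definition conf (y z : M) : Conf := insubd (repr c : Conf) (pair_of y z).

Lemma val_conf y z : y <> z -> val (conf y z) = pair_of y z.
Proof. by move=> yz; rewrite val_insubd pair_of_neq. Qed.

Lemma conf_sym y z : \pi_X (conf y z) = \pi_X (conf z y).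
Proof.
have [->//|yz] := pselect (y = z).
apply/eqmodP/asboolP; exists (tperm ord0 ord_max) => i.
rewrite (val_conf yz) (val_conf (not_eq_sym yz)).
by case: (ord2 i) => ->; rewrite /pair_of ?tpermL ?tpermR.
Qed.

Lemma conf_continuous (T : topologicalType) (f h : T -> M) :
  continuous f -> continuous h -> (forall t, f t <> h t) ->
  continuous (fun t => \pi_X (conf (f t) (h t))).
Proof.
move=> cf ch fh t.
apply: (@continuous_comp _ _ _ (fun t => conf (f t) (h t)) (\pi_X : Conf -> X));
  last exact: pi_continuous.
move: t; apply/(continuous_comp_initial (f := fun t => conf (f t) (h t))).
rewrite (_ : _ \o _ = fun t => pair_of (f t) (h t)); last first.
  by apply/funext => t /=; rewrite -[LHS]/(val (conf (f t) (h t))) val_conf.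
by apply: ptws_continuous => i; case: (ord2 i) => ->.
Qed.

(* Given by the roots b + r and b - r; symmetric, hence independent of the choice of
   the square root r of the discriminant. *)
Definition of_roots (b r : C) : X := \pi_X (conf (sg (b + r)) (sg (b - r))).

Lemma of_rootsN b r : of_roots b (- r) = of_roots b r.
Proof. by rewrite /of_roots opprK conf_sym. Qed.

Definition of_coefs (z : V) : X := of_roots (mid z) (sqrtc (dsc z)).

Lemma of_coefsE z r : r ^+ 2 = dsc z -> of_coefs z = of_roots (mid z) r.
Proof.
move=> rE; have /eqP := sqr_sqrtc (dsc z).
by rewrite -{2}rE eqf_sqr /of_coefs => /orP[/eqP->//|/eqP->]; rewrite of_rootsN.
Qed.

Lemma roots_Zset (z : V) r : Zset z -> r ^+ 2 = dsc z ->
  [/\ r != 0, mid z + r != 0 & mid z + r != 1].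
Proof.
case=> [z1 z2 d0] rE.
have zE := psiK z; rewrite /psi -rE in zE.
split; first by apply: contraNneq d0 => r0; rewrite -rE r0 expr0n.
- apply: contraNneq z1 => h; rewrite -zE /= (_ : _ - _ = (mid z + r) * (mid z - r)); last by ring.
  by rewrite h mul0r.
- apply: contraNneq z2 => h; rewrite -zE /=.
  rewrite (_ : _ - _ = (1 - (mid z + r)) * (1 - (mid z - r))); last by ring.
  by rewrite h subrr mul0r.
Qed.

(** [of_roots] ignores the sign of the root, so near each point [sqrtc] may be replaced by any
    branch that is continuous there. *)
Lemma of_coefs_continuous (T : topologicalType) (f : T -> V) : vcont f ->
  (forall x, Zset (f x)) -> continuous (of_coefs \o f).
Proof.
move=> cf Zf t.
(* The branch [k * proot (e * d)] with k^2 e = 1. The slits for e = 1 and e = -1 lie on opposite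
   half-axes, so the two branches cover d != 0. *)
have chart (e k : C) : k ^+ 2 * e = 1 -> ~~ ((Re (e * dsc (f t)) <= 0) && (Im (e * dsc (f t)) == 0)) ->
    {for t, continuous (of_coefs \o f)}.
  move=> ke et.
  have ce : ccont (fun x => e * dsc (f x)) by apply: ccontM; [exact: ccont_cst|exact: ccont_dsc].
  set U := [set x | ~~ ((Re (e * dsc (f x)) <= 0) && (Im (e * dsc (f x)) == 0))].
  pose r x := k * proot (e * dsc (f x)).
  have rE x : U x -> r x ^+ 2 = dsc (f x).
    by move=> Ux; rewrite exprMn sqr_proot// mulrA ke mul1r.
  apply: (@continuous_at_open _ _ U _ (fun x => of_roots (mid (f x)) (r x))) => //.
  - exact: open_slit.
  - have cm : ccont (fun x : U => mid (f (val x))).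
      by apply: (@ccont_sigL R _ U (fun x => mid (f x))); exact: ccont_mid.
    have cr : ccont (fun x : U => r (val x)).
      apply: ccontM; first exact: ccont_cst.
      apply: (@ccont_proot R U (fun x => e * dsc (f (val x)))).
        exact: (@ccont_sigL R _ U _ ce).
      by move=> x; have := valP x; rewrite inE.
    have UP (x : U) : U (val x) by have := valP x; rewrite inE.
    have rp (x : U) : [/\ r (val x) != 0, mid (f (val x)) + r (val x) != 0 & mid (f (val x)) + r (val x) != 1].
      by apply: (roots_Zset (Zf (val x))); exact: rE (UP x).
    have rm (x : U) : [/\ - r (val x) != 0, mid (f (val x)) - r (val x) != 0 & mid (f (val x)) - r (val x) != 1].
      by apply: (roots_Zset (Zf (val x))); rewrite sqrrN; exact: rE (UP x).
    apply: conf_continuous.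
    + apply: (@sg_cont U (fun x => mid (f (val x)) + r (val x))); first exact: ccontD.
        by move=> x; case: (rp x).
      by move=> x; case: (rp x).
    + apply: (@sg_cont U (fun x => mid (f (val x)) - r (val x))).
        by apply: ccontD => //; exact: ccontN.
        by move=> x; case: (rm x).
      by move=> x; case: (rm x).
    + move=> x /(congr1 zeta); have [r0 p0 p1] := rp x; have [_ m0 m1] := rm x.
      rewrite /sigL /= in r0 p0 p1 m0 m1 *.
      rewrite !sgK// => /addrI /eqP; rewrite -subr_eq0 opprK -mulr2n mulrn_eq0 /=.
      by apply/negP.
  - by move=> x Ux; rewrite /= (of_coefsE (rE x Ux)).
have [h|] := boolP ((Re (1 * dsc (f t)) <= 0) && (Im (1 * dsc (f t)) == 0)); last first.
  by apply: (chart 1 1); rewrite expr1n mul1r.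
apply: (chart (-1) 'i); first by rewrite sqr_i mulrNN mul1r.
move: h; rewrite mul1r mulN1r; have [_ _] := Zf t.
case: (dsc (f t)) => a b; rewrite eq_complex negb_and /= => ab /andP[a0 /eqP b0].
rewrite b0 oppr0 eqxx andbT -ltNge oppr_gt0 lt_neqAle a0 andbT.
by move: ab; rewrite b0 eqxx orbF.
Qed.

Definition coefs_of_conf (y : Conf) : V :=
  let z := zeta (val y ord0) in let w := zeta (val y ord_max) in
  (z * w, (1 - z) * (1 - w)).

Definition coefs (x : X) : V := coefs_of_conf (repr x).

(** The coefficients are symmetric in the two points, hence independent of the representative. *)
Lemma coefs_pi (y : Conf) : coefs (\pi_X y) = coefs_of_conf y.
Proof.
have /eqmodP/asboolP[s sE] : \pi_X (repr (\pi_X y)) = \pi_X y by rewrite reprK.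
rewrite /coefs /coefs_of_conf !sE.
case: (ord2 (s ord0)) => s0; rewrite s0; case: (ord2 (s ord_max)) => s1; rewrite s1 //.
- by have := perm_inj (etrans s0 (esym s1)).
- by congr pair; rewrite mulrC.
- by have := perm_inj (etrans s0 (esym s1)).
Qed.

Lemma vcont_coefs : vcont coefs.
Proof.
have cp (i : 'I_2) : ccont (fun y : Conf => zeta (val y i)).
  apply: (ccont_comp _ zeta_cont (g := fun y : Conf => val y i)) => y.
  apply: (@continuous_comp _ _ _ (val : Conf -> {ptws 'I_2 -> M}) (fun f => f i)).
    exact: initial_continuous.
  exact: (@proj_continuous _ (fun=> M) i).
have c1 : ccont (fun y : Conf => (coefs_of_conf y).1) by exact: ccontM.
have c2 : ccont (fun y : Conf => (coefs_of_conf y).2).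
  by apply: ccontM; apply: ccontD; [exact: ccont_cst|exact: ccontN|exact: ccont_cst|exact: ccontN].
have e : (fun y : Conf => coefs (\pi_X y)) = coefs_of_conf by apply/funext; exact: coefs_pi.
rewrite -e in c1 c2.
by split; split; apply/quotient_continuous; [exact: c1.1|exact: c1.2|exact: c2.1|exact: c2.2].
Qed.

Lemma mid_coefs x : mid (coefs x) =
  (zeta (val (repr x : Conf) ord0) + zeta (val (repr x : Conf) ord_max)) / 2.
Proof. by rewrite /mid /=; field. Qed.

Lemma dsc_coefs x : dsc (coefs x) =
  ((zeta (val (repr x : Conf) ord0) - zeta (val (repr x : Conf) ord_max)) / 2) ^+ 2.
Proof. by rewrite /dsc mid_coefs /=; field. Qed.

Lemma repr_neq (x : X) : val (repr x : Conf) ord0 <> val (repr x : Conf) ord_max.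
Proof. by have := valP (repr x : Conf); rewrite inE /=; apply. Qed.

Lemma Zset_coefs x : Zset (coefs x).
Proof.
have z1 y : 1 - zeta y != 0 by rewrite subr_eq0 eq_sym zeta1.
split; [exact: mulf_neq0|exact: mulf_neq0|].
rewrite dsc_coefs expf_neq0// mulf_neq0 ?invr_eq0 ?pnatr_eq0// subr_eq0.
by apply/eqP => /(can_inj zetaK); exact: repr_neq.
Qed.

Lemma of_coefsK : cancel coefs of_coefs.
Proof.
move=> x; rewrite (of_coefsE (esym (dsc_coefs x))) mid_coefs /of_roots.
set y := repr x : Conf; set z := zeta _; set w := zeta (val y ord_max).
rewrite (_ : _ + _ = z); last by field.
rewrite (_ : _ - _ = w); last by field.
rewrite !zetaK -[RHS]reprK; congr (\pi_X _); apply: val_inj.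
rewrite val_conf; last exact: repr_neq.
by apply/funext => i; case: (ord2 i) => ->.
Qed.

Lemma pair_lower_central_elementary (i : nat) : (1 < i)%N -> exists n,
  group_isomorphic (lower_central_quotient (fundamental_group R c) i) {ffun 'I_n -> 'Z_2}.
Proof.
exact: (pi1_lower_central_elementary c of_coefs_continuous vcont_coefs Zset_coefs of_coefsK).
Qed.

End PairOfPoints.

Lemma mx_continuous (T U : topologicalType) m n (f : T -> 'M[U]_(m, n)) :
  (forall i j, continuous (fun t => f t i j)) -> continuous f.
Proof.
move=> cf t A [P Pf PA]; near=> x; apply: PA => i j; move: i j; near: x.
apply: filter_forall => i; apply: filter_forall => j; exact: (cf i j t _ (Pf i j)).
Unshelve. all: by end_near. Qed.

(** * The punctured sphere *)

Section Reflection.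
Variable R : realType.
Local Notation R3 := (R * R * R)%type.

Definition dot3 (t v : R3) : R := t.1.1 * v.1.1 + t.1.2 * v.1.2 + t.2 * v.2.

Definition norm3 (t : R3) : R := t.1.1 ^+ 2 + t.1.2 ^+ 2 + t.2 ^+ 2.

(** For k = 2 / |v|^2, the reflection in the plane orthogonal to [v]. The hypothesis [kv] also
    admits k = 0, the identity. *)
Definition reflect3 (k : R) (v t : R3) : R3 :=
  (t.1.1 - k * dot3 t v * v.1.1, t.1.2 - k * dot3 t v * v.1.2, t.2 - k * dot3 t v * v.2).

Variables (k : R) (v : R3).
Hypothesis kv : 2 * k = k * (k * norm3 v).

Lemma reflect3K : involutive (reflect3 k v).
Proof.
move: kv; rewrite /norm3; case: v => -[v0 v1] v2 /= h [[a b] d].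
have e x (w : R) : x + (k * (k * (v0 ^+ 2 + v1 ^+ 2 + v2 ^+ 2)) - 2 * k) * w = x.
  by rewrite h subrr mul0r addr0.
rewrite /reflect3 /dot3 /=; congr (_, _, _).
- by rewrite -[RHS](e a ((a * v0 + b * v1 + d * v2) * v0)); ring.
- by rewrite -[RHS](e b ((a * v0 + b * v1 + d * v2) * v1)); ring.
- by rewrite -[RHS](e d ((a * v0 + b * v1 + d * v2) * v2)); ring.
Qed.

Lemma norm3_reflect3 t : norm3 (reflect3 k v t) = norm3 t.
Proof.
move: kv; rewrite /norm3; case: v => -[v0 v1] v2 /= h; case: t => -[a b] d.
rewrite /reflect3 /dot3 /=; apply: subr0_eq.
transitivity ((k * (k * (v0 ^+ 2 + v1 ^+ 2 + v2 ^+ 2)) - 2 * k) * (a * v0 + b * v1 + d * v2) ^+ 2).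
  ring.
by rewrite h subrr mul0r.
Qed.

End Reflection.

(** * Stereographic projection from an arbitrary point *)

Section SphereChart.
Variables (R : realType) (p : sphere2 R).
Local Notation C := R[i].
Local Notation R3 := (R * R * R)%type.

Definition triple (y : sphere2 R) : R3 :=
  (val y ord0 ord0, val y ord0 (inord 1), val y ord0 ord_max).

Definition row3 (t : R3) : 'rV[R]_3 := \row_j nth 0 [:: t.1.1; t.1.2; t.2] j.

Lemma sum_row (v : 'rV[R]_3) : \sum_(i < 3) v ord0 i ^+ 2 =
  norm3 (v ord0 ord0, v ord0 (inord 1), v ord0 ord_max).
Proof.
rewrite !big_ord_recr big_ord0 /= add0r /norm3 /=.
by do 2 congr (_ + _); congr (v _ _ ^+ 2); apply: val_inj; rewrite /= ?inordK.
Qed.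

Lemma norm3_triple y : norm3 (triple y) = 1.
Proof. by have := valP y; rewrite inE /= sum_row. Qed.

Definition of_triple (t : R3) : sphere2 R := insubd p (row3 t).

Lemma val_of_triple t : norm3 t = 1 -> val (of_triple t) = row3 t.
Proof.
move=> t1; rewrite val_insubd ifT// inE /= sum_row -[RHS]t1 /norm3 /row3 !mxE /=.
by rewrite inordK.
Qed.

Lemma of_tripleK t : norm3 t = 1 -> triple (of_triple t) = t.
Proof.
move=> t1; rewrite /triple val_of_triple// !mxE /= inordK//=.
by case: t {t1} => [[]].
Qed.

Lemma tripleK : cancel triple of_triple.
Proof.
move=> y; apply: val_inj; rewrite val_of_triple ?norm3_triple//.
apply/rowP => -[[|[|[|//]]] h]; rewrite mxE /=; congr (val y _ _); apply: val_inj; by rewrite /= ?inordK.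
Qed.

Definition pole_axis : R3 := ((triple p).1.1, (triple p).1.2, (triple p).2 - 1).

(* Exchanges p and the north pole; if p is the north pole, the inverse is 0 and this is
   the identity. *)
Definition reflect_pole : R3 -> R3 := reflect3 (1 - (triple p).2)^-1 pole_axis.

(** For a unit vector p with last coordinate d, the squared distance to the north pole is 2 (1 -
    d). *)
Lemma pole_axisE : 2 * (1 - (triple p).2)^-1 =
  (1 - (triple p).2)^-1 * ((1 - (triple p).2)^-1 * norm3 pole_axis).
Proof.
have := norm3_triple p; rewrite /norm3 /pole_axis.
case: (triple p) => -[a b] d /= abd.
have -> : a ^+ 2 + b ^+ 2 + (d - 1) ^+ 2 = 2 * (1 - d).
  by transitivity (a ^+ 2 + b ^+ 2 + d ^+ 2 + 1 - 2 * d); [ring|rewrite abd; ring].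
have [->|d1] := eqVneq (1 - d) 0; first by rewrite invr0; ring.
by field.
Qed.

Lemma reflect_poleK : involutive reflect_pole.
Proof. exact: reflect3K pole_axisE. Qed.

Lemma norm3_reflect_pole t : norm3 (reflect_pole t) = norm3 t.
Proof. exact: norm3_reflect3 pole_axisE t. Qed.

Lemma reflect_pole_p : reflect_pole (triple p) = (0, 0, 1).
Proof.
have := norm3_triple p; rewrite /reflect_pole /reflect3 /dot3 /pole_axis /norm3.
case: (triple p) => -[a b] d /= abd.
have [d1|d1] := eqVneq d 1.
  have [a0 b0] : a = 0 /\ b = 0.
    move: abd; rewrite d1 expr1n => /eqP; rewrite -subr_eq0 addrK paddr_eq0 ?sqr_ge0//.
    by rewrite !sqrf_eq0 => /andP[/eqP ? /eqP ?].
  by rewrite a0 b0 d1 subrr; congr (_, _, _); ring.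
have d2 : 1 - d != 0 by rewrite subr_eq0 eq_sym.
have -> : a * a + b * b + d * (d - 1) = 1 - d by transitivity (a ^+ 2 + b ^+ 2 + d ^+ 2 - d); [ring|rewrite abd].
by rewrite mulVf//; congr (_, _, _); ring.
Qed.

Lemma reflect_pole_top t : norm3 t = 1 -> (reflect_pole t).2 = 1 -> t = triple p.
Proof.
move=> t1 h; apply: (inv_inj reflect_poleK); rewrite reflect_pole_p.
move: t1; rewrite -norm3_reflect_pole; case: (reflect_pole t) h => -[a b] d /= ->.
rewrite /norm3 /= expr1n => /eqP; rewrite -subr_eq0 addrK paddr_eq0 ?sqr_ge0//.
by rewrite !sqrf_eq0 => /andP[/eqP-> /eqP->].
Qed.

Definition stereo (y : sphere2 R) : C :=
  let t := reflect_pole (triple y) in (t.1.1 / (1 - t.2)) +i* (t.1.2 / (1 - t.2)).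

(** The usual inverse projection (2 x, 2 y, |z|^2 - 1) / (|z|^2 + 1). *)
Definition unstereo3 (z : C) : R3 :=
  let D := Re z ^+ 2 + Im z ^+ 2 + 1 in (2 * Re z / D, 2 * Im z / D, (D - 2) / D).

Definition unstereo (z : C) : sphere2 R := of_triple (reflect_pole (unstereo3 z)).

Lemma unstereo_denom (z : C) : Re z ^+ 2 + Im z ^+ 2 + 1 != 0.
Proof. by rewrite gt_eqF// ltr_wpDl// addr_ge0 ?sqr_ge0. Qed.

Lemma norm3_unstereo3 z : norm3 (unstereo3 z) = 1.
Proof. by have := unstereo_denom z; rewrite /norm3 /unstereo3 /= => D0; field. Qed.

Lemma unstereoK : cancel unstereo stereo.
Proof.
move=> z; rewrite /stereo of_tripleK ?norm3_reflect_pole ?norm3_unstereo3//.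
rewrite reflect_poleK /unstereo3; have := unstereo_denom z.
case: z => a b /= D0.
have -> : 1 - (a ^+ 2 + b ^+ 2 + 1 - 2) / (a ^+ 2 + b ^+ 2 + 1) =
  2 / (a ^+ 2 + b ^+ 2 + 1) by field.
by congr (_ +i* _); field.
Qed.

Lemma stereoK y : y <> p -> unstereo (stereo y) = y.
Proof.
move=> yp; rewrite -[RHS]tripleK /unstereo; congr of_triple.
apply: (canLR reflect_poleK); have h := norm3_reflect_pole (triple y).
have t1 : 1 - (reflect_pole (triple y)).2 != 0.
  apply: contra_notN yp; rewrite subr_eq0 eq_sym => /eqP.
  by move=> /(reflect_pole_top (norm3_triple y)) /(can_inj tripleK).
rewrite norm3_triple in h; rewrite /unstereo3 /stereo.
move: h t1; case: (reflect_pole _) => -[a b] d; rewrite /norm3 /= => h d1.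
have e : (a / (1 - d)) ^+ 2 + (b / (1 - d)) ^+ 2 + 1 = 2 / (1 - d).
  transitivity ((a ^+ 2 + b ^+ 2 + d ^+ 2 + 1 - 2 * d) / (1 - d) ^+ 2); first by field.
  by rewrite h; field.
by rewrite e; congr (_, _, _); field.
Qed.

Lemma unstereo_neq z : unstereo z <> p.
Proof.
move=> /(congr1 triple); rewrite of_tripleK ?norm3_reflect_pole ?norm3_unstereo3//.
move=> /(congr1 reflect_pole); rewrite reflect_poleK reflect_pole_p => /(congr1 snd) /=.
have D0 := unstereo_denom z; move=> /(congr1 ( *%R^~ (Re z ^+ 2 + Im z ^+ 2 + 1))).
by rewrite divfK// mul1r => /eqP; rewrite -subr_eq0 addrAC subrr add0r oppr_eq0 pnatr_eq0.
Qed.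

Section Continuity.
Variable T : topologicalType.

Let cont3 (f : T -> R3) := [/\ continuous (fun t => (f t).1.1),
  continuous (fun t => (f t).1.2) & continuous (fun t => (f t).2)].

Lemma reflect_pole_continuous (f : T -> R3) : cont3 f -> cont3 (fun t => reflect_pole (f t)).
Proof.
case=> f1 f2 f3.
have aff (u : T -> R) (w : R) : continuous u -> continuous (fun t =>
    u t - (1 - (triple p).2)^-1 * dot3 (f t) pole_axis * w).
  move=> cu t; apply: cvgB; first exact: cu.
  apply: cvgM; last exact: cvg_cst.
  apply: cvgM; first exact: cvg_cst.
  by apply: cvgD; [apply: cvgD|]; (apply: cvgM; last exact: cvg_cst); [exact: f1|exact: f2|exact: f3].
by split; exact: aff.
Qed.

Lemma triple_continuous (y : T -> sphere2 R) : continuous y -> cont3 (fun t => triple (y t)).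
Proof.
move=> cy; have c (i : 'I_3) : continuous (fun t => val (y t) ord0 i).
  move=> t; apply: (@continuous_comp _ _ _ y (fun x : sphere2 R => val x ord0 i)); first exact: cy.
  apply: (@continuous_comp _ _ _ (val : sphere2 R -> 'rV[R]_3) (fun M => M ord0 i)).
    exact: initial_continuous.
  exact: coord_continuous.
by split; exact: c.
Qed.

Lemma of_triple_continuous (f : T -> R3) : cont3 f -> (forall t, norm3 (f t) = 1) ->
  continuous (fun t => of_triple (f t)).
Proof.
case=> f1 f2 f3 f_norm; apply/(continuous_comp_initial (f := fun t => of_triple (f t))).
rewrite (_ : _ \o _ = fun t => row3 (f t)); last first.
  by apply/funext => t /=; rewrite -[LHS]/(val (of_triple (f t))) val_of_triple.
apply: mx_continuous => i j; rewrite /row3; under eq_fun do rewrite mxE.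
by case: j => [[|[|[|//]]] h] /=.
Qed.

Lemma stereo_continuous (y : T -> sphere2 R) : continuous y -> (forall t, y t <> p) ->
  ccont (fun t => stereo (y t)).
Proof.
move=> cy yp; have [c1 c2 c3] := reflect_pole_continuous (triple_continuous cy).
have h t : 1 - (reflect_pole (triple (y t))).2 != 0.
  apply: contra_notN (yp t); rewrite subr_eq0 eq_sym => /eqP.
  by move=> /(reflect_pole_top (norm3_triple _)) /(can_inj tripleK).
have ci : continuous (fun t => (1 - (reflect_pole (triple (y t))).2)^-1).
  by move=> t; apply: cvgV => //; apply: cvgB; [exact: cvg_cst|exact: c3].
by split=> t; apply: cvgM; [exact: c1|exact: ci|exact: c2|exact: ci].
Qed.

Lemma unstereo_continuous (z : T -> C) : ccont z -> continuous (fun t => unstereo (z t)).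
Proof.
move=> [cr ci]; have cD : continuous (fun t => Re (z t) ^+ 2 + Im (z t) ^+ 2 + 1).
  move=> t; apply: cvgD; last exact: cvg_cst.
  by under eq_fun do rewrite !expr2; apply: cvgD; apply: cvgM; [exact: cr|exact: cr|exact: ci|exact: ci].
have cV : continuous (fun t => (Re (z t) ^+ 2 + Im (z t) ^+ 2 + 1)^-1).
  by move=> t; apply: cvgV; [exact: unstereo_denom|exact: cD].
apply: of_triple_continuous; last by move=> t; rewrite norm3_reflect_pole norm3_unstereo3.
apply: reflect_pole_continuous; split=> t; apply: cvgM; try exact: cV.
- by apply: cvgM; [exact: cvg_cst|exact: cr].
- by apply: cvgM; [exact: cvg_cst|exact: ci].
- by apply: cvgB; [exact: cD|exact: cvg_cst].
Qed.

End Continuity.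

End SphereChart.

(** * The affine coordinate with punctures at 0, 1 and infinity *)

Section PuncturedSphere.
Variables (R : realType) (x1 x2 x3 : sphere2 R).
Hypotheses (x12 : x1 <> x2) (x13 : x1 <> x3) (x23 : x2 <> x3).
Local Notation C := R[i].
Local Notation M := (punctured_sphere x1 x2 x3).
Variable m0 : M.

Let u : C := stereo x3 x1.
Let w : C := stereo x3 x2.

Let wu : w - u != 0.
Proof.
rewrite subr_eq0; apply/eqP => /(congr1 (unstereo x3)).
by rewrite !stereoK// => /esym.
Qed.

Definition affine_coord (y : M) : C := (stereo x3 (val y) - u) / (w - u).

(** Takes the default value [m0] at z = 0 and z = 1. *)
Definition affine_point (z : C) : M := insubd m0 (unstereo x3 (u + z * (w - u))).

Lemma puncturedP (y : M) : [/\ val y <> x1, val y <> x2 & val y <> x3].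
Proof.
have := valP y; rewrite inE /= => h.
by split=> e; apply: h; [left; left|left; right|right].
Qed.

Lemma affine_coord0 y : affine_coord y != 0.
Proof.
have [y1 _ y3] := puncturedP y; rewrite mulf_neq0 ?invr_eq0// subr_eq0.
by apply/eqP => /(congr1 (unstereo x3)); rewrite !stereoK.
Qed.

Lemma affine_coord1 y : affine_coord y != 1.
Proof.
have [_ y2 y3] := puncturedP y; apply/eqP => /(congr1 ( *%R^~ (w - u))).
rewrite divfK// mul1r => /(congr1 (+%R^~ u)); rewrite !subrK => /(congr1 (unstereo x3)).
by rewrite !stereoK.
Qed.

Lemma val_affine_point z : z != 0 -> z != 1 ->
  val (affine_point z) = unstereo x3 (u + z * (w - u)).
Proof.
move=> z0 z1; rewrite val_insubd ifT// inE => -[[e|e]|]; last exact: unstereo_neq.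
- move/(congr1 (stereo x3)): e; rewrite unstereoK -/u => /eqP.
  by rewrite -subr_eq0 addrAC subrr add0r mulf_eq0 (negbTE z0) (negbTE wu).
- move/(congr1 (stereo x3)): e; rewrite unstereoK -/w => /eqP.
  rewrite -subr_eq0 (_ : _ - _ = (z - 1) * (w - u)); last by ring.
  by rewrite mulf_eq0 subr_eq0 (negbTE z1) (negbTE wu).
Qed.

Lemma affine_pointK z : z != 0 -> z != 1 -> affine_coord (affine_point z) = z.
Proof.
move=> z0 z1; rewrite /affine_coord val_affine_point// unstereoK.
by rewrite addrAC subrr add0r mulfK.
Qed.

Lemma affine_coordK : cancel affine_coord affine_point.
Proof.
move=> y; have [_ _ y3] := puncturedP y.
apply: val_inj; rewrite val_affine_point ?affine_coord0 ?affine_coord1//.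
by rewrite divfK// addrC subrK stereoK.
Qed.

Lemma ccont_affine_coord : ccont affine_coord.
Proof.
apply: ccontM; last exact: ccont_cst.
apply: ccontD; last exact: ccont_cst.
apply: stereo_continuous; last by move=> y; case: (puncturedP y).
exact: initial_continuous.
Qed.

Lemma affine_point_continuous (T : topologicalType) (z : T -> C) : ccont z ->
  (forall t, z t != 0) -> (forall t, z t != 1) -> continuous (affine_point \o z).
Proof.
move=> cz z0 z1; apply/(continuous_comp_initial (f := affine_point \o z)).
rewrite (_ : _ \o _ = fun t => unstereo x3 (u + z t * (w - u))); last first.
  by apply/funext => t /=; rewrite -[LHS]/(val (affine_point (z t))) val_affine_point.
apply: unstereo_continuous; apply: ccontD; first exact: ccont_cst.
by apply: ccontM => //; exact: ccont_cst.
Qed.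

End PuncturedSphere.

Theorem proposition60 (R : realType) (x1 x2 x3 : sphere2 R)
    (x12 : x1 <> x2) (x13 : x1 <> x3) (x23 : x2 <> x3)
    (c : unordered_configuration_space 2 (punctured_sphere x1 x2 x3))
    (i : nat) (hi : (2 <= i)%N) :
  exists n : nat,
    group_isomorphic (lower_central_quotient (braid_group R c) i)
      {ffun 'I_n -> 'Z_2}.
Proof.
(* The base configuration provides the default point of the surface. *)
pose m0 := val (repr c : configuration_space 2 (punctured_sphere x1 x2 x3)) ord0.
apply: (@pair_lower_central_elementary R _ (@affine_coord R x1 x2 x3) (affine_point m0)) hi.
- exact: ccont_affine_coord.
- exact: affine_coord0.
- exact: affine_coord1.
- exact: affine_pointK.
- exact: affine_coordK.
- exact: affine_point_continuous.
Qed.
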